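(* Let $p>1$ and let $f$ be a real-valued harmonic function on the unit disk $\mathbf{U}$. Then $$\|f\|_{b^{2p}}\le C_p\,\|f\|_{h^p},$$ where $$C_p=\begin{cases}\dfrac{\cos\frac{\pi}{4p}}{\cos\frac{\pi}{2p}}, & \text{if } 1<p\le 2,\\[3mm] \dfrac{\cos\frac{\pi}{4p}}{\sin\frac{\pi}{2p}}, & \text{if } p\ge 2.\end{cases}$$
   Context: $\mathbf{U}=\{z\in\mathbb{C}:|z|<1\}$. For a harmonic function $f$ on $\mathbf{U}$ and $0<s<\infty$, the harmonic Bergman norm is $\|f\|_{b^s}=\left(\frac1\pi\int_{\mathbf{U}}|f(z)|^s\,dx\,dy\right)^{1/s}$ with $z=x+iy$, and the harmonic Hardy norm is $\|f\|_{h^s}=\sup_{0\le r<1}\left(\frac{1}{2\pi}\int_0^{2\pi}|f(re^{it})|^s\,dt\right)^{1/s}$. Both may take the value $+\infty$; $h^s$ is the space of harmonic functions on $\mathbf{U}$ with $\|f\|_{h^s}<\infty$. (If $\|f\|_{h^p}=\infty$ the inequality is vacuous.) *)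

(* Defs.v *)
From HB Require Import structures.
From mathcomp Require Import all_boot all_order all_algebra.
From mathcomp Require Import all_classical all_reals all_analysis.

Set Implicit Arguments.
Unset Strict Implicit.
Unset Printing Implicit Defensive.

Import Order.TTheory GRing.Theory Num.Theory.
Import numFieldNormedType.Exports.

Local Open Scope classical_set_scope.
Local Open Scope ring_scope.

(* The complex plane is R * R, with z = x + iy represented by (x, y). *)
Definition unit_disk (R : realType) : set (R * R) :=
  [set z | z.1 ^+ 2 + z.2 ^+ 2 < 1].
Arguments unit_disk R : clear implicits.

Definition partialx (R : realType) (f : R * R -> R) : R * R -> R :=
  fun z => 'D_((1, 0) : R * R) f z.

Definition partialy (R : realType) (f : R * R -> R) : R * R -> R :=
  fun z => 'D_((0, 1) : R * R) f z.

(* Meant for open D. The function f is total, but its values outside D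
   are irrelevant, since derivatives and limits at a point of D only
   depend on f near that point. *)
Definition C1_on (R : realType) (D : set (R * R)) (f : R * R -> R) : Prop :=
  forall z, D z ->
    [/\ derivable f z ((1, 0) : R * R), derivable f z ((0, 1) : R * R),
        {for z, continuous (partialx f)} &
        {for z, continuous (partialy f)}].

Definition C2_on (R : realType) (D : set (R * R)) (f : R * R -> R) : Prop :=
  [/\ C1_on D f, C1_on D (partialx f) & C1_on D (partialy f)].

Definition laplacian (R : realType) (f : R * R -> R) : R * R -> R :=
  fun z => partialx (partialx f) z + partialy (partialy f) z.

Definition harmonic_on (R : realType) (D : set (R * R)) (f : R * R -> R) :
    Prop :=
  C2_on D f /\ forall z, D z -> laplacian f z = 0.

(* Both norms are extended reals: (+oo) `^ s^-1 = +oo for 0 < s. *)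
Definition bergman_norm (R : realType) (s : R) (f : R * R -> R) : \bar R :=
  (((pi^-1)%:E *
    \int[(@lebesgue_measure R \x @lebesgue_measure R)%E]_(z in unit_disk R)
      (`|f z| `^ s)%:E) `^ s^-1)%E.

Definition hardy_norm (R : realType) (s : R) (f : R * R -> R) : \bar R :=
  ereal_sup [set ((((2 * pi)^-1)%:E *
    \int[@lebesgue_measure R]_(t in `[0%R, (2 * pi)%R])
      (`|f (r * cos t, r * sin t)%R| `^ s)%:E) `^ s^-1)%E
    | r in [set r : R | 0 <= r < 1]].

Definition bergman_hardy_const (R : realType) (p : R) : R :=
  if p <= 2 then cos (pi / (4 * p)) / cos (pi / (2 * p))
  else cos (pi / (4 * p)) / sin (pi / (2 * p)).

(* The two cases agree at p = 2. *)
Lemma bergman_hardy_const_ge2 (R : realType) (p : R) : 2 <= p ->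
  bergman_hardy_const p = cos (pi / (4 * p)) / sin (pi / (2 * p)).
Proof.
rewrite le_eqVlt /bergman_hardy_const => /predU1P[<-|p2]; last by rewrite leNgt p2.
rewrite lexx; congr (_ / _).
have {1}-> : pi / (2 * 2) = pi / 2 - pi / (2 * 2) :> R.
  rewrite invfM mulrA; apply/eqP; rewrite eq_sym subr_eq.
  by rewrite -splitr.
by rewrite cosB cos_pihalf sin_pihalf mul0r mul1r add0r.
Qed.

(* Main.v *)
(* Write c for cos (pi / 2p) if p <= 2 and for sin (pi / 2p) if p >= 2, and
   k = cos (pi / 4p), so that C_p = k / c. It suffices to treat the
   dilations u(z) = f(r z), r < 1, and then to let r tend to 1 by Fatou's lemma.
   Fejer kernels and the maximum principle approximate u, uniformly on the closed
   disk, by Re P for a complex polynomial P normalised by Im P(0) = Re P(0) <> 0.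
   Three estimates are combined:
   - on the circle, c^p mean |P|^p <= mean |Re P|^p;
   - on the disk, int |Re P|^(2p) <= k^(2p) int |P|^(2p);
   - Carleman's inequality int |P|^(2p) <= pi (mean |P|^p)^2.
   The first two come from pointwise inequalities such as
   c^p |w|^p + b psi(w) <= |Re w|^p, with b >= 0, where psi is a subharmonic function,
   homogeneous of degree p (or 2p), which is nonnegative on the diagonals
   |Re w| = |Im w|; so the mean of psi o P is at least psi(P(0)) >= 0.
   For |P|^p replaced by |g|^2 with g a polynomial, Carleman's inequality is
   Cauchy-Schwarz on the coefficients of g^2; the general case follows by
   majorising |P|^p on the disk by |e^Q|^2 = |lim (1 + Q / N)^N|^2 with
   2 Re Q close to p ln |P| on the circle.
   Subharmonicity of a continuous function G is used in the weak form
   G(z+h) + G(z-h) + G(z+ih) + G(z-ih) >= 4 G(z) - o(h^2), which suffices for the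
   maximum principle. *)

Require Import Defs.
From mathcomp Require Import all_boot all_order all_algebra.
From mathcomp Require Import complex.
From mathcomp Require Import all_classical all_reals all_analysis.
From mathcomp Require Import measurable_realfun.
From mathcomp Require Import ring lra.

Set Implicit Arguments.
Unset Strict Implicit.
Unset Printing Implicit Defensive.

Import Order.TTheory GRing.Theory Num.Theory.
Import numFieldNormedType.Exports.

Local Open Scope classical_set_scope.
Local Open Scope ring_scope.
Local Notation normc := Normc.normc.

(** * Complex numbers and Fejer approximation *)

Section complex_plane.
Variable R : realType.
Local Notation C := R[i].
Implicit Types (z w : C) (P Q S : {poly C}).

(** Since f is real, only Re P is prescribed and Im P(0) is free. On a diagonal the angle to the
    real axis is pi / 4, and cos (s pi / 4) changes sign exactly at s = 2, where psi changes from Re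
    w^s to a truncation of - Re w^s; so one normalisation of P(0) serves the exponents p and 2 p,
    and it survives the quarter turn i P used for p > 2. P(0) must not be 0 because zeros of P are
    handled by a barrier d ln |P|, whose value at 0 has to be finite.

    The constants come from tangency. At t0 = pi / (2 s) the term cos (s t) vanishes, so the
    pointwise inequality becomes an equality there with constant cos t0^s or sin t0^s, and b is
    forced by equality of the slopes. The circle uses s = p and the disk s = 2 p, whence the angles
    pi / 2p and pi / 4p.

    Rotations take the place of polar coordinates: a disk integral is unchanged by averaging the
    integrand over n rotations, and averages over the n-th roots of unity are exact on polynomials
    of size at most n. *)

Lemma ReD z w : complex.Re (z + w) = complex.Re z + complex.Re w.
Proof. by case: z w => [? ?] [? ?]. Qed.

Lemma ImD z w : complex.Im (z + w) = complex.Im z + complex.Im w.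
Proof. by case: z w => [? ?] [? ?]. Qed.

Lemma ReN z : complex.Re (- z) = - complex.Re z.
Proof. by case: z. Qed.

Lemma ImN z : complex.Im (- z) = - complex.Im z.
Proof. by case: z. Qed.

Lemma ReB z w : complex.Re (z - w) = complex.Re z - complex.Re w.
Proof. by rewrite ReD ReN. Qed.

Lemma ImB z w : complex.Im (z - w) = complex.Im z - complex.Im w.
Proof. by rewrite ImD ImN. Qed.

Lemma ReM z w :
  complex.Re (z * w) = complex.Re z * complex.Re w - complex.Im z * complex.Im w.
Proof. by case: z w => [? ?] [? ?]. Qed.

Lemma ImM z w :
  complex.Im (z * w) = complex.Re z * complex.Im w + complex.Im z * complex.Re w.
Proof. by case: z w => [? ?] [? ?]. Qed.

Lemma ReMr (a : R) z : complex.Re (a%:C%C * z) = a * complex.Re z.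
Proof. by rewrite ReM /= mul0r subr0. Qed.

Lemma ImMr (a : R) z : complex.Im (a%:C%C * z) = a * complex.Im z.
Proof. by rewrite ImM /= mul0r addr0. Qed.

Lemma Re_sum (I : Type) (r : seq I) (p : pred I) (F : I -> C) :
  complex.Re (\sum_(i <- r | p i) F i) = \sum_(i <- r | p i) complex.Re (F i).
Proof. by apply: (big_morph _ ReD). Qed.

Lemma eqC z w :
  complex.Re z = complex.Re w -> complex.Im z = complex.Im w -> z = w.
Proof. by case: z w => [? ?] [? ?] /= -> ->. Qed.

Lemma sqr_normc z : normc z ^+ 2 = complex.Re z ^+ 2 + complex.Im z ^+ 2.
Proof. by case: z => x y /=; rewrite sqr_sqrtr// addr_ge0// sqr_ge0. Qed.

Lemma normc_ge0 z : 0 <= normc z.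
Proof. by case: z => x y; apply: sqrtr_ge0. Qed.

Lemma normc0 : normc (0 : C) = 0.
Proof. by rewrite /Normc.normc /= expr0n addr0 sqrtr0. Qed.

Lemma normc_eq0 z : (normc z == 0) = (z == 0).
Proof.
by apply/eqP/eqP => [/Normc.eq0_normc|->]; rewrite ?normc0.
Qed.

Lemma normc_gt0 z : (0 < normc z) = (z != 0).
Proof. by rewrite lt_def normc_ge0 andbT normc_eq0. Qed.

Lemma normcR (a : R) : normc (a%:C%C : C) = `|a|.
Proof. by rewrite /normc /= expr0n addr0 sqrtr_sqr. Qed.

Lemma normcX z n : normc (z ^+ n) = normc z ^+ n.
Proof. by elim: n => [|n IH]; rewrite ?expr0 ?Normc.normc1// !exprS Normc.normcM IH. Qed.

Lemma normc_le_sqr z (a : R) : 0 <= a ->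
  complex.Re z ^+ 2 + complex.Im z ^+ 2 <= a ^+ 2 -> normc z <= a.
Proof. by move=> a0; rewrite -sqr_normc ler_sqr// nnegrE normc_ge0. Qed.

Lemma normRe_le z : `|complex.Re z| <= normc z.
Proof.
rewrite -ler_sqr ?nnegrE ?normc_ge0// sqr_normc.
by rewrite real_normK ?num_real// lerDl sqr_ge0.
Qed.

Lemma normIm_le z : `|complex.Im z| <= normc z.
Proof.
rewrite -ler_sqr ?nnegrE ?normc_ge0// sqr_normc.
by rewrite real_normK ?num_real// lerDr sqr_ge0.
Qed.

Lemma Re_le_normc z : complex.Re z <= normc z.
Proof. exact: le_trans (ler_norm _) (normRe_le z). Qed.

Lemma ler_normc_sum (I : Type) (r : seq I) (p : pred I) (F : I -> C) :
  normc (\sum_(i <- r | p i) F i) <= \sum_(i <- r | p i) normc (F i).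
Proof.
apply: (big_ind2 (fun x y => normc x <= y)) => //; first by rewrite normc0.
move=> x1 x2 y1 y2 h1 h2; apply: le_trans (le_normcD _ _) _; exact: lerD.
Qed.

Definition cis (t : R) : C := (cos t +i* sin t)%C.

Lemma normc_cis t : normc (cis t) = 1.
Proof. by rewrite /normc /= cos2Dsin2 sqrtr1. Qed.

Lemma cisD s t : cis (s + t) = cis s * cis t.
Proof. by apply: eqC; rewrite /= ?cosD ?sinD ?ReM ?ImM //=; ring. Qed.

Lemma cis0 : cis 0 = 1.
Proof. by apply: eqC; rewrite /= ?cos0 ?sin0. Qed.

Lemma cisX t n : cis t ^+ n = cis (t *+ n).
Proof. by elim: n => [|n IH]; rewrite ?mulr0n ?cis0// exprS IH mulrS cisD. Qed.

(** * Averages over roots of unity and Parseval's identity *)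

Definition root1 (n : nat) : C := cis (2 * pi / n%:R).

Lemma normc_root1 n : normc (root1 n) = 1.
Proof. exact: normc_cis. Qed.

Lemma root1X n : (0 < n)%N -> root1 n ^+ n = 1.
Proof.
move=> n0; rewrite /root1 cisX -[_ *+ n]mulr_natr divfK ?pnatr_eq0 -?lt0n//.
by apply: eqC; rewrite /= mulr_natl ?cos2pi ?sin2pi.
Qed.

(** Half the argument, x = pi m / n, lies strictly between 0 and pi, so sin x > 0, whereas cos (2 x)
    = 1 would force sin x = 0. *)
Lemma root1X_neq1 n m : (0 < m < n)%N -> root1 n ^+ m != 1.
Proof.
case/andP => m0 mn; apply/negP => /eqP /(congr1 (@complex.Re R)).
rewrite /root1 cisX /=.
have n0 : (0 : R) < n%:R by rewrite ltr0n (leq_trans _ mn).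
set x : R := pi * (m%:R / n%:R).
have -> : (2 * pi / n%:R) *+ m = x *+ 2 :> R.
  by rewrite /x -mulr_natl -[in RHS]mulr_natl mulrA mulrC; ring.
rewrite mulr2n cosD -!expr2 => cx.
have sx0 : sin x = 0.
  apply/eqP; rewrite -sqrf_eq0; apply/eqP.
  have := cos2Dsin2 x; nra.
have : 0 < sin x.
  apply: sin_gt0_pi; rewrite /x mulr_gt0 ?pi_gt0 ?divr_gt0 ?ltr0n//=.
  by rewrite gtr_pMr ?pi_gt0// ltr_pdivrMr// mul1r ltr_nat.
  exact: leq_trans mn.
by rewrite sx0 ltxx.
Qed.

(** The powers z^k with 0 < k < n cancel by the geometric sum; the bound on the size of Q excludes k
    = n, which would not cancel. *)
Lemma sum_root1 n Q z : (size Q <= n)%N -> (0 < n)%N ->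
  \sum_(j < n) Q.[z * root1 n ^+ j] = n%:R * Q.[0].
Proof.
move=> sQ n0.
under eq_bigr do rewrite (horner_coef_wide _ sQ).
rewrite exchange_big/= horner_coef0.
case: n n0 sQ => // n _ sQ.
rewrite big_ord_recl /= [X in _ + X]big1 ?addr0.
  under eq_bigr do rewrite expr0 mulr1.
  by rewrite sumr_const card_ord mulr_natl.
move=> i _; under eq_bigr do rewrite exprMn -exprM mulnC exprM mulrA.
rewrite -mulr_sumr.
suff -> : \sum_(j < n.+1) (root1 n.+1 ^+ bump 0 i) ^+ j = 0 by rewrite mulr0.
have := subrX1 (root1 n.+1 ^+ bump 0 i) n.+1.
rewrite -exprM mulnC exprM root1X// expr1n subrr => /esym/eqP.
rewrite mulf_eq0 subr_eq0 => /orP[/eqP h|/eqP//].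
have := @root1X_neq1 n.+1 (bump 0 i).
by rewrite h eqxx /bump leq0n add1n /= ltnS ltn_ord => /(_ isT).
Qed.

(* On the unit circle |z S + c|^2 = |S|^2 + |c|^2 + 2 Re (c^* z S). *)
Fixpoint sqpoly (n : nat) (S : {poly C}) : {poly C} :=
  if n is n'.+1 then
    let S1 := \poly_(i < n') S`_i.+1 in
    sqpoly n' S1 + ((normc S`_0 ^+ 2)%:C%C)%:P + (2%:C * (S`_0)^*)%C *: (S1 * 'X)
  else 0.

Lemma size_sqpoly n S : (size (sqpoly n S) <= n)%N.
Proof.
elim: n S => [|n IH] S /=; first by rewrite size_poly0.
rewrite (leq_trans (size_polyD _ _))// geq_max.
rewrite (leq_trans (size_polyD _ _)) ?geq_max/=.
  apply: (leq_trans (size_scale_leq _ _)); apply: leq_trans (size_polyMleq _ _) _.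
  by rewrite size_polyX addn2 ltnS size_poly.
by rewrite (leq_trans (IH _))//= (leq_trans (size_polyC_leq1 _)).
Qed.

(** Although |S|^2 is not analytic, on the unit circle it is the real part of a polynomial of no
    larger size, to which the exact averages over roots of unity and the mean value property
    apply. *)
Lemma sqpolyE n S z : (size S <= n)%N -> normc z = 1 ->
  normc S.[z] ^+ 2 = complex.Re (sqpoly n S).[z].
Proof.
move=> + z1; elim: n S => [|n IH] S sS /=.
  by move: sS; rewrite leqn0 size_poly_eq0 => /eqP->; rewrite !horner0 normc0 expr0n.
set S1 := \poly_(i < n) _.
have ES : S = S1 * 'X + (S`_0)%:P.
  apply/polyP => -[|i]; rewrite coefD coefMX coefC/= ?add0r// addr0 coef_poly.
  by case: ltnP => // ni; rewrite nth_default// (leq_trans sS).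
rewrite {1}ES !hornerE ReD ReD /= -IH ?size_poly//.
rewrite [X in _ = _ + X](_ : _ =
   2 * complex.Re ((S`_0)^*%C * (S1.[z] * z))); last first.
  by rewrite -!mulrA ReMr.
have -> : normc S1.[z] ^+ 2 = normc (S1.[z] * z) ^+ 2 by rewrite Normc.normcM z1 mulr1.
move: (S1.[z] * z) (S`_0) => a b; rewrite !sqr_normc ReM ReD ImD.
by case: b => x y /=; ring.
Qed.

Lemma sqpoly0 n S :
  (sqpoly n S).[0] = (\sum_(i < n) normc S`_i ^+ 2)%:C%C.
Proof.
elim: n S => [|n IH] S /=; first by rewrite horner0 big_ord0.
rewrite hornerD hornerD hornerC hornerZ hornerMX IH mulr0 mulr0 addr0 big_ord_recl addrC rmorphD/=; congr (_ + _).
congr (_ %:C)%C; apply: eq_bigr => i _; by rewrite coef_poly ltn_ord.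
Qed.

(** Discrete Parseval identity. Absorbing z into the coefficients ([T]) reduces it to the unit
    circle, where [sqpoly] is averaged exactly. *)
Lemma mean_sqr_normc n S z : (size S <= n)%N -> (0 < n)%N ->
  \sum_(j < n) normc S.[z * root1 n ^+ j] ^+ 2 =
  n%:R * \sum_(i < n) normc S`_i ^+ 2 * (normc z ^+ 2) ^+ i.
Proof.
move=> sS n0; pose T := \poly_(i < n) (S`_i * z ^+ i).
have TE w : S.[z * w] = T.[w].
  rewrite (horner_coef_wide _ sS) /T horner_poly.
  by apply: eq_bigr => i _; rewrite exprMn mulrA.
have sT : (size T <= n)%N by rewrite size_poly.
under eq_bigr do rewrite TE (sqpolyE sT) ?normcX ?normc_root1 ?expr1n//.
rewrite -Re_sum.
have := sum_root1 1 (size_sqpoly n T) n0.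
under eq_bigr do rewrite mul1r.
move=> ->; rewrite sqpoly0 -(rmorph_nat (real_complex R)) ReMr /=; congr (_ * _).
by apply: eq_bigr => i _; rewrite coef_poly ltn_ord Normc.normcM normcX exprMn exprAC.
Qed.

(* The nodes are the n-th roots of unity and the kernel is Fejer's
   |\sum_(k < n) v ^+ k|^2 / n, which equals |v ^+ n - 1|^2 / (n |v - 1|^2). *)
Lemma fejer_approx (g : C -> R) (e B : R) (n : nat) : (0 < n)%N -> 0 <= B ->
  (forall z w, normc z = 1 -> normc w = 1 ->
     `|g z - g w| <= e + B * normc (z - w) ^+ 2) ->
  exists2 Q : {poly C}, (size Q <= n)%N &
    forall z, normc z = 1 -> `|g z - complex.Re Q.[z]| <= e + B * 4 / n%:R.
Proof.
move=> n0 B0 gB; pose rt := root1 n.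
have rt1 j : normc (rt ^+ j) = 1 by rewrite normcX normc_root1 expr1n.
pose S (j : nat) : {poly C} := \poly_(k < n) (rt ^+ j) ^+ k.
pose S0 : {poly C} := \poly_(k < n) 1.
have SE j z : (S j).[z] = S0.[z * rt ^+ j].
  rewrite !horner_poly; apply: eq_bigr => k _.
  by rewrite mul1r exprMn mulrC.
(* The j-th kernel peaks at [a j], the point where z rt^j = 1. *)
pose a j := (rt ^+ j)^-1.
have a1 j : normc (a j) = 1 by rewrite Normc.normcV rt1 invr1.
pose c : R := (n%:R ^+ 2)^-1.
have nR : 0 < n%:R :> R by rewrite ltr0n.
exists (\sum_(j < n) ((g (a j) * c)%:C%C *: sqpoly n (S j))).
  apply: (leq_trans (size_sum _ _ _)); apply/bigmax_leqP => j _.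
  exact: leq_trans (size_scale_leq _ _) (size_sqpoly _ _).
move=> z z1; rewrite horner_sum Re_sum.
under eq_bigr do rewrite hornerZ ReMr -(sqpolyE _ z1) ?size_poly// SE.
pose K j := normc S0.[z * rt ^+ j] ^+ 2 * c.
have K0 j : 0 <= K j by rewrite mulr_ge0 ?sqr_ge0// invr_ge0 sqr_ge0.
have sK : \sum_(j < n) K j = 1.
  rewrite -mulr_suml mean_sqr_normc ?size_poly// z1.
  under eq_bigr => j _ do
    rewrite coef_poly ltn_ord Normc.normc1 !expr1n mul1r.
  by rewrite sumr_const card_ord -expr2 mulfV// expf_neq0// gt_eqF.
have -> : \sum_(j < n) g (a j) * c * normc S0.[z * rt ^+ j] ^+ 2 =
          \sum_(j < n) g (a j) * K j.
  by apply: eq_bigr => j _; rewrite /K; ring.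
have -> : g z = \sum_(j < n) g z * K j by rewrite -mulr_sumr sK mulr1.
rewrite -sumrB.
apply: le_trans (ler_norm_sum _ _ _) _.
(* The quadratic modulus cancels the denominator of the kernel: K j |z - a j|^2 = |v^n - 1|^2 / n^2
   <= 4 / n^2 with v = z rt^j, and the sum over n nodes leaves B * 4 / n. *)
have Kn (j : 'I_n) : `|g z * K j - g (a j) * K j| <= e * K j + B * 4 * c.
  rewrite -mulrBl normrM (ger0_norm (K0 j)).
  apply: le_trans (ler_wpM2r (K0 j) (gB _ _ z1 (a1 j))) _.
  rewrite mulrDl lerD2l -!(mulrA B) ler_wpM2l// /K mulrA.
  apply: ler_wpM2r; first by rewrite /c invr_ge0 sqr_ge0.
  have -> : normc (z - a j) = normc (z * rt ^+ j - 1).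
    rewrite -[LHS]mulr1 -(rt1 j) -Normc.normcM mulrBl mulVf//.
    by rewrite -normc_eq0 rt1 oner_eq0.
  rewrite -exprMn -Normc.normcM.
  have -> : S0.[z * rt ^+ j] = \sum_(i < n) (z * rt ^+ j) ^+ i.
    by rewrite horner_poly; apply: eq_bigr => i _; rewrite mul1r.
  rewrite -subrX1 (_ : 4 = 2 ^+ 2); last by rewrite -natrX.
  rewrite ler_sqr ?nnegrE ?normc_ge0//.
  apply: le_trans (le_normcD _ _) _.
  by rewrite normcN Normc.normc1 normcX Normc.normcM z1 rt1 mulr1 expr1n.
apply: le_trans (ler_sum _ (fun j _ => Kn j)) _.
rewrite big_split/= -mulr_sumr sK mulr1 lerD2l sumr_const card_ord.
by rewrite -[_ *+ n]mulr_natr /c le_eqVlt; apply/orP; left; apply/eqP; field; rewrite gt_eqF.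
Qed.

End complex_plane.

(** * Maximum principle *)

Section maximum_principle.
Variable R : realType.
Local Notation C := R[i].
Implicit Types (z w : C) (P Q S : {poly C}) (G : C -> R).

Definition cpx (z : R * R) : C := (z.1 +i* z.2)%C.

(** Continuity is tested on R * R, the plane on which the integrals of the theorem are taken. *)
Definition continuousC G := continuous (fun z : R * R => G (cpx z)).

Definition cdisk : set (R * R) := [set z | z.1 ^+ 2 + z.2 ^+ 2 <= 1].

Lemma cdiskE (z : R * R) : cdisk z <-> normc (cpx z) <= 1.
Proof.
rewrite /cdisk /=; split=> h.
  by apply: (@normc_le_sqr _ (cpx z) 1) => //; rewrite expr1n.
have := sqr_normc (cpx z); rewrite /= => <-.
by rewrite expr_le1// sqrtr_ge0.
Qed.

Lemma continuousC_Re : continuousC (fun z => complex.Re z).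
Proof. by move=> z; exact: cvg_fst. Qed.

Lemma continuousC_Im : continuousC (fun z => complex.Im z).
Proof. by move=> z; exact: cvg_snd. Qed.

Lemma continuousC_cst (a : R) : continuousC (fun=> a).
Proof. by move=> z; exact: cvg_cst. Qed.

Lemma continuousCD G1 G2 : continuousC G1 -> continuousC G2 ->
  continuousC (fun z => G1 z + G2 z).
Proof. by move=> h1 h2 z; apply: cvgD; [exact: h1|exact: h2]. Qed.

Lemma continuousCN G : continuousC G -> continuousC (fun z => - G z).
Proof. by move=> h z; apply: cvgN; exact: h. Qed.

Lemma continuousCB G1 G2 : continuousC G1 -> continuousC G2 ->
  continuousC (fun z => G1 z - G2 z).
Proof. by move=> h1 h2 z; apply: cvgB; [exact: h1|exact: h2]. Qed.

Lemma continuousCM G1 G2 : continuousC G1 -> continuousC G2 ->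
  continuousC (fun z => G1 z * G2 z).
Proof. by move=> h1 h2 z; apply: cvgM; [exact: h1|exact: h2]. Qed.

Lemma continuousCX G n : continuousC G -> continuousC (fun z => G z ^+ n).
Proof.
move=> h; elim: n => [|n IH].
  by under [X in continuousC X]funext do rewrite expr0; exact: continuousC_cst.
have -> : (fun z => G z ^+ n.+1) = (fun z => G z * G z ^+ n).
  by apply/funext => z; rewrite exprS.
exact: continuousCM.
Qed.

Lemma continuousC_comp G (k : R -> R) : continuousC G ->
  (forall z, {for G z, continuous k}) -> continuousC (fun z => k (G z)).
Proof. by move=> h kG z; apply: continuous_comp; [exact: h|exact: kG]. Qed.

Lemma continuousC_horner P :
  continuousC (fun z => complex.Re P.[z]) /\
  continuousC (fun z => complex.Im P.[z]).
Proof.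
elim/poly_ind: P => [|P c [IHr IHi]].
  by split; under [X in continuousC X]funext do rewrite horner0 /=;
    exact: continuousC_cst.
have cr := continuousC_Re; have ci := continuousC_Im.
have cc := continuousC_cst; split.
  have -> : (fun z => complex.Re (P * 'X + c%:P).[z]) = fun z =>
      complex.Re P.[z] * complex.Re z - complex.Im P.[z] * complex.Im z + complex.Re c.
    by apply/funext => z; rewrite hornerMXaddC ReD ReM.
  by apply: continuousCD => //; apply: continuousCB; apply: continuousCM.
have -> : (fun z => complex.Im (P * 'X + c%:P).[z]) = fun z =>
    complex.Re P.[z] * complex.Im z + complex.Im P.[z] * complex.Re z + complex.Im c.
  by apply/funext => z; rewrite hornerMXaddC ImD ImM.
by apply: continuousCD => //; apply: continuousCD; apply: continuousCM.
Qed.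

Lemma continuousC_normc (g : C -> C) :
  continuousC (fun z => complex.Re (g z)) ->
  continuousC (fun z => complex.Im (g z)) ->
  continuousC (fun z => normc (g z)).
Proof.
move=> hr hi.
have -> : (fun z => normc (g z)) =
    fun z => Num.sqrt (complex.Re (g z) ^+ 2 + complex.Im (g z) ^+ 2).
  by apply/funext => z; case: (g z).
apply: (@continuousC_comp (fun z => complex.Re (g z) ^+ 2 + complex.Im (g z) ^+ 2)).
  by apply: continuousCD; apply: continuousCX.
by move=> z; exact: sqrt_continuous.
Qed.

Lemma compact_cdisk : compact cdisk.
Proof.
have := compact_setX (@segment_compact R (-1) 1) (@segment_compact R (-1) 1).
move=> /(subclosed_compact _); apply.
  have -> : cdisk = (fun z : R * R => z.1 ^+ 2 + z.2 ^+ 2) @^-1` [set x | x <= 1] by [].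
  apply: closed_comp; last exact: closed_le.
  move=> z _.
  have h : continuousC (fun z => complex.Re z ^+ 2 + complex.Im z ^+ 2).
    exact: continuousCD (continuousCX continuousC_Re) (continuousCX continuousC_Im).
  exact: (h z).
move=> [x y]; rewrite /cdisk/= => h.
split; rewrite /= in_itv/= -ler_norml -(ler_sqr (_ : _ \in Num.nneg)) ?nnegrE//;
  rewrite real_normK ?num_real// expr1n; apply: le_trans h.
- by rewrite lerDl sqr_ge0.
- by rewrite lerDr sqr_ge0.
Qed.

Lemma EVT_cdisk G : continuousC G ->
  exists2 z, normc z <= 1 & forall w, normc w <= 1 -> G w <= G z.
Proof.
move=> cG.
have cd0 : cdisk !=set0 by exists (0, 0); rewrite /cdisk/= expr0n addr0.
have := @compact_EVT_max (R * R)%type R (fun z : R * R => G (cpx z)) cdisk cd0 compact_cdisk.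
move=> /(_ (continuous_subspaceT cG)) [c cD cmax].
exists (cpx c); first by apply/cdiskE; move: cD; rewrite inE.
move=> w w1; have := cmax (complex.Re w, complex.Im w).
have -> : cpx (complex.Re w, complex.Im w) = w by case: w {w1}.
by apply; rewrite inE; apply/cdiskE; rewrite /cpx /=; case: w w1.
Qed.

Lemma bounded_cdisk G : continuousC G ->
  exists M, forall w, normc w <= 1 -> `|G w| <= M.
Proof.
move=> cG; have [z _ zmax] := EVT_cdisk cG.
have [z' _ zmin] := EVT_cdisk (continuousCN cG).
exists (Num.max (G z) (- G z')) => w w1.
rewrite ler_norml lerNl le_max le_max zmax// zmin// orbT//=.
Qed.

(** Uniform continuity in the form that [fejer_approx] consumes. On the diagonal the difference
    vanishes; off it, a large multiple n of the squared distance dominates. The strict inequality is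
    open in the pair and monotone in n, so compactness of the product yields one n for all pairs. *)
Lemma modulus_cdisk G (e : R) : continuousC G -> 0 < e ->
  exists2 B : R, 0 <= B & forall z w, normc z <= 1 -> normc w <= 1 ->
    `|G z - G w| <= e + B * normc (z - w) ^+ 2.
Proof.
move=> cG e0.
have := compact_setX compact_cdisk compact_cdisk.
rewrite compact_near_coveringP => nc.
pose d (p : (R * R) * (R * R)) : R :=
  (p.1.1 - p.2.1) ^+ 2 + (p.1.2 - p.2.2) ^+ 2.
pose H (p : (R * R) * (R * R)) : R := `|G (cpx p.1) - G (cpx p.2)|.
have cd : continuous d.
  have c11 : continuous (fun p : (R * R) * (R * R) => p.1.1).
    by move=> p; apply: (@continuous_comp _ _ _ (@fst (R * R) (R * R)) (@fst R R)); exact: cvg_fst.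
  have c12 : continuous (fun p : (R * R) * (R * R) => p.1.2).
    by move=> p; apply: (@continuous_comp _ _ _ (@fst (R * R) (R * R)) (@snd R R)); [exact: cvg_fst|exact: cvg_snd].
  have c21 : continuous (fun p : (R * R) * (R * R) => p.2.1).
    by move=> p; apply: (@continuous_comp _ _ _ (@snd (R * R) (R * R)) (@fst R R)); [exact: cvg_snd|exact: cvg_fst].
  have c22 : continuous (fun p : (R * R) * (R * R) => p.2.2).
    by move=> p; apply: (@continuous_comp _ _ _ (@snd (R * R) (R * R)) (@snd R R)); exact: cvg_snd.
  have -> : d = fun p => (p.1.1 - p.2.1) * (p.1.1 - p.2.1) + (p.1.2 - p.2.2) * (p.1.2 - p.2.2).
    by apply/funext => p; rewrite /d !expr2.
  by move=> p; apply: cvgD; apply: cvgM; apply: cvgB;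
    do ?[exact: c11|exact: c12|exact: c21|exact: c22].
have cH : continuous H.
  have cf1 : continuous (fun p : (R * R) * (R * R) => G (cpx p.1)).
    move=> p; apply: (@continuous_comp _ _ _ (@fst (R * R) (R * R)) (fun z : R * R => G (cpx z))); [exact: cvg_fst|exact: cG].
  have cf2 : continuous (fun p : (R * R) * (R * R) => G (cpx p.2)).
    move=> p; apply: (@continuous_comp _ _ _ (@snd (R * R) (R * R)) (fun z : R * R => G (cpx z))); [exact: cvg_snd|exact: cG].
  move=> p; apply: cvg_norm; apply: cvgB.
    exact: cf1.
  exact: cf2.
have d0 p : 0 <= d p by rewrite addr_ge0// sqr_ge0.
have := nc nat \oo (fun n p => H p < e + n%:R * d p) _.
case.
- move=> p _.
  have [n hn] : exists n : nat, H p < e + n%:R * d p.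
    have [dp|dp] := eqVneq (d p) 0.
      exists 0%N; rewrite mul0r addr0 /H.
      have : p.1 = p.2.
        move: dp => /eqP; rewrite /d paddr_eq0 ?sqr_ge0// !sqrf_eq0 !subr_eq0.
        by case: p => [[a b] [c f]] /= /andP[/eqP-> /eqP->].
      by move=> ->; rewrite subrr normr0.
    have dp0 : 0 < d p by rewrite lt_def dp d0.
    exists (Num.truncn (H p / d p)).+1.
    rewrite -ltrBlDl -ltr_pdivrMr//.
    apply: le_lt_trans (truncnS_gt _).
    by rewrite ler_pM2r ?invr_gt0// gerBl ltW.
  have cHd : continuous (fun p => e + n%:R * d p - H p).
    move=> q; apply: cvgB; last exact: cH.
    apply: cvgD; first exact: cvg_cst.
    by apply: cvgM; [exact: cvg_cst|exact: cd].
  have hp : 0 < e + n%:R * d p - H p by rewrite subr_gt0.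
  have /= near1 := cvgr_gt _ (cHd p) _ hp.
  exists ([set p' | 0 < e + n%:R * d p' - H p'], [set m | (n <= m)%N]).
    split; first exact: near1.
    by exists n.
  move=> [q m] [/= q0 nm]; rewrite /=.
  apply: (@lt_le_trans _ _ (e + n%:R * d q)); first by rewrite -subr_gt0.
  by rewrite lerD2l ler_wpM2r// ler_nat.
- move=> n _ hn; exists n%:R => // z w z1 w1.
  have := hn n (leqnn n) ((complex.Re z, complex.Im z), (complex.Re w, complex.Im w)).
  have E v : cpx (complex.Re v, complex.Im v) = v by case: v.
  rewrite /H /d /= !E sqr_normc ReB ImB => /(_ _)/ltW; apply.
  by split; apply/cdiskE; rewrite E.
Qed.

(** * Discrete subharmonicity and contact from below *)

Definition cross G z (h : R) : R :=
  G (z + h%:C%C) + G (z - h%:C%C) + G (z + (0 +i* h)%C) + G (z - (0 +i* h)%C).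

(* A discrete form of [0 <= laplacian G z], for G only continuous. *)
Definition sub4 G z := forall e : R, 0 < e -> exists2 d : R, 0 < d &
  forall h, 0 < h < d -> 4 * G z - e * h ^+ 2 <= cross G z h.

(** Adding d |z|^2 gains 4 d h^2 in the cross sum against an allowed error d h^2, so [F] has no
    interior maximum where G is subharmonic. As d is half the excess of G over M at z0, the maximum
    of [F] still lies where M < G. Asking for subharmonicity only there lets callers stay away from
    zeros of a polynomial. *)
Lemma max_principle G (M : R) : continuousC G ->
  (forall z, normc z = 1 -> G z <= M) ->
  (forall z, normc z < 1 -> M < G z -> sub4 G z) ->
  forall z, normc z <= 1 -> G z <= M.
Proof.
move=> cG GM sG z0 z01; rewrite leNgt; apply/negP => Mz0.
pose d := (G z0 - M) / 2.
have d0 : 0 < d by rewrite divr_gt0// subr_gt0.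
pose F z := G z + d * (complex.Re z ^+ 2 + complex.Im z ^+ 2).
have cF : continuousC F.
  apply: continuousCD => //; apply: continuousCM; first exact: continuousC_cst.
  by apply: continuousCD; apply: continuousCX;
    [exact: continuousC_Re|exact: continuousC_Im].
have [z1 z11 z1max] := EVT_cdisk cF.
have F01 := z1max _ z01.
have Gz1 : M < G z1.
  have s1 : normc z1 ^+ 2 <= 1 by rewrite expr_le1// normc_ge0.
  have s0 : 0 <= normc z0 ^+ 2 by rewrite sqr_ge0.
  move: F01; rewrite /F -!sqr_normc /d; nra.
have z1lt : normc z1 < 1.
  rewrite lt_def z11 andbT; apply/negP => /eqP e.
  by have := GM _ (esym e); rewrite leNgt Gz1.
have [r r0 hr] := sG _ z1lt Gz1 d d0.
pose h := Num.min (r / 2) ((1 - normc z1) / 2).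
have h0 : 0 < h by rewrite lt_min !divr_gt0// subr_gt0.
have hr2 : h < r by rewrite gt_min; apply/orP; left; lra.
have hz : normc z1 + h <= 1.
  have : h <= (1 - normc z1) / 2 by rewrite ge_min lexx orbT.
  by lra.
have := hr h; rewrite h0 hr2 => /(_ isT).
have nb v : normc v = h -> normc (z1 + v) <= 1.
  by move=> vh; apply: le_trans (le_normcD _ _) _; rewrite vh.
have nh : normc h%:C%C = h by rewrite normcR gtr0_norm.
have nih : normc (0 +i* h)%C = h.
  by rewrite /Normc.normc /= expr0n add0r sqrtr_sqr gtr0_norm.
have := z1max (z1 + h%:C%C); have := z1max (z1 - h%:C%C).
have := z1max (z1 + (0 +i* h)%C); have := z1max (z1 - (0 +i* h)%C).
rewrite !nb ?normcN// => /(_ isT) A1 /(_ isT) A2 /(_ isT) A3 /(_ isT) A4.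
move: A1 A2 A3 A4; rewrite /cross /F !ReD !ImD !ReN !ImN /=.
set a := G (_ - _); set b := G (_ + _); set c := G (_ - _); set e := G (_ + _).
move=> A1 A2 A3 A4.
have : 0 < d * h ^+ 2 by rewrite mulr_gt0// exprn_gt0.
rewrite !expr2 in A1 A2 A3 A4 *.
move=> dh; nra.
Qed.

Lemma sub4D G1 G2 z : sub4 G1 z -> sub4 G2 z -> sub4 (fun w => G1 w + G2 w) z.
Proof.
move=> h1 h2 e e0; have e2 : 0 < e / 2 by rewrite divr_gt0.
have [d1 d10 hd1] := h1 _ e2; have [d2 d20 hd2] := h2 _ e2.
exists (Num.min d1 d2) => [|h]; first by rewrite lt_min d10.
rewrite lt_min => /andP[h0 /andP[hd1' hd2']].
have := hd1 h; have := hd2 h; rewrite h0 hd1' hd2' => /(_ isT) + /(_ isT).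
rewrite /cross; lra.
Qed.

Lemma sub4Z G z (a : R) : 0 <= a -> sub4 G z -> sub4 (fun w => a * G w) z.
Proof.
move=> a0 sG e e0.
have [a00|an0] := eqVneq a 0.
  exists 1 => // h _; rewrite /cross a00 !mul0r mulr0 !addr0 sub0r oppr_le0.
  by rewrite mulr_ge0 ?sqr_ge0// ltW.
have ap : 0 < a by rewrite lt_def an0.
have [d d0 hd] := sG (e / a) (divr_gt0 e0 ap).
exists d => // h hh; have := hd h hh.
rewrite -(ler_pM2l ap) mulrBr [X in _ - X]mulrA [a * (e / a)]mulrC divfK// /cross; lra.
Qed.

Lemma horner_bounded P : exists2 K : R, 0 <= K &
  forall z, normc z <= 1 -> normc P.[z] <= K.
Proof.
exists (\sum_(i < size P) normc P`_i) => [|z z1].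
  by apply: sumr_ge0 => i _; exact: normc_ge0.
rewrite horner_coef; apply: le_trans (ler_normc_sum _ _ _) _.
apply: ler_sum => i _; rewrite Normc.normcM normcX.
by rewrite ler_piMr ?normc_ge0// exprn_ile1// normc_ge0.
Qed.

(** In the Taylor expansion at z, odd orders cancel between opposite points and order two cancels
    between the real and imaginary directions, since (i h)^2 = - h^2; only a fourth-order term
    remains. *)
Lemma cross_horner P z : exists2 K : R, 0 <= K & forall h, 0 <= h <= 1 ->
  4 * complex.Re P.[z] - K * h ^+ 4 <= cross (fun w => complex.Re P.[w]) z h.
Proof.
pose Q := P \Po ('X + z%:P).
have QE v : P.[z + v] = Q.[v] by rewrite horner_comp !hornerE addrC.
pose Q4 := drop_poly 4 Q.
have QD v : Q.[v] = Q`_0 + Q`_1 * v + Q`_2 * v ^+ 2 + Q`_3 * v ^+ 3 + Q4.[v] * v ^+ 4.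
  rewrite -{1}(poly_take_drop 4 Q) hornerD hornerM hornerXn; congr (_ + _).
  rewrite /take_poly horner_poly !big_ord_recl big_ord0 /= /bump /=.
  by rewrite expr0 mulr1 expr1 addr0 !addrA.
have [K K0 hK] := horner_bounded Q4.
exists (4 * K) => [|h /andP[h0 h1]]; first by rewrite mulr_ge0.
rewrite /cross -[in P.[z]](addr0 z) !QE.
have Q0 : Q.[0] = Q`_0 by rewrite horner_coef0.
rewrite Q0 !(QD (_%:C)%C) !(QD (- _)) (QD (0 +i* h)%C).
set r : C := (h%:C)%C; set s : C := (0 +i* h)%C.
have E4 : [/\ r ^+ 4 = (h ^+ 4)%:C%C, s ^+ 4 = (h ^+ 4)%:C%C & s ^+ 2 = - r ^+ 2].
  have s2 : s ^+ 2 = - r ^+ 2 by apply: eqC; rewrite /= ; ring.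
  split => //; first by rewrite rmorphXn.
  by rewrite (_ : 4 = 2 * 2)%N// exprM s2 sqrrN -exprM rmorphXn.
have [r4 s4 s2] := E4.
have nr : normc r <= 1 by rewrite normcR ger0_norm.
have ns : normc s <= 1.
  by rewrite /Normc.normc /= expr0n add0r sqrtr_sqr ger0_norm.
have hh : 0 <= h ^+ 4 by rewrite exprn_ge0.
have bd v : normc v <= 1 -> - (K * h ^+ 4) <= complex.Re (Q4.[v] * (h ^+ 4)%:C%C).
  move=> v1; rewrite [Q4.[v] * _]mulrC ReMr [_ * complex.Re _]mulrC -mulNr ler_wpM2r//.
  by rewrite lerNl -ReN (le_trans (Re_le_normc _))// normcN hK.
have := bd r nr; have := bd s ns; have := bd (- r); have := bd (- s).
rewrite !normcN => /(_ ns) b1 /(_ nr) b2 b3 b4.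
rewrite (_ : (- r) ^+ 4 = (h ^+ 4)%:C%C); last by rewrite exprNn r4 -signr_odd mul1r.
rewrite (_ : (- s) ^+ 4 = (h ^+ 4)%:C%C); last by rewrite exprNn s4 -signr_odd mul1r.
rewrite r4 s4 -!ReD.
set A := Q4.[r] * _ in b4 *; set B := Q4.[- r] * _ in b2 *.
set E := Q4.[s] * _ in b3 *; set F := Q4.[- s] * _ in b1 *.
rewrite [X in _ <= complex.Re X](_ : _ = 4 * Q`_0 + (A + B + E + F)); last first.
  by rewrite sqrrN (_ : (- s) ^+ 2 = - r ^+ 2) ?sqrrN// s2; ring.
rewrite !ReD (_ : (4 : C) = (4 : R)%:C%C) ?ReMr; first lra.
by rewrite rmorph_nat.
Qed.

Lemma sub4_Re P z : sub4 (fun w => complex.Re P.[w]) z.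
Proof.
have [K K0 hK] := cross_horner P z => e e0.
exists (Num.min 1 (e / (K + 1))) => [|h]; first by rewrite lt_min ltr01 divr_gt0// ltr_wpDl.
rewrite lt_min => /andP[h0 /andP[h1 he]].
apply: le_trans (hK h _); last by rewrite !ltW.
rewrite lerD2l lerN2 (_ : 4 = 2 + 2)%N// exprD mulrA ler_wpM2r ?sqr_ge0//.
rewrite ltr_pdivlMr ?ltr_wpDl// in he.
rewrite expr2; nra.
Qed.

(** Contact from below at [w0], to second order, with the harmonic polynomial psi w0 + Re (al v + be
    v^2). A local test for subharmonicity that asks for no derivatives of psi and is stable under
    composition with polynomials. *)
Definition touched (psi : C -> R) (w0 : C) := exists al be : C,
  forall e : R, 0 < e -> exists2 d : R, 0 < d & forall v, normc v < d ->
    psi w0 + complex.Re (al * v + be * v ^+ 2) - e * normc v ^+ 2 <= psi (w0 + v).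

Lemma horner_lipschitz P z : exists2 K : R, 0 <= K &
  forall v, normc v <= 1 -> normc (P.[z + v] - P.[z]) <= K * normc v.
Proof.
pose Q := P \Po ('X + z%:P).
have QE v : P.[z + v] = Q.[v] by rewrite horner_comp !hornerE addrC.
have QD v : Q.[v] = Q`_0 + (drop_poly 1 Q).[v] * v.
  rewrite -{1}(poly_take_drop 1 Q) hornerD hornerM hornerXn expr1; congr (_ + _).
  by rewrite /take_poly horner_poly big_ord_recl big_ord0 expr0 mulr1 addr0.
have [K K0 hK] := horner_bounded (drop_poly 1 Q); exists K => // v v1.
rewrite -{2}(addr0 z) !QE horner_coef0 QD addrAC subrr add0r Normc.normcM.
by rewrite ler_wpM2r ?normc_ge0// hK.
Qed.

(** Composing the touching polynomial with P gives the real part of a polynomial [T], for which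
    [sub4] is known; P is Lipschitz near z, so the error stays of second order. *)
Lemma sub4_touched (psi : C -> R) P z : touched psi P.[z] ->
  sub4 (fun w => psi P.[w]) z.
Proof.
move=> [al [be tp]] e e0.
pose T := al *: (P - P.[z]%:P) + be *: (P - P.[z]%:P) ^+ 2.
have [L L0 hL] := horner_lipschitz P z.
(* Each of the four points of the cross costs at most e / 8 * h^2; the other half of e is spent on
   [T]. *)
pose e1 := e / (8 * (L ^+ 2 + 1)).
have L1 : 0 < L ^+ 2 + 1 by rewrite ltr_wpDl// sqr_ge0.
have e10 : 0 < e1 by rewrite divr_gt0// mulr_gt0.
have [d d0 hd] := tp _ e10.
have [r r0 hr] := sub4_Re T z (divr_gt0 e0 (ltr0n _ 2)).
exists (Num.min 1 (Num.min r (d / (L + 1)))) => [|h].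
  by rewrite !lt_min ltr01 r0 divr_gt0// ltr_wpDl.
rewrite !lt_min => /andP[h0 /andP[h1 /andP[hr1 hd1]]].
have := hr h; rewrite h0 hr1 => /(_ isT).
have T0 : T.[z] = 0 by rewrite /T hornerD !hornerZ horner_exp hornerD hornerN hornerC subrr expr2 !mulr0 addr0.
rewrite T0 mulr0 sub0r => crT.
have Lh : L * h < d.
  by move: hd1; rewrite ltr_pdivlMr ?ltr_wpDl// => ?; nra.
have E v : normc v = h -> psi P.[z] + complex.Re T.[z + v] - e / 8 * h ^+ 2 <= psi P.[z + v].
  move=> vh; have Pv := hL v; rewrite vh (ltW h1) in Pv; have {}Pv := Pv isT.
  have := hd _ (le_lt_trans Pv Lh).
  rewrite [P.[z] + _]addrC subrK => /(le_trans _); apply.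
  have -> : T.[z + v] = al * (P.[z + v] - P.[z]) + be * (P.[z + v] - P.[z]) ^+ 2.
    by rewrite !hornerE.
  rewrite lerD2l lerN2.
  have : normc (P.[z + v] - P.[z]) ^+ 2 <= L ^+ 2 * h ^+ 2.
    by rewrite -exprMn ler_sqr// nnegrE ?normc_ge0// mulr_ge0// ltW.
  move=> sq; apply: (@le_trans _ _ (e1 * (L ^+ 2 * h ^+ 2))).
    by rewrite ler_wpM2l// ltW.
  rewrite mulrA ler_wpM2r ?sqr_ge0// /e1 mulrAC ler_pdivrMr; last by rewrite mulr_gt0.
  by rewrite [leRHS]mulrA divfK//; nra.
have nh : normc h%:C%C = h by rewrite normcR gtr0_norm.
have nih : normc (0 +i* h)%C = h.
  by rewrite /Normc.normc /= expr0n add0r sqrtr_sqr gtr0_norm.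
have := E _ nh; have := E _ nih; have := E (- h%:C%C); have := E (- (0 +i* h)%C).
rewrite !normcN => /(_ nih) a1 /(_ nh) a2 a3 a4.
move: crT; rewrite /cross => crT; lra.
Qed.

End maximum_principle.

(** * Functions of one variable *)

Section one_variable.
Variable R : realType.
Implicit Types (f g : R -> R) (s t a b : R).

Lemma is_derive1D f g t a b : is_derive t 1 f a -> is_derive t 1 g b ->
  is_derive t 1 (fun x => f x + g x) (a + b).
Proof. by move=> df dg; exact: is_deriveD. Qed.

Lemma is_derive1B f g t a b : is_derive t 1 f a -> is_derive t 1 g b ->
  is_derive t 1 (fun x => f x - g x) (a - b).
Proof. by move=> df dg; exact: is_deriveB. Qed.

Lemma is_derive1M f g t a b : is_derive t 1 f a -> is_derive t 1 g b ->
  is_derive t 1 (fun x => f x * g x) (f t * b + g t * a).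
Proof. by move=> df dg; exact: is_deriveM. Qed.

Lemma is_derive1Z f t a s : is_derive t 1 f a ->
  is_derive t 1 (fun x => s * f x) (s * a).
Proof. by move=> df; exact: is_deriveZ. Qed.

Lemma is_derive1N f t a : is_derive t 1 f a ->
  is_derive t 1 (fun x => - f x) (- a).
Proof. by move=> df; exact: is_deriveN. Qed.

Lemma is_derive1_compE f g t a b : is_derive (g t) 1 f a -> is_derive t 1 g b ->
  is_derive t 1 (fun x => f (g x)) (a * b).
Proof. by move=> df dg; exact: (@is_derive1_comp R f g t a b). Qed.

Lemma is_derive1_lin s t : is_derive t 1 (fun x => s * x) s.
Proof. by have := is_derive1Z s (is_derive_id t (1 : R)); rewrite mulr1. Qed.

Lemma is_derive1_cosM s t : is_derive t 1 (fun x => cos (s * x)) (- (s * sin (s * t))).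
Proof.
have := is_derive1_compE (is_derive_cos (s * t)) (is_derive1_lin s t).
by rewrite mulNr mulrC.
Qed.

Lemma is_derive1_sinM s t : is_derive t 1 (fun x => sin (s * x)) (s * cos (s * t)).
Proof.
have := is_derive1_compE (is_derive_sin (s * t)) (is_derive1_lin s t).
by rewrite mulrC.
Qed.

Lemma is_derive1_continuous f t a : is_derive t 1 f a -> {for t, continuous f}.
Proof.
by move=> [df _]; apply/differentiable_continuous/derivable1_diffP.
Qed.

Lemma derive_le0_nincr f g (a b : R) : {within `[a, b], continuous f} ->
  (forall t, a < t < b -> is_derive t 1 f (g t)) ->
  (forall t, a < t < b -> g t <= 0) ->
  forall x y, a <= x -> x <= y -> y <= b -> f y <= f x.
Proof.
move=> cf df g0 x y ax xy yb.
have [->|xney] := eqVneq x y; first exact: lexx.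
have xlty : x < y by rewrite lt_neqAle xney.
have dxy z : z \in `]x, y[%R -> is_derive z 1 f (g z).
  by rewrite in_itv/= => /andP[xz zy]; apply: df; rewrite (le_lt_trans ax xz) (lt_le_trans zy yb).
have cxy : {within `[x, y], continuous f}.
  apply: continuous_subspaceW cf; apply: subset_itv; by rewrite bnd_simp.
have [c + fE] := MVT xlty dxy cxy.
rewrite in_itv/= => /andP[xc cy]; rewrite -subr_le0 fE.
rewrite mulr_le0_ge0 ?subr_ge0// g0// (le_lt_trans ax xc)/=.
exact: lt_le_trans cy yb.
Qed.

(** The sign of the derivative g is decided by comparing a nonincreasing L with its value at t0, so
    f rises up to t0 and falls afterwards. In the applications L is, up to sign, the logarithm of
    the ratio of the two terms whose difference is g. *)
Lemma unimodal_max f g (L dL : R -> R) (t0 b : R) : 0 < t0 < b ->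
  {within `[0, b], continuous f} ->
  (forall t, 0 < t < b -> is_derive t 1 f (g t)) ->
  (forall t, 0 < t < b -> is_derive t 1 L (dL t)) ->
  (forall t, 0 < t < b -> dL t <= 0) ->
  (forall t, 0 < t < b -> L t0 <= L t -> 0 <= g t) ->
  (forall t, 0 < t < b -> L t <= L t0 -> g t <= 0) ->
  forall t, 0 <= t <= b -> f t <= f t0.
Proof.
move=> /andP[t00 t0b] cf df dL1 dL0 gp gn t /andP[t_0 tb].
have Lm x y : 0 < x -> x <= y -> y < b -> L y <= L x.
  move=> x0 xy yb.
  have xyin z : x <= z <= y -> 0 < z < b.
    by move=> /andP[xz zy]; rewrite (lt_le_trans x0 xz) (le_lt_trans zy yb).
  apply: (@derive_le0_nincr L dL x y) => //.
  - apply: continuous_in_subspaceT => z; rewrite inE/= in_itv/= => zin.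
    exact: is_derive1_continuous (dL1 _ (xyin _ zin)).
  - move=> z /andP[xz zy]; apply: dL1; apply: xyin; by rewrite !ltW.
  - move=> z /andP[xz zy]; apply: dL0; apply: xyin; by rewrite !ltW.
have [tt0|t0t] := leP t t0.
- rewrite -lerN2; apply: (@derive_le0_nincr (fun x => - f x) (fun x => - g x) 0 t0) => //.
  + move=> x; apply: cvgN.
    have h : {within `[0, t0], continuous f}.
      by apply: continuous_subspaceW cf; apply: subset_itv; rewrite bnd_simp// ltW.
    exact: h.
  + move=> x /andP[x0 xt]; apply: is_derive1N; apply: df.
    by rewrite x0 (lt_trans xt).
  + move=> x /andP[x0 xt]; rewrite oppr_le0; apply: gp; first by rewrite x0 (lt_trans xt).
    by apply: Lm => //; exact: ltW.
- apply: (@derive_le0_nincr f g t0 b) => //; last exact: ltW.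
  + by apply: continuous_subspaceW cf; apply: subset_itv; rewrite bnd_simp// ltW.
  + by move=> x /andP[x0 xt]; apply: df; rewrite xt (lt_trans t00 x0).
  + move=> x /andP[x0 xt]; apply: gn; first by rewrite xt (lt_trans t00 x0).
    by apply: Lm => //; exact: ltW.
Qed.

Lemma continuous_normr_powR s : 0 < s -> continuous (fun x : R => `|x| `^ s).
Proof.
move=> s0 x; have [->|x0] := eqVneq x 0.
  rewrite /continuous_at normr0 powR0 ?gt_eqF//.
  apply/cvgr0Pnorm_lt => e e0; near=> y.
  rewrite ger0_norm ?powR_ge0//.
  have -> : e = (e `^ s^-1) `^ s.
    by rewrite -powRrM mulVf ?gt_eqF// powRr1// ltW.
  rewrite gt0_ltr_powR// ?nnegrE ?powR_ge0//; near: y.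
  apply: (@nbhs0_lt R R^o (e `^ s^-1)); exact: powR_gt0.
apply: (@continuous_comp _ _ _ (fun x : R => `|x| : R) (fun y : R => y `^ s)).
  exact: norm_continuous.
have nx : 0 < `|x| by rewrite normr_gt0.
exact: is_derive1_continuous (is_derive1_powR s nx).
Unshelve. all: by end_near. Qed.

Lemma powR_expR a s : 0 < a -> a `^ s = expR (s * ln a).
Proof. by move=> a0; rewrite /powR gt_eqF. Qed.

Lemma sinM_pi_gt0 s t : 1 <= s -> 0 < t < pi / s -> 0 < sin (s * t).
Proof.
move=> s1 /andP[t0 ts]; have s0 : 0 < s by exact: lt_le_trans s1.
by apply: sin_gt0_pi; rewrite mulr_gt0//= mulrC -ltr_pdivlMr.
Qed.

(* [log_ratio_dec s t] has the sign of the derivative at [t] of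
   ln (sin (s * t)) - (s - 1) * ln (cos t) - ln (sin t). *)
Lemma log_ratio_dec s t : 2 <= s -> 0 <= t <= pi / s ->
  (s - 1) * (sin t * cos ((s - 1) * t)) - cos t * sin ((s - 1) * t) <= 0.
Proof.
move=> s2 /andP[t0 ts].
have s0 : 0 < s by lra.
pose f (t : R) : R := (s - 1) * (sin t * cos ((s - 1) * t)) - cos t * sin ((s - 1) * t).
pose g (t : R) : R := (1 - (s - 1) ^+ 2) * (sin t * sin ((s - 1) * t)).
have df (x : R) : is_derive x (1 : R) f (g x).
  have d := is_derive1B (is_derive1Z (s - 1) (is_derive1M (is_derive_sin x)
     (is_derive1_cosM (s - 1) x))) (is_derive1M (is_derive_cos x) (is_derive1_sinM (s - 1) x)).
  by apply: is_derive_eq; rewrite /g; ring.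
have tp : t <= pi / 2 by apply: le_trans ts _; rewrite ler_pM2l ?pi_gt0// lef_pV2 ?posrE.
have ts' : (s - 1) * t <= pi.
  have : s * t <= pi by rewrite mulrC -ler_pdivlMr.
  nra.
have f0 : f 0 = 0 by rewrite /f !(mulr0, sin0, mul0r) subrr.
rewrite -/(f t) -[leRHS]f0; apply: (@derive_le0_nincr f g 0 t) => //.
- apply: continuous_subspaceT => x; exact: is_derive1_continuous (df x).
- move=> x /andP[x0 xt]; rewrite /g mulr_le0_ge0//.
    have : 1 <= (s - 1) ^+ 2 by rewrite expr_ge1//; lra.
    lra.
  rewrite mulr_ge0//; apply: sin_ge0_pi.
    by rewrite (ltW x0)/=; have := pi_gt0 R; lra.
  by rewrite mulr_ge0 ?(ltW x0)//=; [nra|lra].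
Qed.

(** The derivative of this expression is sin t sin ((s - 1) t) times 1 - (s - 1)^2, a factor that
    changes sign at s = 2; hence the direction opposite to [log_ratio_dec]. *)
Lemma log_ratio_inc s t : 1 < s <= 2 -> 0 <= t <= pi / 2 ->
  0 <= (s - 1) * (sin t * cos ((s - 1) * t)) - cos t * sin ((s - 1) * t).
Proof.
move=> /andP[s1 s2] /andP[t0 ts].
pose f (t : R) : R := cos t * sin ((s - 1) * t) - (s - 1) * (sin t * cos ((s - 1) * t)).
pose g (t : R) : R := ((s - 1) ^+ 2 - 1) * (sin t * sin ((s - 1) * t)).
have df (x : R) : is_derive x (1 : R) f (g x).
  have d := is_derive1B (is_derive1M (is_derive_cos x) (is_derive1_sinM (s - 1) x))
    (is_derive1Z (s - 1) (is_derive1M (is_derive_sin x) (is_derive1_cosM (s - 1) x))).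
  by apply: is_derive_eq; rewrite /g; ring.
have ts' : (s - 1) * t <= pi / 2 by nra.
rewrite -oppr_le0 opprB.
have f0 : f 0 = 0 by rewrite /f !(mulr0, sin0, mul0r) subrr.
rewrite -/(f t) -[leRHS]f0; apply: (@derive_le0_nincr f g 0 t) => //.
- apply: continuous_subspaceT => x; exact: is_derive1_continuous (df x).
- move=> x /andP[x0 xt]; rewrite /g mulr_le0_ge0//.
    have : (s - 1) ^+ 2 <= 1 by rewrite expr_le1//; lra.
    lra.
  have pi0 := pi_gt0 R.
  rewrite mulr_ge0//; apply: sin_ge0_pi.
    by rewrite (ltW x0)/=; lra.
  by rewrite mulr_ge0 ?(ltW x0)//=; [nra|lra].
Qed.

(** The sign of the derivative of ln (sin (s t)) - (s - 1) ln (sin t) - ln (cos t). Once (s - 1) t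
    exceeds pi / 2, the cosine is nonpositive and each term has the right sign; before that, the
    expression starts at 0 and has derivative (1 - (s - 1)^2) cos t cos ((s - 1) t) <= 0. *)
Lemma log_ratio_sin s t : 2 <= s -> 0 <= t <= pi / s ->
  sin t * cos ((s - 1) * t) - (s - 1) * (cos t * sin ((s - 1) * t)) <= 0.
Proof.
move=> s2 /andP[t0 ts].
have s0 : 0 < s by lra.
have tp u : u <= pi / s -> u <= pi / 2.
  by move=> /le_trans; apply; rewrite ler_pM2l ?pi_gt0// lef_pV2 ?posrE.
have ts' : (s - 1) * t <= pi.
  have : s * t <= pi by rewrite mulrC -ler_pdivlMr.
  nra.
have pi0 := pi_gt0 R.
have st u : 0 <= u -> u <= pi / s -> 0 <= sin u.
  by move=> u0 us; apply: sin_ge0_pi; rewrite u0/=; have := tp _ us; lra.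
have ct u : 0 <= u -> u <= pi / s -> 0 <= cos u.
  by move=> u0 us; apply: cos_ge0_pihalf; rewrite tp// andbT; lra.
have [hle|hgt] := leP ((s - 1) * t) (pi / 2); last first.
  have c0 : cos ((s - 1) * t) <= 0.
    have := @cos_ge0_pihalf R (pi - (s - 1) * t).
    rewrite cosB cospi sinpi mul0r addr0 mulN1r oppr_ge0; apply.
    by apply/andP; split; lra.
  have s1 : 0 <= sin ((s - 1) * t) by apply: sin_ge0_pi; rewrite ts' andbT; lra.
  have := st _ t0 ts; have := ct _ t0 ts; move=> c1 s3.
  rewrite subr_le0 (@le_trans _ _ 0)//; first by rewrite mulr_ge0_le0.
  by rewrite !mulr_ge0//; lra.
pose f (t : R) : R := sin t * cos ((s - 1) * t) - (s - 1) * (cos t * sin ((s - 1) * t)).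
pose g (t : R) : R := (1 - (s - 1) ^+ 2) * (cos t * cos ((s - 1) * t)).
have df (x : R) : is_derive x (1 : R) f (g x).
  have d := is_derive1B (is_derive1M (is_derive_sin x) (is_derive1_cosM (s - 1) x))
    (is_derive1Z (s - 1) (is_derive1M (is_derive_cos x) (is_derive1_sinM (s - 1) x))).
  by apply: is_derive_eq; rewrite /g; ring.
have f0 : f 0 = 0 by rewrite /f !(mulr0, sin0, mul0r) subrr.
rewrite -/(f t) -[leRHS]f0; apply: (@derive_le0_nincr f g 0 t) => //.
- apply: continuous_subspaceT => x; exact: is_derive1_continuous (df x).
- move=> x /andP[x0 xt]; rewrite /g mulr_le0_ge0//.
    have : 1 <= (s - 1) ^+ 2 by rewrite expr_ge1//; lra.
    lra.
  rewrite mulr_ge0//; first by apply: ct; [exact: ltW|lra].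
  apply: cos_ge0_pihalf; apply/andP; split; last by nra.
  by rewrite (@le_trans _ _ 0)//; [lra|rewrite mulr_ge0 ?ltW//; lra].
Qed.

End one_variable.

(** * Trigonometric inequalities *)

Section trigonometric_inequalities.
Variable R : realType.
Implicit Types (s t b : R).

Lemma is_derive1_normr_powR s (y : R) : 0 < y ->
  is_derive y 1 (fun x : R => `|x| `^ s) (s * y `^ (s - 1)).
Proof.
move=> y0; apply: (near_eq_is_derive _ (is_derive1_powR s y0)).
near=> x; rewrite ger0_norm// ltW//; near: x; exact: lt_nbhsr.
Unshelve. all: by end_near. Qed.

Lemma continuous_cos_powR s : 0 < s -> continuous (fun t : R => `|cos t| `^ s).
Proof.
move=> s0 x; apply: (@continuous_comp _ _ _ (@cos R) (fun y : R => `|y| `^ s)).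
  exact: continuous_cos.
exact: continuous_normr_powR.
Qed.

Lemma continuous_sin_powR s : 0 < s -> continuous (fun t : R => `|sin t| `^ s).
Proof.
move=> s0 x; apply: (@continuous_comp _ _ _ (@sin R) (fun y : R => `|y| `^ s)).
  exact: continuous_sin.
exact: continuous_normr_powR.
Qed.

Lemma continuous_cosM b s : continuous (fun t : R => b * cos (s * t)).
Proof.
by move=> x; exact: is_derive1_continuous (is_derive1Z b (is_derive1_cosM s x)).
Qed.

Section contact.
Variables (s : R).
Hypothesis s1 : 1 < s.
(** The first positive zero of cos (s t). The curves cos^s t and cos^s t0 + b cos (s t) meet there,
    and equality of the slopes forces b = cos^(s - 1) t0 sin t0. For sin^s t and sin^s t0 - b cos (s
    t) it forces b = sin^(s - 1) t0 cos t0. *)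
Let t0 := pi / (2 * s).
Let s0 : 0 < s := lt_trans ltr01 s1.

Lemma contact_pi : s * t0 = pi / 2.
Proof. by rewrite /t0; field; rewrite gt_eqF. Qed.

Lemma contact_bounds : [/\ 0 < t0, t0 < pi / 2, t0 < pi / s & 0 < cos t0 /\ 0 < sin t0].
Proof.
have pi0 := pi_gt0 R; have e := contact_pi.
have := s1; have t0p : 0 < t0 by rewrite divr_gt0// mulr_gt0.
move=> s1'; have t0l : t0 < pi / 2 by rewrite -e; nra.
split => //; first by rewrite ltr_pdivlMr//; lra.
split; first by apply: cos_gt0_pihalf; rewrite t0l andbT; lra.
by apply: sin_gt0_pihalf; rewrite t0p t0l.
Qed.

(** The derivative of cos^s t - b cos (s t) is s times the difference of b sin (s t) and cos^(s - 1)
    t sin t; this is the logarithm of their ratio without the constant b, so comparison with its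
    value at t0 gives the sign. *)
Definition log_ratio_cos t := ln (sin (s * t)) - ((s - 1) * ln (cos t) + ln (sin t)).

Lemma log_ratio_cos_le t (u := cos t `^ (s - 1) * sin t)
    (b := cos t0 `^ (s - 1) * sin t0) : 0 < t < pi / 2 -> t < pi / s ->
  (log_ratio_cos t0 <= log_ratio_cos t -> u <= b * sin (s * t)) /\
  (log_ratio_cos t <= log_ratio_cos t0 -> b * sin (s * t) <= u).
Proof.
move=> /andP[tp tl] ts; have [a1 a2 a3 [a4 a5]] := contact_bounds.
have st : 0 < sin (s * t) by apply: sinM_pi_gt0; rewrite ?tp ?ts ?ltW.
have c0 : 0 < cos t by apply: cos_gt0_pihalf; rewrite tl andbT; lra.
have sn0 : 0 < sin t by apply: sin_gt0_pihalf; rewrite tp tl.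
have u0 : 0 < u by rewrite mulr_gt0 ?powR_gt0.
have b0 : 0 < b by rewrite mulr_gt0 ?powR_gt0.
have bs0 : 0 < b * sin (s * t) by rewrite mulr_gt0.
have -> : (u <= b * sin (s * t)) = (ln u <= ln (b * sin (s * t))) by rewrite ler_ln ?posrE.
have -> : (b * sin (s * t) <= u) = (ln (b * sin (s * t)) <= ln u) by rewrite ler_ln ?posrE.
rewrite lnM ?posrE// /u lnM ?posrE ?powR_gt0// ln_powR.
rewrite /b lnM ?posrE ?powR_gt0// ln_powR.
rewrite /log_ratio_cos contact_pi sin_pihalf ln1 sub0r; split; lra.
Qed.

Lemma is_derive1_log_ratio_cos t : 0 < t < pi / 2 -> t < pi / s ->
  is_derive t 1 log_ratio_cos
   (((s - 1) * (sin t * cos ((s - 1) * t)) - cos t * sin ((s - 1) * t)) /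
    (sin (s * t) * sin t * cos t)).
Proof.
move=> /andP[tp tl] ts.
have st : 0 < sin (s * t) by apply: sinM_pi_gt0; rewrite ?tp ?ts ?ltW.
have c0 : 0 < cos t by apply: cos_gt0_pihalf; rewrite tl andbT; lra.
have sn0 : 0 < sin t by apply: sin_gt0_pihalf; rewrite tp tl.
have d := is_derive1B (is_derive1_compE (is_derive1_ln st) (is_derive1_sinM s t))
  (is_derive1D (is_derive1Z (s - 1) (is_derive1_compE (is_derive1_ln c0) (is_derive_cos t)))
    (is_derive1_compE (is_derive1_ln sn0) (is_derive_sin t))).
apply: is_derive_eq.
(* Splitting s t as (s - 1) t + t brings out the factor cos^2 t + sin^2 t = 1. *)
have Es : sin (s * t) = sin ((s - 1) * t) * cos t + cos ((s - 1) * t) * sin t.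
  by rewrite -sinD; congr sin; ring.
have Ec : cos (s * t) = cos ((s - 1) * t) * cos t - sin ((s - 1) * t) * sin t.
  by rewrite -cosD; congr cos; ring.
have nz : sin (s * t) != 0 by rewrite gt_eqF.
have c2 : cos t ^+ 2 = 1 - sin t ^+ 2 by rewrite cos2sin2.
have n1 : sin t != 0 by rewrite gt_eqF.
have n2 : cos t != 0 by rewrite gt_eqF.
apply: (mulIf (mulf_neq0 (mulf_neq0 nz n1) n2)); rewrite mulfVK ?mulf_neq0//.
rewrite [LHS](_ : _ = s * cos (s * t) * sin t * cos t +
   (s - 1) * sin t ^+ 2 * sin (s * t) - cos t ^+ 2 * sin (s * t)); last first.
  by field; rewrite n1 n2 nz.
rewrite Es Ec.
transitivity (((s - 1) * (sin t * cos ((s - 1) * t)) - cos t * sin ((s - 1) * t)) *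
  (cos t ^+ 2 + sin t ^+ 2)).
  by ring.
by rewrite c2 subrK mulr1.
Qed.

Definition log_ratio_sin_fun t := ln (sin (s * t)) - ((s - 1) * ln (sin t) + ln (cos t)).

Lemma log_ratio_sin_le t (u := sin t `^ (s - 1) * cos t)
    (b := sin t0 `^ (s - 1) * cos t0) : 0 < t < pi / 2 -> t < pi / s ->
  (log_ratio_sin_fun t0 <= log_ratio_sin_fun t -> u <= b * sin (s * t)) /\
  (log_ratio_sin_fun t <= log_ratio_sin_fun t0 -> b * sin (s * t) <= u).
Proof.
move=> /andP[tp tl] ts; have [a1 a2 a3 [a4 a5]] := contact_bounds.
have st : 0 < sin (s * t) by apply: sinM_pi_gt0; rewrite ?tp ?ts ?ltW.
have c0 : 0 < cos t by apply: cos_gt0_pihalf; rewrite tl andbT; lra.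
have sn0 : 0 < sin t by apply: sin_gt0_pihalf; rewrite tp tl.
have u0 : 0 < u by rewrite mulr_gt0 ?powR_gt0.
have b0 : 0 < b by rewrite mulr_gt0 ?powR_gt0.
have bs0 : 0 < b * sin (s * t) by rewrite mulr_gt0.
have -> : (u <= b * sin (s * t)) = (ln u <= ln (b * sin (s * t))) by rewrite ler_ln ?posrE.
have -> : (b * sin (s * t) <= u) = (ln (b * sin (s * t)) <= ln u) by rewrite ler_ln ?posrE.
rewrite lnM ?posrE// /u lnM ?posrE ?powR_gt0// ln_powR.
rewrite /b lnM ?posrE ?powR_gt0// ln_powR.
rewrite /log_ratio_sin_fun contact_pi sin_pihalf ln1 sub0r; split; lra.
Qed.

Lemma is_derive1_log_ratio_sin t : 0 < t < pi / 2 -> t < pi / s ->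
  is_derive t 1 log_ratio_sin_fun
   ((sin t * cos ((s - 1) * t) - (s - 1) * (cos t * sin ((s - 1) * t))) /
    (sin (s * t) * sin t * cos t)).
Proof.
move=> /andP[tp tl] ts.
have st : 0 < sin (s * t) by apply: sinM_pi_gt0; rewrite ?tp ?ts ?ltW.
have c0 : 0 < cos t by apply: cos_gt0_pihalf; rewrite tl andbT; lra.
have sn0 : 0 < sin t by apply: sin_gt0_pihalf; rewrite tp tl.
have d := is_derive1B (is_derive1_compE (is_derive1_ln st) (is_derive1_sinM s t))
  (is_derive1D (is_derive1Z (s - 1) (is_derive1_compE (is_derive1_ln sn0) (is_derive_sin t)))
    (is_derive1_compE (is_derive1_ln c0) (is_derive_cos t))).
apply: is_derive_eq.
have Es : sin (s * t) = sin ((s - 1) * t) * cos t + cos ((s - 1) * t) * sin t.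
  by rewrite -sinD; congr sin; ring.
have Ec : cos (s * t) = cos ((s - 1) * t) * cos t - sin ((s - 1) * t) * sin t.
  by rewrite -cosD; congr cos; ring.
have nz : sin (s * t) != 0 by rewrite gt_eqF.
have c2 : cos t ^+ 2 = 1 - sin t ^+ 2 by rewrite cos2sin2.
have n1 : sin t != 0 by rewrite gt_eqF.
have n2 : cos t != 0 by rewrite gt_eqF.
apply: (mulIf (mulf_neq0 (mulf_neq0 nz n1) n2)); rewrite mulfVK ?mulf_neq0//.
rewrite [LHS](_ : _ = s * cos (s * t) * sin t * cos t -
   (s - 1) * cos t ^+ 2 * sin (s * t) + sin t ^+ 2 * sin (s * t)); last first.
  by field; rewrite n1 n2 nz.
rewrite Es Ec.
transitivity ((sin t * cos ((s - 1) * t) - (s - 1) * (cos t * sin ((s - 1) * t))) *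
  (cos t ^+ 2 + sin t ^+ 2)).
  by ring.
by rewrite c2 subrK mulr1.
Qed.

(** The difference of the two sides vanishes at t0 and is unimodal there: for s <= 2 the logarithmic
    ratio is nondecreasing in t. *)
Lemma cos_powR_ge t : s <= 2 -> 0 <= t <= pi / 2 ->
  cos t0 `^ s + cos t0 `^ (s - 1) * sin t0 * cos (s * t) <= cos t `^ s.
Proof.
move=> s2 /andP[tp tl]; have [a1 a2 a3 [a4 a5]] := contact_bounds.
have pi0 := pi_gt0 R.
pose b := cos t0 `^ (s - 1) * sin t0; rewrite -/b.
(* With the absolute value, f is continuous on the whole line, also where the cosine is negative. *)
pose f (t : R) : R := b * cos (s * t) - `|cos t| `^ s.
pose g (t : R) : R := s * (cos t `^ (s - 1) * sin t - b * sin (s * t)).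
have s1' := s1.
have hs : pi / 2 <= pi / s by rewrite ler_pM2l// lef_pV2 ?posrE.
have ct (x : R) : 0 < x < pi / 2 -> 0 < cos x.
  by move=> /andP[x0 xl]; apply: cos_gt0_pihalf; rewrite xl andbT; lra.
suff : f t <= f t0.
  rewrite /f contact_pi cos_pihalf mulr0 sub0r ger0_norm; last first.
    by apply: cos_ge0_pihalf; rewrite tl andbT; lra.
  rewrite ger0_norm; last exact: ltW.
  lra.
have U := (@unimodal_max _ f g (fun t => - log_ratio_cos t)
  (fun t => - (((s - 1) * (sin t * cos ((s - 1) * t)) - cos t * sin ((s - 1) * t)) /
    (sin (s * t) * sin t * cos t))) t0 (pi / 2)); apply: U.
- by rewrite a1 a2.
- by apply: continuous_subspaceT => x; apply: cvgB;
    [exact: continuous_cosM|exact: continuous_cos_powR].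
- move=> x xin; have := ct x xin => cx.
  have d := is_derive1B (is_derive1Z b (is_derive1_cosM s x))
     (is_derive1_compE (is_derive1_normr_powR s cx) (is_derive_cos x)).
  by apply: is_derive_eq; rewrite /g; ring.
- move=> x xin; apply: is_derive1N; apply: is_derive1_log_ratio_cos => //.
  by move: xin => /andP[_ /lt_le_trans]; apply.
- move=> x xin; rewrite oppr_le0 mulr_ge0//.
    apply: log_ratio_inc; first by rewrite s1 s2.
    by move: xin => /andP[x0 xl]; rewrite !ltW.
  have /andP[x0 xl] := xin; have xs := lt_le_trans xl hs.
  have st : 0 < sin (s * x) by apply: sinM_pi_gt0; rewrite ?x0 ?xs ?ltW.
  have sx0 : 0 < sin x by apply: sin_gt0_pihalf; rewrite xin.
  by rewrite invr_ge0 !mulr_ge0// ltW// ct.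
- move=> x xin; rewrite lerN2 /g => h; rewrite mulr_ge0//; first lra.
  have xs : x < pi / s by move: xin => /andP[_ /lt_le_trans]; apply.
  by rewrite subr_ge0; exact: (log_ratio_cos_le xin xs).2.
- move=> x xin; rewrite lerN2 /g => h; rewrite mulr_ge0_le0//; first lra.
  have xs : x < pi / s by move: xin => /andP[_ /lt_le_trans]; apply.
  by rewrite subr_le0; exact: (log_ratio_cos_le xin xs).1.
- by rewrite tp tl.
Qed.

(** For s >= 2 the ratio is monotone the other way, which reverses the inequality on [0, pi / s].
    Beyond pi / s, cos (s t) would rise again; freezing it at -1 keeps the bound, because cos^s t
    goes on decreasing up to pi / 2. *)
Lemma cos_powR_le t : 2 <= s -> 0 <= t <= pi / 2 ->
  cos t `^ s <= cos t0 `^ s + cos t0 `^ (s - 1) * sin t0 * cos (Num.min (s * t) pi).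
Proof.
move=> s2 /andP[tp tl]; have [a1 a2 a3 [a4 a5]] := contact_bounds.
have pi0 := pi_gt0 R.
pose b := cos t0 `^ (s - 1) * sin t0; rewrite -/b.
pose f (t : R) : R := `|cos t| `^ s - b * cos (s * t).
pose g (t : R) : R := s * (b * sin (s * t) - cos t `^ (s - 1) * sin t).
have hs : pi / s <= pi / 2 by rewrite ler_pM2l// lef_pV2 ?posrE//; lra.
have ct (x : R) : 0 < x < pi / s -> 0 < cos x.
  by move=> /andP[x0 xl]; apply: cos_gt0_pihalf; rewrite (lt_le_trans xl hs) andbT; lra.
suff main u : 0 <= u <= pi / s -> cos u `^ s <= cos t0 `^ s + b * cos (s * u).
  have [h|h] := leP (s * t) pi.
    by apply: main; rewrite tp/= ler_pdivlMr// mulrC.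
  apply: (@le_trans _ _ (cos (pi / s) `^ s)).
    have h' : pi / s < t by rewrite ltr_pdivrMr// mulrC.
    apply: ge0_ler_powR; rewrite ?nnegrE; first lra.
    - by apply: cos_ge0_pihalf; rewrite tl andbT; lra.
    - apply: cos_ge0_pihalf; rewrite hs andbT.
      by rewrite (@le_trans _ _ 0)// ?divr_ge0//; lra.
    - have := @ltr_cos R; move=> /(_ (pi / s) t); rewrite !in_itv/=.
      have -> : 0 <= t <= pi by apply/andP; split; lra.
      have -> : 0 <= pi / s <= pi.
        by rewrite divr_ge0 ?(ltW pi0) ?(ltW s0)//= (le_trans hs)//; lra.
      by move=> /(_ isT isT) e; apply: ltW; rewrite e.
  have := main (pi / s); rewrite mulrCA divff ?gt_eqF// mulr1; apply.
  by rewrite lexx divr_ge0// ltW.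
move=> /andP[u0 ul].
suff : f u <= f t0.
  rewrite /f contact_pi cos_pihalf mulr0 subr0 ger0_norm; last first.
    by apply: cos_ge0_pihalf; rewrite (le_trans ul hs) andbT; lra.
  rewrite ger0_norm; last exact: ltW.
  lra.
apply: (@unimodal_max _ f g log_ratio_cos
  (fun t => (((s - 1) * (sin t * cos ((s - 1) * t)) - cos t * sin ((s - 1) * t)) /
    (sin (s * t) * sin t * cos t))) t0 (pi / s)) => //.
- by rewrite a1 a3.
- by apply: continuous_subspaceT => x; apply: cvgB;
    [exact: continuous_cos_powR|exact: continuous_cosM].
- move=> x xin; have := ct x xin => cx.
  have d := is_derive1B (is_derive1_compE (is_derive1_normr_powR s cx) (is_derive_cos x))
     (is_derive1Z b (is_derive1_cosM s x)).
  by apply: is_derive_eq; rewrite /g; ring.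
- move=> x /andP[x0 xl]; apply: is_derive1_log_ratio_cos => //.
  by rewrite x0 (lt_le_trans xl).
- move=> x xin; rewrite mulr_le0_ge0//.
    apply: log_ratio_dec => //.
    by move: xin => /andP[x0 xl]; rewrite !ltW.
  have /andP[x0 xl] := xin.
  have st : 0 < sin (s * x) by apply: sinM_pi_gt0; rewrite ?x0 ?xl ?ltW.
  have sx0 : 0 < sin x by apply: sin_gt0_pihalf; rewrite x0 (lt_le_trans xl).
  by rewrite invr_ge0 !mulr_ge0// ltW// ct.
- move=> x /andP[x0 xl]; rewrite /g => h; rewrite mulr_ge0//; first lra.
  rewrite subr_ge0; apply: (log_ratio_cos_le _ xl).1 => //.
  by rewrite x0 (lt_le_trans xl).
- move=> x /andP[x0 xl]; rewrite /g => h; rewrite mulr_ge0_le0//; first lra.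
  rewrite subr_le0; apply: (log_ratio_cos_le _ xl).2 => //.
  by rewrite x0 (lt_le_trans xl).
- by rewrite u0 ul.
Qed.

(** Unimodality settles [0, pi / s]; beyond it the left side is frozen while sin^s t keeps
    increasing up to pi / 2. *)
Lemma sin_powR_ge t : 2 <= s -> 0 <= t <= pi / 2 ->
  sin t0 `^ s - sin t0 `^ (s - 1) * cos t0 * cos (Num.min (s * t) pi) <= sin t `^ s.
Proof.
move=> s2 /andP[tp tl]; have [a1 a2 a3 [a4 a5]] := contact_bounds.
have pi0 := pi_gt0 R.
pose b := sin t0 `^ (s - 1) * cos t0; rewrite -/b.
pose f (t : R) : R := - (`|sin t| `^ s) - b * cos (s * t).
pose g (t : R) : R := s * (b * sin (s * t) - sin t `^ (s - 1) * cos t).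
have hs : pi / s <= pi / 2 by rewrite ler_pM2l// lef_pV2 ?posrE//; lra.
have ct (x : R) : 0 < x < pi / s -> 0 < cos x.
  by move=> /andP[x0 xl]; apply: cos_gt0_pihalf; rewrite (lt_le_trans xl hs) andbT; lra.
have sp (x : R) : 0 < x < pi / s -> 0 < sin x.
  by move=> /andP[x0 xl]; apply: sin_gt0_pihalf; rewrite (lt_le_trans xl hs) andbT.
suff main u : 0 <= u <= pi / s -> sin t0 `^ s - b * cos (s * u) <= sin u `^ s.
  have [h|h] := leP (s * t) pi.
    by apply: main; rewrite tp/= ler_pdivlMr// mulrC.
  apply: (@le_trans _ _ (sin (pi / s) `^ s)); last first.
    have h' : pi / s < t by rewrite ltr_pdivrMr// mulrC.
    have ps0 : 0 <= pi / s by rewrite divr_ge0//; lra.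
    apply: ge0_ler_powR; rewrite ?nnegrE; first lra.
    - by apply: sin_ge0_pi; apply/andP; split; lra.
    - by apply: sin_ge0_pi; apply/andP; split; lra.
    - have := @ltr_sin R; move=> /(_ (pi / s) t); rewrite !in_itv/=.
      have -> : - (pi / 2) <= t <= pi / 2 by apply/andP; split; lra.
      have -> : - (pi / 2) <= pi / s <= pi / 2 by apply/andP; split; lra.
      by move=> /(_ isT isT) e; apply: ltW; rewrite e.
  have := main (pi / s); rewrite mulrCA divff ?gt_eqF// mulr1; apply.
  by rewrite lexx divr_ge0// ltW.
move=> /andP[u0 ul].
suff : f u <= f t0.
  rewrite /f contact_pi cos_pihalf mulr0 subr0 ger0_norm; last first.
    by apply: sin_ge0_pi; rewrite u0/=; lra.
  rewrite ger0_norm; last exact: ltW.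
  lra.
apply: (@unimodal_max _ f g log_ratio_sin_fun
  (fun t => ((sin t * cos ((s - 1) * t) - (s - 1) * (cos t * sin ((s - 1) * t))) /
    (sin (s * t) * sin t * cos t))) t0 (pi / s)) => //.
- by rewrite a1 a3.
- by apply: continuous_subspaceT => x; apply: cvgB;
    [apply: cvgN; exact: continuous_sin_powR|exact: continuous_cosM].
- move=> x xin; have := sp x xin => sx.
  have d := is_derive1B (is_derive1N (is_derive1_compE (is_derive1_normr_powR s sx) (is_derive_sin x)))
     (is_derive1Z b (is_derive1_cosM s x)).
  by apply: is_derive_eq; rewrite /g; ring.
- move=> x /andP[x0 xl]; apply: is_derive1_log_ratio_sin => //.
  by rewrite x0 (lt_le_trans xl).
- move=> x xin; rewrite mulr_le0_ge0//.
    apply: log_ratio_sin => //.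
    by move: xin => /andP[x0 xl]; rewrite !ltW.
  have /andP[x0 xl] := xin.
  have st : 0 < sin (s * x) by apply: sinM_pi_gt0; rewrite ?x0 ?xl ?ltW.
  by rewrite invr_ge0 !mulr_ge0// ltW// ?ct// sp.
- move=> x /andP[x0 xl]; rewrite /g => h; rewrite mulr_ge0//; first lra.
  rewrite subr_ge0; apply: (log_ratio_sin_le _ xl).1 => //.
  by rewrite x0 (lt_le_trans xl).
- move=> x /andP[x0 xl]; rewrite /g => h; rewrite mulr_ge0_le0//; first lra.
  rewrite subr_le0; apply: (log_ratio_sin_le _ xl).2 => //.
  by rewrite x0 (lt_le_trans xl).
- by rewrite u0 ul.
Qed.

End contact.

End trigonometric_inequalities.

(** * Second-order expansions *)

Section second_order_expansions.
Variable R : realType.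
Local Notation C := R[i].
Implicit Types (v w : C) (E F : C -> R) (k : R -> R).

Definition taylor2 k (c k0 k1 k2 : R) := forall e : R, 0 < e ->
  exists2 d : R, 0 < d & forall t, `|t| < d ->
    `|k (c + t) - (k0 + k1 * t + k2 * t ^+ 2)| <= e * t ^+ 2.

(** Peano form of the remainder: [dk] is only assumed differentiable at c. Its linearisation error
    is at most e |u| for small u, and the mean value theorem on the segment from c to c + t
    integrates this to e t^2. *)
Lemma taylor2_derive k (dk : R -> R) (c r k2 : R) : 0 < r ->
  (forall t, `|t - c| < r -> is_derive t 1 k (dk t)) ->
  is_derive c 1 dk k2 -> taylor2 k c (k c) (dk c) (k2 / 2).
Proof.
move=> r0 hk [ddk dkE] e e0.
have : (fun h => h^-1 * (dk (h + c) - dk c)) @ 0^' --> k2.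
  have := ddk; rewrite /derivable => /cvg_ex[l hl].
  have E : (fun h => h^-1 *: (dk (h *: 1 + c) - dk c)) = (fun h => h^-1 * (dk (h + c) - dk c)).
    by apply/funext => h; rewrite /GRing.scale/= mulr1.
  move: hl dkE; rewrite /derive E => hl <-.
  by rewrite (cvg_lim _ hl).
move=> /cvgrPdist_le /(_ _ e0); rewrite near_withinE /= => -[d /= d0 hd].
exists (Num.min d r) => [|t]; first by rewrite lt_min d0.
rewrite lt_min => /andP[td tr].
have bd u : `|u| <= `|t| -> `|dk (c + u) - dk c - k2 * u| <= e * `|u|.
  move=> ut; have [->|u0] := eqVneq u 0.
    by rewrite addr0 subrr mulr0 subr0 normr0 mulr0.
  have := hd u; rewrite /= sub0r normrN => /(_ (le_lt_trans ut td) u0).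
  rewrite distrC -(ler_pM2r (_ : 0 < `|u|)) ?normr_gt0// -normrM mulrBl.
  by rewrite mulrAC mulVf// mul1r (addrC u).
pose g x := k x - dk c * (x - c) - k2 / 2 * (x - c) ^+ 2.
have dg x : `|x - c| < r -> is_derive x 1 g (dk x - dk c - k2 * (x - c)).
  move=> xr; have hx := hk _ xr.
  have hl : is_derive x 1 (fun y : R => y - c) 1.
    have := is_derive1B (is_derive_id x (1 : R)) (is_derive_cst c x 1).
    by rewrite subr0.
  have d2 := is_derive1B (is_derive1B hx (is_derive1Z (dk c) hl))
    (is_derive1Z (k2 / 2) (is_derive1M hl hl)).
  by apply: is_derive_eq; field.
have dh (x : R) : x \in `]0, 1[%R -> is_derive x 1 (fun y : R => g (c + t * y))
    ((dk (c + t * x) - dk c - k2 * (t * x)) * t).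
  rewrite in_itv/= => /andP[x0 x1].
  have hi : is_derive x 1 (fun y : R => c + t * y) t.
    by have := is_derive1D (is_derive_cst c x 1) (is_derive1_lin t x); rewrite add0r.
  have xr : `|c + t * x - c| < r.
    rewrite addrAC subrr add0r normrM (gtr0_norm x0).
    by apply: le_lt_trans tr; rewrite ler_piMr// ltW.
  have := @is_derive1_compE R g (fun y : R => c + t * y) x _ _ (dg _ xr) hi.
  by rewrite [c + t * x - c]addrAC subrr add0r.
have ch : {within `[0, 1], continuous (fun y : R => g (c + t * y))}.
  apply: continuous_in_subspaceT => x; rewrite inE/= in_itv/= => /andP[x0 x1].
  have xr : `|c + t * x - c| < r.
    rewrite addrAC subrr add0r normrM (ger0_norm x0).
    by apply: le_lt_trans tr; rewrite ler_piMr.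
  have hi : is_derive x 1 (fun y : R => c + t * y) t.
    by have := is_derive1D (is_derive_cst c x 1) (is_derive1_lin t x); rewrite add0r.
  exact: is_derive1_continuous (@is_derive1_compE R g (fun y : R => c + t * y) x _ _ (dg _ xr) hi).
have [x + gE] := MVT ltr01 dh ch.
rewrite in_itv/= => /andP[x0 x1].
move: gE; rewrite mulr1 mulr0 addr0 subr0 mulr1 {1 2}/g subrr mulr0 expr0n/= mulr0 !subr0.
rewrite (addrC c t) addrK (addrC t c) => gE.
have -> : k (c + t) - (k c + dk c * t + k2 / 2 * t ^+ 2) =
    k (c + t) - dk c * t - k2 / 2 * t ^+ 2 - k c by ring.
rewrite gE normrM.
have tx : `|t * x| <= `|t| by rewrite normrM (gtr0_norm x0) ler_piMr// ltW.
have := bd _ tx => /(ler_wpM2r (normr_ge0 t)) /le_trans; apply.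
have -> : t ^+ 2 = `|t| * `|t| by rewrite -normrM ger0_norm -expr2// sqr_ge0.
by rewrite -mulrA ler_wpM2l ?(ltW e0)// ler_wpM2r.
Qed.

(** * Algebra of second-order jets *)

Definition o2 E := forall e : R, 0 < e -> exists2 d : R, 0 < d &
  forall v, normc v < d -> `|E v| <= e * normc v ^+ 2.

Lemma o2_le E1 E2 : o2 E2 ->
  (exists2 d : R, 0 < d & forall v, normc v < d -> `|E1 v| <= `|E2 v|) -> o2 E1.
Proof.
move=> h2 [r r0 hr] e e0; have [d d0 hd] := h2 e e0.
exists (Num.min d r) => [|v]; first by rewrite lt_min d0.
by rewrite lt_min => /andP[vd vr]; apply: le_trans (hr _ vr) (hd _ vd).
Qed.

Lemma o2D E1 E2 : o2 E1 -> o2 E2 -> o2 (fun v => E1 v + E2 v).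
Proof.
move=> h1 h2 e e0; have e2 : 0 < e / 2 by rewrite divr_gt0.
have [d1 d10 hd1] := h1 _ e2; have [d2 d20 hd2] := h2 _ e2.
exists (Num.min d1 d2) => [|v]; first by rewrite lt_min d10.
rewrite lt_min => /andP[v1 v2]; apply: le_trans (ler_normD _ _) _.
by have := hd1 _ v1; have := hd2 _ v2; lra.
Qed.

Definition near0_bounded F := exists2 K : R, 0 < K & exists2 d : R, 0 < d &
  forall v, normc v < d -> `|F v| <= K.

Lemma o2M F E : near0_bounded F -> o2 E -> o2 (fun v => F v * E v).
Proof.
move=> [K K0 [r r0 hr]] hE e e0.
have [d d0 hd] := hE (e / K) (divr_gt0 e0 K0).
exists (Num.min d r) => [|v]; first by rewrite lt_min d0.
rewrite lt_min => /andP[vd vr]; rewrite normrM.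
apply: le_trans (ler_pM _ _ (hr _ vr) (hd _ vd)) _ => //.
by rewrite mulrA [K * _]mulrC divfK// gt_eqF.
Qed.

Lemma o2_cubic F : (exists2 K : R, 0 < K & exists2 d : R, 0 < d &
  forall v, normc v < d -> `|F v| <= K * normc v ^+ 3) -> o2 F.
Proof.
move=> [K K0 [r r0 hr]] e e0.
exists (Num.min r (e / K)) => [|v]; first by rewrite lt_min r0 divr_gt0.
rewrite lt_min => /andP[vr ve]; apply: le_trans (hr _ vr) _.
rewrite exprS mulrA ler_wpM2r ?sqr_ge0// mulrC -ler_pdivlMr//.
exact: ltW.
Qed.

Definition quad (c p q a b d : R) v : R :=
  c + p * complex.Re v + q * complex.Im v + a * complex.Re v ^+ 2 +
  b * (complex.Re v * complex.Im v) + d * complex.Im v ^+ 2.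

(** Second-order expansion at 0 carried by six real coefficients, so that sums, products and
    compositions reduce to [ring] or [field]. The function is harmonic to second order at the point
    exactly when d = - a. *)
Definition jet F (c p q a b d : R) := o2 (fun v => F v - quad c p q a b d v).

Lemma jet_bounded F (c p q a b d : R) : jet F c p q a b d ->
  exists2 K : R, 0 < K & exists2 r : R, 0 < r <= 1 &
    forall v, normc v < r -> `|F v - c| <= K * normc v.
Proof.
move=> jF; have [r r0 hr] := jF 1 ltr01.
pose K := `|p| + `|q| + `|a| + `|b| + `|d| + 1.
have K0 : 0 < K by rewrite ltr_wpDl// !addr_ge0.
exists K => //; exists (Num.min r 1) => [|v].
  by rewrite lt_min r0 ltr01 ge_min lexx orbT.
rewrite lt_min => /andP[vr v1].
have n0 := normc_ge0 v; have hx := normRe_le v; have hy := normIm_le v.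
have -> : F v - c = (F v - quad c p q a b d v) + (quad c p q a b d v - c) by ring.
apply: le_trans (ler_normD _ _) _.
apply: le_trans (lerD (hr _ vr) (lexx _)) _; rewrite mul1r.
have -> : quad c p q a b d v - c = p * complex.Re v + q * complex.Im v +
  a * complex.Re v ^+ 2 + b * (complex.Re v * complex.Im v) + d * complex.Im v ^+ 2.
  by rewrite /quad; ring.
move: hx hy; move: (complex.Re v) (complex.Im v) (normc v) n0 {vr} v1 => x y n n0 n1 hx hy.
have n2 : n ^+ 2 <= n by rewrite expr2 ler_piMl// ltW.
have hxx : `|x ^+ 2| <= n.
  by rewrite normrX; apply: le_trans n2; rewrite ler_sqr ?nnegrE.
have hyy : `|y ^+ 2| <= n.
  by rewrite normrX; apply: le_trans n2; rewrite ler_sqr ?nnegrE.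
have hxy : `|x * y| <= n.
  by rewrite normrM; apply: le_trans n2; rewrite expr2 ler_pM.
have st (u w : R) : `|w| <= n -> `|u * w| <= `|u| * n.
  by move=> hw; rewrite normrM ler_wpM2l.
rewrite /K !mulrDl mul1r addrC lerD//.
do 4 (apply: le_trans (ler_normD _ _) _; apply: lerD; last exact: st).
exact: st.
Qed.

Lemma jet_near0_bounded F (c p q a b d : R) : jet F c p q a b d -> near0_bounded F.
Proof.
move=> /jet_bounded[K K0 [r /andP[r0 r1] hr]].
exists (K + `|c|); first by rewrite ltr_pwDl.
exists r => // v vr; rewrite -[F v](subrK c); apply: le_trans (ler_normD _ _) _.
rewrite lerD2r; apply: le_trans (hr _ vr) _.
by rewrite ler_piMr// ltW// (lt_le_trans vr).
Qed.

Lemma jet_quad (c p q a b d : R) : jet (quad c p q a b d) c p q a b d.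
Proof.
move=> e e0; exists 1 => // v _.
by rewrite subrr normr0 mulr_ge0 ?sqr_ge0// ltW.
Qed.

Lemma jet_eq F (c p q a b d c' p' q' a' b' d' : R) : jet F c p q a b d ->
  [/\ c = c', p = p' & q = q'] -> [/\ a = a', b = b' & d = d'] ->
  jet F c' p' q' a' b' d'.
Proof. by move=> h [<- <- <-] [<- <- <-]. Qed.

Lemma jetD F F' (c p q a b d c' p' q' a' b' d' : R) :
  jet F c p q a b d -> jet F' c' p' q' a' b' d' ->
  jet (fun v => F v + F' v) (c + c') (p + p') (q + q') (a + a') (b + b') (d + d').
Proof.
move=> h h'; apply: (o2_le (o2D h h')); exists 1 => // v _.
by rewrite le_eqVlt; apply/orP; left; apply/eqP; congr `|_|; rewrite /quad; ring.
Qed.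

Lemma jetM F F' (c p q a b d c' p' q' a' b' d' : R) :
  jet F c p q a b d -> jet F' c' p' q' a' b' d' ->
  jet (fun v => F v * F' v) (c * c') (c * p' + p * c') (c * q' + q * c')
    (c * a' + p * p' + a * c') (c * b' + p * q' + q * p' + b * c')
    (c * d' + q * q' + d * c').
Proof.
move=> h h'.
pose P := quad c p q a b d; pose P' := quad c' p' q' a' b' d'.
have h1 := o2M (jet_near0_bounded h') h.
have h2 := o2M (jet_near0_bounded (jet_quad c p q a b d)) h'.
pose T v := P v * P' v - quad (c * c') (c * p' + p * c') (c * q' + q * c')
    (c * a' + p * p' + a * c') (c * b' + p * q' + q * p' + b * c')
    (c * d' + q * q' + d * c') v.
(* [T] collects the terms of degree three and four in the product of the two quadratic
   polynomials. *)
have h3 : o2 T.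
  pose A v := a * complex.Re v ^+ 2 + b * (complex.Re v * complex.Im v) + d * complex.Im v ^+ 2.
  pose A' v := a' * complex.Re v ^+ 2 + b' * (complex.Re v * complex.Im v) + d' * complex.Im v ^+ 2.
  pose L v := p * complex.Re v + q * complex.Im v.
  pose L' v := p' * complex.Re v + q' * complex.Im v.
  have bL (s t : R) v : `|s * complex.Re v + t * complex.Im v| <= (`|s| + `|t|) * normc v.
    apply: le_trans (ler_normD _ _) _; rewrite mulrDl !normrM.
    by rewrite lerD// ler_wpM2l// ?normRe_le ?normIm_le.
  have bA (s t u : R) v : `|s * complex.Re v ^+ 2 + t * (complex.Re v * complex.Im v) +
      u * complex.Im v ^+ 2| <= (`|s| + `|t| + `|u|) * normc v ^+ 2.
    have hx := normRe_le v; have hy := normIm_le v.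
    apply: le_trans (ler_normD _ _) _; rewrite mulrDl; apply: lerD.
      apply: le_trans (ler_normD _ _) _; rewrite mulrDl; apply: lerD.
        by rewrite normrM ler_wpM2l// normrX ler_sqr ?nnegrE ?normc_ge0.
      by rewrite normrM ler_wpM2l// normrM expr2 ler_pM.
    by rewrite normrM ler_wpM2l// normrX ler_sqr ?nnegrE ?normc_ge0.
  pose k1 := `|p| + `|q|; pose k2 := `|p'| + `|q'|.
  pose m1 := `|a| + `|b| + `|d|; pose m2 := `|a'| + `|b'| + `|d'|.
  have k10 : 0 <= k1 by rewrite addr_ge0.
  have k20 : 0 <= k2 by rewrite addr_ge0.
  have m10 : 0 <= m1 by rewrite !addr_ge0.
  have m20 : 0 <= m2 by rewrite !addr_ge0.
  apply: o2_cubic; exists (k1 * m2 + m1 * k2 + m1 * m2 + 1).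
    by rewrite ltr_wpDl// !addr_ge0// mulr_ge0.
  exists 1 => // v v1.
  have -> : T v = L v * A' v + A v * L' v + A v * A' v.
    by rewrite /T /P /P' /quad /L /L' /A /A'; ring.
  have n0 := normc_ge0 v.
  have n3 : 0 <= normc v ^+ 3 by rewrite exprn_ge0.
  have n4 : normc v ^+ 4 <= normc v ^+ 3 by rewrite [leLHS]exprS ler_piMl// ltW.
  apply: (@le_trans _ _ (k1 * m2 * normc v ^+ 3 + m1 * k2 * normc v ^+ 3 + m1 * m2 * normc v ^+ 4)).
    apply: le_trans (ler_normD _ _) _; apply: lerD.
      apply: le_trans (ler_normD _ _) _; apply: lerD; rewrite normrM.
        by rewrite exprS mulrACA ler_pM// ?bL ?bA.
      by rewrite (exprD _ 2 1) expr1 mulrACA ler_pM// ?bL ?bA.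
    by rewrite normrM (exprD _ 2 2) mulrACA ler_pM// bA.
  have mm := mulr_ge0 m10 m20.
  have -> : (k1 * m2 + m1 * k2 + m1 * m2 + 1) * normc v ^+ 3 =
    k1 * m2 * normc v ^+ 3 + m1 * k2 * normc v ^+ 3 + m1 * m2 * normc v ^+ 3 + normc v ^+ 3 by ring.
  by rewrite -[leLHS]addr0 lerD// lerD2l ler_wpM2l.
apply: (o2_le (o2D (o2D h1 h2) h3)); exists 1 => // v _.
rewrite le_eqVlt; apply/orP; left; apply/eqP; congr `|_|.
by rewrite /T /P /P'; ring.
Qed.

Lemma jetZ F (s c p q a b d : R) : jet F c p q a b d ->
  jet (fun v => s * F v) (s * c) (s * p) (s * q) (s * a) (s * b) (s * d).
Proof.
move=> h; have hs : near0_bounded (fun=> s).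
  by exists (`|s| + 1); [rewrite ltr_wpDl|exists 1 => // v _; rewrite lerDl].
apply: (o2_le (o2M hs h)); exists 1 => // v _.
by rewrite le_eqVlt; apply/orP; left; apply/eqP; congr `|_|; rewrite /quad; ring.
Qed.

Lemma jet_comp k F (k0 k1 k2 c p q a b d : R) : taylor2 k c k0 k1 k2 ->
  jet F c p q a b d ->
  jet (fun v => k (F v)) k0 (k1 * p) (k1 * q) (k1 * a + k2 * p ^+ 2)
    (k1 * b + 2 * k2 * (p * q)) (k1 * d + k2 * q ^+ 2).
Proof.
move=> tk jF; have [K K0 [r /andP[r0 _] hr]] := jet_bounded jF.
pose E v := k (F v) - (k0 + k1 * (F v - c) + k2 * (F v - c) ^+ 2).
have oE : o2 E.
  move=> e e0; have K2 : 0 < K ^+ 2 by rewrite exprn_gt0.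
  have [t t0 ht] := tk _ (divr_gt0 e0 K2).
  exists (Num.min r (t / K)) => [|v]; first by rewrite lt_min r0 divr_gt0.
  rewrite lt_min => /andP[vr vt]; have Fv := hr _ vr.
  have := ht (F v - c); rewrite (addrC c) subrK => /(_ _)/le_trans; apply.
    by apply: le_lt_trans Fv _; rewrite mulrC -ltr_pdivlMr.
  rewrite -[leLHS]mulrA ler_wpM2l ?(ltW e0)// mulrC ler_pdivrMr// mulrC -exprMn.
  by rewrite -[leLHS]ger0_norm ?sqr_ge0// normrX ler_sqr ?nnegrE// mulr_ge0 ?normc_ge0// ltW.
have jc : jet (fun v => F v + - c) (c + - c) (p + 0) (q + 0) (a + 0) (b + 0) (d + 0).
  apply: jetD => //; apply: (o2_le (jet_quad (- c) 0 0 0 0 0)); exists 1 => // v _.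
  by rewrite le_eqVlt; apply/orP; left; apply/eqP; congr `|_|; rewrite /quad; ring.
have jk0 : jet (fun=> k0) k0 0 0 0 0 0.
  apply: (o2_le (jet_quad k0 0 0 0 0 0)); exists 1 => // v _.
  by rewrite le_eqVlt; apply/orP; left; apply/eqP; congr `|_|; rewrite /quad; ring.
have j := jetD (jetD jk0 (jetZ k1 jc)) (jetZ k2 (jetM jc jc)).
apply: (o2_le (o2D oE j)); exists 1 => // v _.
rewrite le_eqVlt; apply/orP; left; apply/eqP; congr `|_|.
by rewrite /E /quad; ring.
Qed.

Lemma jet_Re : jet (@complex.Re R) 0 1 0 0 0 0.
Proof.
apply: (o2_le (jet_quad 0 1 0 0 0 0)); exists 1 => // v _.
by rewrite le_eqVlt; apply/orP; left; apply/eqP; congr `|_|; rewrite /quad; ring.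
Qed.

Lemma jet_Im : jet (@complex.Im R) 0 0 1 0 0 0.
Proof.
apply: (o2_le (jet_quad 0 0 1 0 0 0)); exists 1 => // v _.
by rewrite le_eqVlt; apply/orP; left; apply/eqP; congr `|_|; rewrite /quad; ring.
Qed.

Lemma jet_cst (c : R) : jet (fun=> c) c 0 0 0 0 0.
Proof.
apply: (o2_le (jet_quad c 0 0 0 0 0)); exists 1 => // v _.
by rewrite le_eqVlt; apply/orP; left; apply/eqP; congr `|_|; rewrite /quad; ring.
Qed.

(** * Jets of the logarithm, the argument and real powers *)

Lemma taylor2_ln : taylor2 (@ln R) 1 0 1 (- 1 / 2).
Proof.
rewrite -[0]ln1 -[X in taylor2 _ _ _ X _]invr1.
apply: (@taylor2_derive _ (fun x : R => x^-1) 1 1) => // [t t1|].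
  by apply: is_derive1_ln; move: t1; rewrite ltr_norml; lra.
have h := is_derive1_powR (-1) (ltr01 : 0 < 1 :> R).
apply: (near_eq_is_derive (f := fun x : R => x `^ (-1))).
  near=> x; rewrite powR_inv1// ltW//; near: x; exact: lt_nbhsr.
by rewrite powR1 mulr1 in h.
Unshelve. all: by end_near. Qed.

Lemma taylor2_inv : taylor2 (fun x : R => x^-1) 1 1 (-1) 1.
Proof.
move=> e e0; exists (Num.min (1 / 2) (e / 2)) => [|t]; first by rewrite lt_min !divr_gt0.
rewrite lt_min => /andP[t1 te].
have t2 : 1 / 2 <= 1 + t by move: t1; rewrite ltr_norml; lra.
have tn : 1 + t != 0 by rewrite gt_eqF//; lra.
have -> : (1 + t)^-1 - (1 + -1 * t + 1 * t ^+ 2) = (- t / (1 + t)) * t ^+ 2.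
  by field.
rewrite normrM [X in _ * X]ger0_norm ?sqr_ge0// ler_wpM2r ?sqr_ge0//.
rewrite normrM normrN normfV (ger0_norm (_ : 0 <= 1 + t)); last lra.
rewrite ler_pdivrMr; last lra.
have : 0 <= `|t| by []. nra.
Qed.

Lemma taylor2_atan : taylor2 (@atan R) 0 0 1 0.
Proof.
have := @taylor2_derive (@atan R) (fun x => (1 + x ^+ 2)^-1) 0 1 0 ltr01.
rewrite atan0 expr0n/= addr0 invr1 mul0r; apply.
have h1 : is_derive (0 : R) 1 (fun x : R => 1 + x ^+ 2) 0.
  have h := is_derive1D (is_derive_cst (1 : R) (0 : R) (1 : R))
    (is_derive1M (is_derive_id (0 : R) (1 : R)) (is_derive_id (0 : R) (1 : R))).
  by apply: is_derive_eq; rewrite !mul0r !addr0.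
have h2 := is_derive1_powR (-1) (ltr01 : 0 < 1 :> R).
have h3 : is_derive (0 : R) 1 (fun x : R => (1 + x ^+ 2) `^ (-1)) 0.
  have e1 : (1 : R) = 1 + 0 ^+ 2 by rewrite expr0n/= addr0.
  rewrite {1}e1 in h2.
  by have := @is_derive1_compE R (fun y : R => y `^ (-1)) (fun x : R => 1 + x ^+ 2) 0 _ _ h2 h1; rewrite mulr0.
apply: (near_eq_is_derive _ h3); near=> x.
by rewrite powR_inv1// addr_ge0// sqr_ge0.
Unshelve. all: by end_near. Qed.

Lemma taylor2_expRM (s : R) : taylor2 (fun t => expR (s * t)) 0 1 s (s ^+ 2 / 2).
Proof.
have de (x : R) : is_derive x 1 (fun t : R => expR (s * t)) (s * expR (s * x)).
  have := is_derive1_compE (is_derive_expR (s * x)) (is_derive1_lin s x).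
  by rewrite mulrC.
have := @taylor2_derive _ (fun x => s * expR (s * x)) 0 1 (s ^+ 2) ltr01 (fun t _ => de t).
rewrite mulr0 expR0 mulr1; apply.
have := is_derive1Z s (de 0); by rewrite mulr0 expR0 mulr1 -expr2.
Qed.

Lemma taylor2_cosM (s tau : R) :
  taylor2 (fun t => cos (s * t + tau)) 0 (cos tau) (- (s * sin tau)) (- (s ^+ 2 * cos tau) / 2).
Proof.
have dl (x : R) : is_derive x 1 (fun t : R => s * t + tau) s.
  by have := is_derive1D (is_derive1_lin s x) (is_derive_cst tau x 1); rewrite addr0.
have dc (x : R) : is_derive x 1 (fun t : R => cos (s * t + tau)) (- (s * sin (s * x + tau))).
  have := @is_derive1_compE R cos (fun t : R => s * t + tau) x _ _ (is_derive_cos (s * x + tau)) (dl x).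
  by rewrite mulNr mulrC.
have := @taylor2_derive _ (fun x => - (s * sin (s * x + tau))) 0 1
  (- (s ^+ 2 * cos tau)) ltr01 (fun t _ => dc t).
rewrite mulr0 add0r; apply.
have := is_derive1N (is_derive1Z s (@is_derive1_compE R sin (fun t : R => s * t + tau) 0 _ _ (is_derive_sin (s * 0 + tau)) (dl 0))).
by have -> : s * (cos (s * 0 + tau) * s) = s ^+ 2 * cos tau by rewrite mulr0 add0r; ring.
Qed.

(** With [arg1], the real and imaginary parts of the principal logarithm of 1 + v for |v| < 1; there
    Re (1 + v) > 0, so the arctangent is the argument. *)
Definition log_abs1 v : R := ln (normc (1 + v)).
Definition arg1 v : R := atan (complex.Im v / (1 + complex.Re v)).

Lemma normc1D_gt0 v : normc v < 1 -> 0 < 1 + complex.Re v /\ 0 < normc (1 + v).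
Proof.
move=> v1; have := normRe_le v; rewrite ler_norml => /andP[h _].
have h1 : 0 < 1 + complex.Re v by lra.
split => //; rewrite normc_gt0; apply/eqP => /(congr1 (@complex.Re R)).
by rewrite ReD /= => e; rewrite e ltxx in h1.
Qed.

Lemma polar1D v : normc v < 1 ->
  1 + v = (expR (log_abs1 v))%:C%C * cis (arg1 v).
Proof.
move=> v1; have [x0 n0] := normc1D_gt0 v1.
rewrite /log_abs1 lnK ?posrE// /arg1.
set q := complex.Im v / _.
have ny : complex.Im v = q * (1 + complex.Re v) by rewrite /q divfK// gt_eqF.
have q0 : 0 < 1 + q ^+ 2 by rewrite ltr_pwDl// sqr_ge0.
have nE : normc (1 + v) = (1 + complex.Re v) * Num.sqrt (1 + q ^+ 2).
  apply/eqP; rewrite -(@eqrXn2 _ 2) ?normc_ge0 ?mulr_ge0 ?sqrtr_ge0 ?(ltW x0)//.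
  rewrite sqr_normc ReD ImD /= add0r exprMn sqr_sqrtr ?(ltW q0)// ny; apply/eqP; ring.
have sq : Num.sqrt (1 + q ^+ 2) != 0 by rewrite gt_eqF// sqrtr_gt0.
have c0 : cos (atan q) = (Num.sqrt (1 + q ^+ 2))^-1 by rewrite cos_atan.
have s0 : sin (atan q) = q * (Num.sqrt (1 + q ^+ 2))^-1.
  have E : sin (atan q) / cos (atan q) = q := atanK q.
  by rewrite -c0 -[X in _ = X * _]E divfK// c0 invr_eq0.
apply: eqC; rewrite ?ReMr ?ImMr /= ?c0 ?s0 nE ?ReD ?ImD/=.
  by rewrite mulfK.
by rewrite add0r [q * _]mulrC mulrA mulfK// ny mulrC.
Qed.

Lemma jet_log_abs1 : jet log_abs1 0 1 0 (- 1 / 2) 0 (1 / 2).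
Proof.
have jx := jet_Re; have jy := jet_Im.
have j1 := jetD (jet_cst 1) (jetD (jetZ 2 jx) (jetD (jetM jx jx) (jetM jy jy))).
have j2 : jet (fun v => 1 + (2 * complex.Re v + (complex.Re v * complex.Re v +
    complex.Im v * complex.Im v))) 1 2 0 1 0 1.
  by apply: (jet_eq j1); split; ring.
have j3 := jetZ (1 / 2) (jet_comp taylor2_ln j2).
have j4 := jet_eq j3 (c' := 0) (p' := 1) (q' := 0) (a' := - 1 / 2) (b' := 0) (d' := 1 / 2).
have {}j4 := j4 (And3 _ _ _) (And3 _ _ _).
apply: (o2_le (j4 _ _ _ _ _ _)); try (by field); try (by ring).
exists 1 => // v v1; have [x0 n0] := normc1D_gt0 v1.
rewrite /log_abs1 (_ : 1 + (2 * _ + _) = normc (1 + v) ^+ 2).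
  have -> // : 1 / 2 * ln (normc (1 + v) ^+ 2) = ln (normc (1 + v)).
  by rewrite lnXn//; field.
by rewrite sqr_normc ReD ImD /=; ring.
Qed.

Lemma jet_arg1 : jet arg1 0 0 1 0 (- 1) 0.
Proof.
have jx := jet_Re; have jy := jet_Im.
have j1 : jet (fun v => 1 + complex.Re v) 1 1 0 0 0 0.
  by apply: (jet_eq (jetD (jet_cst 1) jx)); split; ring.
have j2 := jetM jy (jet_comp taylor2_inv j1).
have j3 : jet (fun v => complex.Im v * (1 + complex.Re v)^-1) 0 0 1 0 (-1) 0.
  by apply: (jet_eq j2); split; ring.
by apply: (jet_eq (jet_comp taylor2_atan j3)); split; ring.
Qed.

(** The function is Re (e^(i tau) (1 + v)^s), and the coefficients are those of Re (e^(i tau) (1 + s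
    v + s (s - 1) / 2 v^2)). *)
Lemma jet_rpow (s tau : R) :
  jet (fun v => expR (s * log_abs1 v) * cos (s * arg1 v + tau)) (cos tau)
   (s * cos tau) (- (s * sin tau)) (s * (s - 1) / 2 * cos tau)
   (- (s * (s - 1) * sin tau)) (- (s * (s - 1) / 2 * cos tau)).
Proof.
have j := jetM (jet_comp (taylor2_expRM s) jet_log_abs1)
  (jet_comp (taylor2_cosM s tau) jet_arg1).
by apply: (jet_eq j); split; field.
Qed.

(* The second-order part of the jet is a x^2 + b x y - a y^2 = Re ((a - i b / 2) v^2). *)
Lemma touched_jet (psi : C -> R) (w0 : C) F (c p q a b : R) : w0 != 0 ->
  jet F c p q a b (- a) -> psi w0 = c ->
  (exists2 d : R, 0 < d & forall v, normc v < d -> F v <= psi (w0 * (1 + v))) ->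
  touched psi w0.
Proof.
move=> w00 jF pc [r r0 hr].
have n0 : 0 < normc w0 by rewrite normc_gt0.
(* The jet is taken in the relative increment u = v / w0, whence the powers of w0. *)
exists ((p -i* q)%C / w0), ((a -i* (b / 2))%C / w0 ^+ 2) => e e0.
have n2 : 0 < normc w0 ^+ 2 by rewrite exprn_gt0.
have [d d0 hd] := jF (e * normc w0 ^+ 2) (mulr_gt0 e0 n2).
exists (Num.min d r * normc w0) => [|v]; first by rewrite mulr_gt0// lt_min d0.
rewrite -ltr_pdivrMr// -Normc.normcV -Normc.normcM.
set u := v * w0^-1 => ud.
have -> : w0 + v = w0 * (1 + u).
  by rewrite mulrDr mulr1 /u mulrCA mulfV// mulr1.
have vE : v = u * w0 by rewrite /u mulfVK.
move: ud; rewrite lt_min => /andP[ud ur].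
apply: le_trans (hr _ ur).
have := hd _ ud; rewrite ler_norml => /andP[h _].
rewrite pc (_ : complex.Re _ = quad 0 p q a b (- a) u); last first.
  rewrite (_ : _ + _ = (p -i* q)%C * u + (a -i* (b / 2))%C * u ^+ 2); last first.
    by rewrite vE; field.
  by rewrite /quad; case: (u) => x y; rewrite expr2 /=; field.
have e1 : quad c p q a b (- a) u = c + quad 0 p q a b (- a) u by rewrite /quad; ring.
rewrite e1 in h; rewrite vE Normc.normcM exprMn.
have e2 : e * (normc u ^+ 2 * normc w0 ^+ 2) = e * normc w0 ^+ 2 * normc u ^+ 2 by ring.
rewrite e2; lra.
Qed.

End second_order_expansions.

(** * Subharmonic homogeneous functions *)

Section homogeneous_functions.
Variable R : realType.
Local Notation C := R[i].
Implicit Types (z w v : C) (s t : R).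

(* The angle in [0, pi / 2] between the line R w and the real axis. *)
Definition line_angle w : R :=
  2 * atan (`|complex.Im w| / (normc w + `|complex.Re w|)).

Lemma line_angleN w : line_angle (- w) = line_angle w.
Proof. by rewrite /line_angle normcN ReN ImN !normrN. Qed.

(** Half-angle formula sin u / (1 + cos u) = tan (u / 2), whose denominator does not vanish even on
    the imaginary axis. *)
Lemma line_angle_polar (r t : R) : 0 < r -> `|t| <= pi / 2 ->
  line_angle (r%:C%C * cis t) = `|t|.
Proof.
move=> r0 tp; have pi0 := pi_gt0 R.
rewrite /line_angle Normc.normcM normcR normc_cis mulr1 ReMr ImMr /=.
rewrite !normrM !(gtr0_norm r0).
have c0 : 0 <= cos t by apply: cos_ge0_pihalf; rewrite -ler_norml.
have sE : `|sin t| = sin `|t|.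
  have [t0|t0] := leP 0 t.
    rewrite (ger0_norm t0) ger0_norm// sin_ge0_pi// t0/=.
    by rewrite ger0_norm// in tp; lra.
  have tE : `|t| = - t by rewrite ltr0_norm.
  rewrite tE sinN ler0_norm// -oppr_ge0 -sinN sin_ge0_pi//.
  by rewrite tE in tp; apply/andP; split; lra.
rewrite sE (ger0_norm c0) -(cos_norm t).
have -> : r + r * cos `|t| = r * (1 + cos `|t|) by ring.
rewrite -mulf_div divff ?gt_eqF// mul1r.
have t0 : 0 <= `|t| by [].
set u := `|t| in tp t0 *.
have uE : u = u / 2 *+ 2 by rewrite -mulr_natl; field.
have ch : 0 < cos (u / 2) by apply: cos_gt0_pihalf; apply/andP; split; lra.
have -> : sin u / (1 + cos u) = tan (u / 2).
  rewrite {1 2}uE sin_mulr2n cos_mulr2n /tan.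
  have -> : 1 + (cos (u / 2) ^+ 2 *+ 2 - 1) = 2 * cos (u / 2) ^+ 2 by ring.
  by field; rewrite gt_eqF.
rewrite tanK; first by field.
by rewrite in_itv/=; apply/andP; split; lra.
Qed.

Lemma line_angle_polar2 (r t : R) : 0 < r -> pi / 2 <= `|t| <= pi ->
  line_angle (r%:C%C * cis t) = pi - `|t|.
Proof.
move=> r0; have pi0 := pi_gt0 R; wlog t0 : t / 0 <= t.
  move=> h; have [/h//|t0] := leP 0 t.
  move=> tp; have := h (- t); rewrite normrN oppr_ge0 => /(_ (ltW t0) tp) <-.
  by rewrite /line_angle !Normc.normcM !normc_cis !ReMr !ImMr /= cosN sinN mulrN normrN.
rewrite (ger0_norm t0) => /andP[t1 t2].
have -> : cis t = - cis (t - pi).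
  by apply: eqC; rewrite /= -?cosDpi -?sinDpi subrK.
by rewrite mulrN line_angleN line_angle_polar// ler0_norm; lra.
Qed.

Lemma polar_halfplane w : 0 <= complex.Re w ->
  exists2 t, `|t| <= pi / 2 & w = (normc w)%:C%C * cis t.
Proof.
move=> x0; have [w0|w0] := eqVneq w 0.
  exists 0; first by rewrite normr0 divr_ge0// pi_ge0.
  by rewrite w0 normc0 /real_complex_def mul0r.
have n0 : 0 < normc w by rewrite normc_gt0.
set n := normc w in n0 *.
pose y := complex.Im w / n.
have y1 : -1 <= y <= 1.
  rewrite -ler_norml /y normrM normfV (gtr0_norm n0) ler_pdivrMr// mul1r.
  exact: normIm_le.
exists (asin y).
  by rewrite ler_norml asin_geNpi2// asin_lepi2.
apply: eqC; rewrite ?ReMr ?ImMr /=; last first.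
  by rewrite asinK ?in_itv//= /y mulrC divfK// gt_eqF.
rewrite cos_asin//.
have -> : 1 - y ^+ 2 = (complex.Re w / n) ^+ 2.
  have := sqr_normc w; rewrite -/n => e.
  have n2 : n ^+ 2 != 0 by rewrite expf_neq0// gt_eqF.
  by rewrite /y !expr_div_n; apply: (mulIf n2); rewrite mulrBl !mulfVK// e; ring.
by rewrite sqrtr_sqr ger0_norm ?divr_ge0 ?(ltW n0)// mulrC divfK// gt_eqF.
Qed.

Lemma continuousC_line_angle (w : R * R) : cpx w != 0 ->
  {for w, continuous (fun z : R * R => line_angle (cpx z))}.
Proof.
move=> w0; rewrite /line_angle; apply: cvgM; first exact: cvg_cst.
apply: (@continuous_comp _ _ _ (fun z : R * R => `|complex.Im (cpx z)| /
  (normc (cpx z) + `|complex.Re (cpx z)|)) (@atan R)); last exact: continuous_atan.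
have ci : {for w, continuous (fun z : R * R => `|complex.Im (cpx z)|)}.
  by apply: cvg_norm; exact: cvg_snd.
have cr : {for w, continuous (fun z : R * R => `|complex.Re (cpx z)|)}.
  by apply: cvg_norm; exact: cvg_fst.
have cn : {for w, continuous (fun z : R * R => normc (cpx z))}.
  have cn : continuousC (fun z : C => normc z).
    exact: (continuousC_normc (g := id) (@continuousC_Re R) (@continuousC_Im R)).
  exact: cn.
apply: cvgM; first exact: ci.
apply: cvgV; last by apply: cvgD; [exact: cn|exact: cr].
by rewrite gt_eqF// ltr_pwDl// normc_gt0.
Qed.

(** The angle has no limit at the origin, but k is bounded and |w|^s tends to 0 there. *)
Lemma continuousC_homogeneous s (k : R -> R) : 0 < s -> continuous k ->
  (forall t, `|k t| <= 1) ->
  continuousC (fun w => normc w `^ s * k (line_angle w)).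
Proof.
move=> s0 ck k1.
have cn : continuousC (fun w => normc w `^ s).
  have -> : (fun w => normc w `^ s) = (fun w => `|normc w| `^ s).
    by apply/funext => w; rewrite ger0_norm// normc_ge0.
  apply: (continuousC_comp (k := fun x : R => `|x| `^ s)).
    exact: (continuousC_normc (g := id) (@continuousC_Re R) (@continuousC_Im R)).
  by move=> z; exact: continuous_normr_powR.
move=> w; have [w0|w0] := eqVneq (cpx w) 0; last first.
  apply: cvgM; first exact: cn.
  apply: (@continuous_comp _ _ _ (fun z : R * R => line_angle (cpx z)) k).
    exact: continuousC_line_angle.
  exact: ck.
have E0 : normc (cpx w) `^ s = 0 by rewrite w0 normc0 powR0// gt_eqF.
rewrite /continuous_at E0 mul0r.
have cnw := cn w; rewrite /continuous_at E0 in cnw.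
apply/cvgr0Pnorm_lt => e e0.
move/cvgr0Pnorm_lt : cnw => /(_ _ e0); apply: filterS => z; apply: le_lt_trans.
by rewrite normrM ler_piMr.
Qed.

(** On the right half-plane this is Re w^s for the principal branch, extended by w -> - w. *)
Definition rpow_cos s w : R := normc w `^ s * cos (s * line_angle w).

(** In the double sector of half-angle pi / s around the real axis this is - Re w^s (extended by w
    -> - w), and outside it |w|^s. The two pieces agree on the edges, and - Re w^s never exceeds
    |w|^s, which preserves subharmonicity across them. *)
Definition rpow_trunc s w : R :=
  normc w `^ s * - cos (Num.min (s * line_angle w) pi).

Lemma continuousC_rpow_cos s : 0 < s -> continuousC (rpow_cos s).
Proof.
move=> s0; apply: (@continuousC_homogeneous s (fun t => cos (s * t))) => //.
  by move=> t; exact: is_derive1_continuous (is_derive1_cosM s t).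
by move=> t; exact: cos_max.
Qed.

Lemma continuousC_rpow_trunc s : 0 < s -> continuousC (rpow_trunc s).
Proof.
move=> s0; apply: (@continuousC_homogeneous s (fun t => - cos (Num.min (s * t) pi))) => //.
  move=> t; apply: cvgN.
  apply: (@continuous_comp _ _ _ (fun t : R => Num.min (s * t) pi) (@cos R)); last exact: continuous_cos.
  apply: continuous_min; last exact: cvg_cst.
  exact: is_derive1_continuous (is_derive1_lin s t).
by move=> t; rewrite normrN; exact: cos_max.
Qed.

Lemma touchedN (psi : C -> R) w : (forall z, psi (- z) = psi z) ->
  touched psi (- w) -> touched psi w.
Proof.
move=> pN [al [be h]]; exists (- al), be => e e0; have [d d0 hd] := h e e0.
exists d => // v vd; have := hd (- v).
rewrite normcN pN -opprD pN => /(_ vd).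
by rewrite mulrN -mulNr sqrrN.
Qed.

(* Near w0 = r0 e^(i t0), the function r^s cos (s (theta - t0) + tau) is
   harmonic. *)
Lemma touched_rpow (psi : C -> R) (r0 t0 s tau K : R) : 0 < r0 ->
  psi (r0%:C%C * cis t0) = K * (r0 `^ s * cos tau) ->
  (exists2 d : R, 0 < d & forall r t, 0 < r -> `|t - t0| < d ->
    K * (r `^ s * cos (s * (t - t0) + tau)) <= psi (r%:C%C * cis t)) ->
  touched psi (r0%:C%C * cis t0).
Proof.
move=> r00 p0 [d d0 hd].
have nz : r0%:C%C * cis t0 != 0.
  by rewrite -normc_gt0 Normc.normcM normc_cis mulr1 normcR gtr0_norm.
have j := jetZ (K * r0 `^ s) (jet_rpow s tau).
have [L L0 [r /andP[r0' r1] hr]] := jet_bounded (@jet_arg1 R).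
apply: (touched_jet nz (jet_eq j (And3 erefl erefl erefl) (And3 erefl erefl (mulrN _ _)))).
  by rewrite p0; ring.
exists (Num.min r (d / L)) => [|v]; first by rewrite lt_min r0' divr_gt0.
rewrite lt_min => /andP[vr vd].
have v1 : normc v < 1 := lt_le_trans vr r1.
have ad : `|arg1 v| < d.
  have := hr v vr; rewrite subr0 => /le_lt_trans; apply.
  by rewrite mulrC -ltr_pdivlMr.
have -> : r0%:C%C * cis t0 * (1 + v) = (r0 * expR (log_abs1 v))%:C%C * cis (t0 + arg1 v).
  by rewrite polar1D// rmorphM/= cisD; ring.
have := hd (r0 * expR (log_abs1 v)) (t0 + arg1 v).
rewrite mulr_gt0 ?expR_gt0// addrAC subrr add0r ad => /(_ isT isT); apply: le_trans.
rewrite powRM ?expR_ge0 ?(ltW r00)// le_eqVlt; apply/orP; left; apply/eqP.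
by rewrite (powR_expR _ (expR_gt0 _)) expRK; ring.
Qed.

(** By e^x >= 1 + x, the harmonic function |w|^s (1 + s ln |1 + v|) stays below |w (1 + v)|^s, with
    equality at v = 0. *)
Lemma touched_normc_powR (psi : C -> R) s w : 0 < s -> w != 0 ->
  psi w = normc w `^ s ->
  (exists2 d : R, 0 < d & forall v, normc v < d ->
    normc (w * (1 + v)) `^ s <= psi (w * (1 + v))) ->
  touched psi w.
Proof.
move=> s0 w0 pw [d d0 hd]; have n0 : 0 < normc w by rewrite normc_gt0.
pose K := normc w `^ s.
have j := jetD (jet_cst K) (jetZ (K * s) (@jet_log_abs1 R)).
have j2 : jet (fun v => K + K * s * log_abs1 v) K (K * s) 0 (K * s * (- 1 / 2)) 0
    (- (K * s * (- 1 / 2))).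
  by apply: (jet_eq j); split; field.
apply: (touched_jet w0 j2) => //; exists (Num.min 1 d) => [|v].
  by rewrite lt_min ltr01.
rewrite lt_min => /andP[v1 vd]; apply: le_trans (hd v vd).
have [_ n1] := normc1D_gt0 v1.
rewrite Normc.normcM powRM ?normc_ge0// -/K.
rewrite (powR_expR _ n1) -{1}[K]mulr1 -mulrA -mulrDr ler_wpM2l ?powR_ge0//.
exact: expR_ge1Dx.
Qed.

Lemma rpow_cosN s w : rpow_cos s (- w) = rpow_cos s w.
Proof. by rewrite /rpow_cos normcN line_angleN. Qed.

Lemma rpow_truncN s w : rpow_trunc s (- w) = rpow_trunc s w.
Proof. by rewrite /rpow_trunc normcN line_angleN. Qed.

Lemma normc_polar (r t : R) : 0 < r -> normc (r%:C%C * cis t) = r.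
Proof. by move=> r0; rewrite Normc.normcM normc_cis mulr1 normcR gtr0_norm. Qed.

(** Continued across the imaginary axis, the branch Re w^s lies below the reflected value: for t >
    pi / 2 the gap is 2 sin (s pi / 2) sin (s (t - pi / 2)) r^s, and s <= 2 makes both sines
    nonnegative. Near the axis the function is thus a maximum of two harmonic branches. *)
Lemma rpow_cos_polar_ge s (r t : R) : 1 < s <= 2 -> 0 < r -> `|t| < pi ->
  r `^ s * cos (s * t) <= rpow_cos s (r%:C%C * cis t).
Proof.
move=> /andP[s1 s2] r0 tp; have pi0 := pi_gt0 R.
rewrite /rpow_cos normc_polar// ler_wpM2l ?powR_ge0//.
have -> : cos (s * t) = cos (s * `|t|).
  have s0 : 0 <= s by lra.
  by rewrite -[in RHS](ger0_norm s0) -normrM cos_norm.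
have [th|/ltW th] := leP `|t| (pi / 2); first by rewrite line_angle_polar.
rewrite line_angle_polar2//; last by rewrite th ltW.
move: (`|t|) th tp => {}t th tp.
have -> : s * t = s * (pi / 2) + s * (t - pi / 2) by ring.
have -> : s * (pi - t) = s * (pi / 2) - s * (t - pi / 2) by field.
rewrite cosD cosB lerD2l.
have h1 : 0 <= sin (s * (pi / 2)) by apply: sin_ge0_pi; apply/andP; split; nra.
have h2 : 0 <= sin (s * (t - pi / 2)) by apply: sin_ge0_pi; apply/andP; split; nra.
have := mulr_ge0 h1 h2; lra.
Qed.

Lemma touched_rpow_cos s w : 1 < s <= 2 -> w != 0 -> touched (rpow_cos s) w.
Proof.
move=> s12; wlog x0 : w / 0 <= complex.Re w.
  move=> h w0; have [x0|x0] := leP 0 (complex.Re w); first exact: h.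
  apply: touchedN; first exact: rpow_cosN.
  by apply: h; rewrite ?oppr_eq0// ReN oppr_ge0 ltW.
move=> w0; have n0 : 0 < normc w by rewrite normc_gt0.
have [t tp ->] := polar_halfplane x0; have pi0 := pi_gt0 R.
have st : cos (s * `|t|) = cos (s * t).
  have s0 : 0 <= s by lra.
  by rewrite -{1}(ger0_norm s0) -normrM cos_norm.
apply: (@touched_rpow _ _ _ s (s * t) 1) => //.
  by rewrite /rpow_cos normc_polar// line_angle_polar// st mul1r.
exists (pi / 2) => [|r u r0 ut]; first by rewrite divr_gt0.
rewrite mul1r -mulrDr subrK; apply: rpow_cos_polar_ge => //.
rewrite -[u](subrK t); apply: le_lt_trans (ler_normD _ _) _; lra.
Qed.

Lemma touched_rpow_trunc s w : 2 < s -> w != 0 -> touched (rpow_trunc s) w.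
Proof.
move=> s2; wlog x0 : w / 0 <= complex.Re w.
  move=> h w0; have [x0|x0] := leP 0 (complex.Re w); first exact: h.
  apply: touchedN; first exact: rpow_truncN.
  by apply: h; rewrite ?oppr_eq0// ReN oppr_ge0 ltW.
move=> w0; have n0 : 0 < normc w by rewrite normc_gt0.
have [t tp wE] := polar_halfplane x0; have pi0 := pi_gt0 R.
have s0 : 0 < s by lra.
have lw : line_angle w = `|t| by rewrite wE line_angle_polar.
have [h|h] := leP (s * `|t|) pi; last first.
  have pw : rpow_trunc s w = normc w `^ s.
    by rewrite /rpow_trunc lw min_r ?(ltW h)// cospi opprK mulr1.
  have st : pi / s < `|t| by rewrite ltr_pdivrMr// mulrC.
  have s2' : pi / s < pi / 2 by rewrite ltr_pM2l// ltf_pV2 ?posrE.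
  apply: touched_normc_powR pw _ => //.
  have [L L0 [r /andP[r0 r1] hr]] := jet_bounded (@jet_arg1 R).
  (* A change of argument below d keeps the angle beyond pi / s; the second bound covers points that
     cross the imaginary axis, where the angle becomes pi minus the argument. *)
  pose d := Num.min (`|t| - pi / s) (pi / 2 - pi / s).
  have d0 : 0 < d by rewrite lt_min !subr_gt0 st.
  exists (Num.min r (d / L)) => [|v]; first by rewrite lt_min r0 divr_gt0.
  rewrite lt_min => /andP[vr vd].
  have v1 : normc v < 1 := lt_le_trans vr r1.
  have : `|arg1 v| < d.
    have := hr v vr; rewrite subr0 => /le_lt_trans; apply.
    by rewrite mulrC -ltr_pdivlMr.
  rewrite lt_min => /andP[a1 a2].
  have -> : w * (1 + v) = (normc w * expR (log_abs1 v))%:C%C * cis (t + arg1 v).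
    by rewrite {1}wE polar1D// rmorphM/= cisD; ring.
  have ne0 : 0 < normc w * expR (log_abs1 v) by rewrite mulr_gt0 ?expR_gt0.
  rewrite /rpow_trunc normc_polar//.
  have u1 : `|t + arg1 v| <= `|t| + `|arg1 v| by exact: ler_normD.
  have u2 : `|t| - `|arg1 v| <= `|t + arg1 v|.
    by have := lerB_normD t (arg1 v).
  rewrite min_r ?cospi ?opprK ?mulr1//.
  rewrite mulrC -ler_pdivrMr//.
  have [uh|/ltW uh] := leP `|t + arg1 v| (pi / 2).
    by rewrite line_angle_polar//; lra.
  rewrite line_angle_polar2//; first lra.
  by have ps0 := divr_gt0 pi0 s0; rewrite uh/=; lra.
rewrite wE.
have th : `|t| < pi / 2 by nra.
have st : cos (s * `|t|) = cos (s * t).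
  by rewrite -{1}(ger0_norm (ltW s0)) -normrM cos_norm.
apply: (@touched_rpow _ _ _ s (s * t) (-1)) => //.
  by rewrite /rpow_trunc normc_polar// line_angle_polar// min_l// st; ring.
exists (pi / 2 - `|t|) => [|r u r0 ut]; first by rewrite subr_gt0.
rewrite -mulrDr subrK.
have up : `|u| <= pi / 2.
  rewrite -[u](subrK t); apply: le_trans (ler_normD _ _) _; lra.
have su : cos (s * `|u|) = cos (s * u).
  by rewrite -{1}(ger0_norm (ltW s0)) -normrM cos_norm.
rewrite /rpow_trunc normc_polar// line_angle_polar// mulN1r -mulrN ler_wpM2l ?powR_ge0//.
rewrite lerN2; have [hu|hu] := leP (s * `|u|) pi; first by rewrite su.
by rewrite cospi cos_geN1.
Qed.

(** * Pointwise inequalities for |Re w|^s and |Im w|^s *)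

Lemma rpow_cos_le s w (t0 := pi / (2 * s)) : 1 < s <= 2 ->
  cos t0 `^ s * normc w `^ s + cos t0 `^ (s - 1) * sin t0 * rpow_cos s w <=
  `|complex.Re w| `^ s.
Proof.
move=> /andP[s1 s2]; wlog x0 : w / 0 <= complex.Re w.
  move=> h; have [/h//|x0] := leP 0 (complex.Re w).
  have := h (- w); rewrite ReN normrN normcN rpow_cosN; apply.
  by rewrite oppr_ge0 ltW.
have [t tp wE] := polar_halfplane x0.
have sn : s != 0 by rewrite gt_eqF//; lra.
have [w0|w0] := eqVneq w 0.
  by rewrite w0 /rpow_cos normc0 /= normr0 powR0// mul0r !mulr0 addr0.
have n0 : 0 < normc w by rewrite normc_gt0.
have c0 : 0 <= cos t by apply: cos_ge0_pihalf; rewrite -ler_norml.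
have -> : `|complex.Re w| `^ s = normc w `^ s * cos `|t| `^ s.
  rewrite {1}wE ReMr /= normrM (gtr0_norm n0) (ger0_norm c0) cos_norm.
  by rewrite powRM// ltW.
rewrite /rpow_cos [line_angle w](_ : _ = `|t|); last by rewrite wE line_angle_polar.
rewrite [leLHS](_ : _ = normc w `^ s *
  (cos t0 `^ s + cos t0 `^ (s - 1) * sin t0 * cos (s * `|t|))); last by ring.
rewrite ler_wpM2l ?powR_ge0//; apply: cos_powR_ge => //.
by rewrite normr_ge0.
Qed.

(** Homogeneous form of [sin_powR_ge]. It concerns the imaginary part because the sector of
    [rpow_trunc] is centred on the real axis; applied to i P it bounds |Re P|. *)
Lemma rpow_trunc_Im s w (t0 := pi / (2 * s)) : 2 < s ->
  sin t0 `^ s * normc w `^ s + sin t0 `^ (s - 1) * cos t0 * rpow_trunc s w <=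
  `|complex.Im w| `^ s.
Proof.
move=> s2; wlog x0 : w / 0 <= complex.Re w.
  move=> h; have [/h//|x0] := leP 0 (complex.Re w).
  have := h (- w); rewrite ImN normrN normcN rpow_truncN; apply.
  by rewrite ReN oppr_ge0 ltW.
have pi0 := pi_gt0 R.
have [t tp wE] := polar_halfplane x0.
have sn : s != 0 by rewrite gt_eqF//; lra.
have [w0|w0] := eqVneq w 0.
  by rewrite w0 /rpow_trunc normc0 /= normr0 powR0// mul0r !mulr0 addr0.
have n0 : 0 < normc w by rewrite normc_gt0.
have sE : `|sin t| = sin `|t|.
  have [t0'|t0'] := leP 0 t.
    rewrite (ger0_norm t0') ger0_norm// sin_ge0_pi// t0'/=.
    by rewrite ger0_norm// in tp; lra.
  have tE : `|t| = - t by rewrite ltr0_norm.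
  rewrite tE sinN ler0_norm// -oppr_ge0 -sinN sin_ge0_pi//.
  by rewrite tE in tp; apply/andP; split; lra.
have s0 : 0 <= sin `|t| by rewrite -sE.
have -> : `|complex.Im w| `^ s = normc w `^ s * sin `|t| `^ s.
  by rewrite {1}wE ImMr /= normrM (gtr0_norm n0) sE powRM// ltW.
rewrite /rpow_trunc [line_angle w](_ : _ = `|t|); last by rewrite wE line_angle_polar.
rewrite [leLHS](_ : _ = normc w `^ s *
  (sin t0 `^ s - sin t0 `^ (s - 1) * cos t0 * cos (Num.min (s * `|t|) pi))); last by ring.
rewrite ler_wpM2l ?powR_ge0//; apply: sin_powR_ge; [lra|exact: ltW|].
by rewrite normr_ge0.
Qed.

Lemma rpow_trunc_Re s w (t0 := pi / (2 * s)) : 2 < s ->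
  `|complex.Re w| `^ s + cos t0 `^ (s - 1) * sin t0 * rpow_trunc s w <=
  cos t0 `^ s * normc w `^ s.
Proof.
move=> s2; wlog x0 : w / 0 <= complex.Re w.
  move=> h; have [/h//|x0] := leP 0 (complex.Re w).
  have := h (- w); rewrite ReN normrN normcN rpow_truncN; apply.
  by rewrite oppr_ge0 ltW.
have [t tp wE] := polar_halfplane x0.
have sn : s != 0 by rewrite gt_eqF//; lra.
have [w0|w0] := eqVneq w 0.
  by rewrite w0 /rpow_trunc normc0 /= normr0 powR0// mul0r !mulr0 addr0.
have n0 : 0 < normc w by rewrite normc_gt0.
have c0 : 0 <= cos t by apply: cos_ge0_pihalf; rewrite -ler_norml.
have -> : `|complex.Re w| `^ s = normc w `^ s * cos `|t| `^ s.
  rewrite {1}wE ReMr /= normrM (gtr0_norm n0) (ger0_norm c0) cos_norm.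
  by rewrite powRM// ltW.
rewrite /rpow_trunc [line_angle w](_ : _ = `|t|); last by rewrite wE line_angle_polar.
rewrite -subr_ge0 [leRHS](_ : _ = normc w `^ s *
  (cos t0 `^ s + cos t0 `^ (s - 1) * sin t0 * cos (Num.min (s * `|t|) pi) - cos `|t| `^ s)); last by ring.
rewrite mulr_ge0 ?powR_ge0// subr_ge0; apply: cos_powR_le; [lra|exact: ltW|].
by rewrite normr_ge0.
Qed.

(** Equal squares of the coordinates give cos (2 t) = 0. Squared hypotheses cover all four diagonal
    directions, hence both P(0) and i P(0). *)
Lemma line_angle_diag (c : R) w : c != 0 ->
  complex.Re w ^+ 2 = c ^+ 2 -> complex.Im w ^+ 2 = c ^+ 2 -> line_angle w = pi / 4.
Proof.
move=> c0; wlog x0 : w / 0 <= complex.Re w.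
  move=> h; have [/h//|x0] := leP 0 (complex.Re w).
  rewrite -line_angleN => e1 e2; apply: h; rewrite ?ReN ?ImN ?sqrrN//.
  by rewrite oppr_ge0 ltW.
move=> ex ey.
have n0 : 0 < normc w.
  rewrite normc_gt0; apply/eqP => w0; move: ex; rewrite w0 /= expr0n/= => /esym/eqP.
  by rewrite sqrf_eq0 (negbTE c0).
have [t tp wE] := polar_halfplane x0; have pi0 := pi_gt0 R.
have -> : line_angle w = `|t| by rewrite wE line_angle_polar.
have c2 : cos (`|t| *+ 2) = cos (pi / 2).
  rewrite cos_pihalf cos_mulr2n cos_norm.
  have := cos2Dsin2 t; move: ex ey; rewrite wE ReMr ImMr /= !exprMn => e1 e2.
  have e3 : cos t ^+ 2 = sin t ^+ 2.
    have nn : normc w ^+ 2 != 0 by rewrite expf_neq0// gt_eqF.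
    by apply: (mulfI nn); rewrite e1 e2.
  by rewrite -e3 -mulr2n => ->; rewrite subrr.
have := @cos_inj R (`|t| *+ 2) (pi / 2); rewrite !in_itv/= c2.
rewrite mulrn_wge0// -[_ *+ 2]mulr_natl => h.
have : 2 * `|t| = pi / 2 by apply: h => //; apply/andP; split; lra.
lra.
Qed.

(** The angle is pi / 4 and s pi / 4 <= pi / 2. For s > 2 the angle s pi / 4 passes pi / 2, which is
    why the truncated function carries a minus sign. *)
Lemma rpow_cos_diag (c s : R) w : c != 0 -> 1 < s <= 2 ->
  complex.Re w ^+ 2 = c ^+ 2 -> complex.Im w ^+ 2 = c ^+ 2 -> 0 <= rpow_cos s w.
Proof.
move=> c0 /andP[s1 s2] ex ey; have pi0 := pi_gt0 R.
rewrite /rpow_cos (line_angle_diag c0)// mulr_ge0 ?powR_ge0//.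
by apply: cos_ge0_pihalf; apply/andP; split; nra.
Qed.

Lemma rpow_trunc_diag (c s : R) w : c != 0 -> 2 < s ->
  complex.Re w ^+ 2 = c ^+ 2 -> complex.Im w ^+ 2 = c ^+ 2 -> 0 <= rpow_trunc s w.
Proof.
move=> c0 s2 ex ey; have pi0 := pi_gt0 R.
rewrite /rpow_trunc (line_angle_diag c0)// mulr_ge0 ?powR_ge0//.
set m := Num.min _ _.
have mp : m <= pi by rewrite ge_min lexx orbT.
have m2 : pi / 2 <= m by rewrite le_min; apply/andP; split; nra.
have := @cos_ge0_pihalf R (pi - m).
rewrite cosB cospi sinpi mul0r addr0 mulN1r; apply.
by apply/andP; split; lra.
Qed.

End homogeneous_functions.

(** * Lebesgue measure on the plane *)

Section plane_measure.
Variable R : realType.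
Local Notation mu := (@lebesgue_measure R).
Local Notation mu2 := (mu \x mu)%E.
Local Notation T := (measurableTypeR R).

(** An open set is the countable union of the boxes with rational centre and radius 1 / (n + 1) that
    it contains; the other boxes are replaced by the empty set so that the index set is fixed. *)
Lemma open_measurable_plane (U : set (R * R)) : open U ->
  measurable (U : set (T * T)).
Proof.
move=> oU.
pose b (q : R) (n : nat) : set R := ball q n.+1%:R^-1.
pose S (p q : rat) (n : nat) : set (R * R) := b (ratr p) n `*` b (ratr q) n.
have -> : U = \bigcup_p \bigcup_q \bigcup_n
    (if `[< S p q n `<=` U >] then S p q n else set0).
  apply/seteqP; split => [[x y] Uxy|z [p _ [q _ [n _]]]]; last first.
    by case: ifPn => // /asboolP; apply.
  have : nbhs (x, y) U by exact: open_nbhs_nbhs.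
  move=> /nbhs_ballP[e /= e0 eU].
  (* Half of e, because a point of the box is reached from (x, y) through the centre of the box. *)
  have [n hn] : exists n : nat, (n.+1%:R^-1 : R) < e / 2.
    have [//|n hn] := @ltr_add_invr R 0%R (e / 2) _; first exact: divr_gt0.
    by exists n; rewrite add0r in hn.
  have n0 : (0 : R) < n.+1%:R^-1 by rewrite invr_gt0 ltr0n.
  have rat_near (u : R) : exists p : rat, ball (ratr p : R) n.+1%:R^-1 u.
    have uu : u - n.+1%:R^-1 < u + n.+1%:R^-1 by apply: (@lt_trans _ _ u); [rewrite ltrBlDr ltrDl|rewrite ltrDl].
    have [p] := rat_in_itvoo uu.
    rewrite in_itv/= => /andP[h1 h2]; exists p.
    rewrite /ball/= ltr_norml; move: h1 h2; set r := _^-1 => h1 h2.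
    by apply/andP; split; lra.
  have [p px] := rat_near x; have [q qy] := rat_near y.
  exists p => //; exists q => //; exists n => //.
  case: ifPn => [_|/asboolP]; first by split.
  case=> -[u v] [/= pu qv]; apply: eU; split => /=;
    rewrite [e]splitr.
  - move: px pu; rewrite /b /ball/= distrC => px pu.
    by have := ler_distD (ratr p : R) x u; move: hn px pu; set r := _^-1; lra.
  - move: qy qv; rewrite /b /ball/= distrC => qy qv.
    by have := ler_distD (ratr q : R) y v; move: hn qy qv; set r := _^-1; lra.
apply: bigcupT_measurable_rat => p; apply: bigcupT_measurable_rat => q.
apply: bigcup_measurable => n _; case: ifPn => // _.
by apply: measurableX; exact: measurable_ball.
Qed.

Lemma continuous_measurable_plane (f : R * R -> R) : continuous f ->
  measurable_fun [set: T * T] f.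
Proof.
move=> /continuousP cf; apply: (measurability _ (RGenOpens.measurableE R)).
move=> _ [_ [a [b ->] <-]]; rewrite setTI; apply: open_measurable_plane.
exact/cf/interval_open.
Qed.

(** The image of Lebesgue measure under a translation has the same value on half-open intervals,
    hence is Lebesgue measure. *)
Lemma integral_translate (h : T -> \bar R) (c : R) : measurable_fun [set: T] h ->
  (forall x, 0 <= h x)%E ->
  (\int[mu]_x h (x + c)%R = \int[mu]_x h x)%E.
Proof.
move=> mh h0.
pose phi (x : T) : T := x + c.
have mphi : measurable_fun [set: T] phi by apply: measurable_funD.
have E : forall A, measurable A -> mu A = pushforward mu phi A.
  apply: lebesgue_measure_unique => _ [[a b] /= _ <-].
  rewrite /pushforward.
  have -> : phi @^-1` [set` `]a, b]] = [set` `]a - c, b - c]].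
    by apply/seteqP; split => x /=; rewrite /phi !in_itv/= ltrBlDr lerBrDr.
  rewrite -!/(mu _) !lebesgue_measure_itv/= !lte_fin ltrD2r.
  by case: ifPn => // _; congr (_%:E); ring.
have := @ge0_integral_pushforward _ _ T T R phi mphi mu setT h measurableT mh.
rewrite preimage_setT => <-; last by move=> y _; exact: h0.
by apply: eq_measure_integral => A mA _; exact/esym/E.
Qed.

(** By Tonelli, a shear acts on each horizontal line as a translation. *)
Lemma integral_shear1 (H : T * T -> \bar R) (a : R) : measurable_fun [set: T * T] H ->
  (forall z, 0 <= H z)%E ->
  (\int[mu2]_z H (z.1 + a * z.2, z.2)%R = \int[mu2]_z H z)%E.
Proof.
move=> mH H0.
have ms : measurable_fun [set: T * T] (fun z => (z.1 + a * z.2, z.2) : T * T).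
  apply: measurable_fun_pair => //; apply: measurable_funD => //.
  by apply: measurable_funM.
rewrite fubini_tonelli2//; last exact: measurableT_comp.
rewrite [RHS](fubini_tonelli2 H mH H0); apply: eq_integral => y _.
rewrite /fubini_G /=.
apply: (integral_translate (h := fun x => H (x, y)) (a * y)) => //.
exact: measurable_fun_pair1.
Qed.

Lemma integral_shear2 (H : T * T -> \bar R) (a : R) : measurable_fun [set: T * T] H ->
  (forall z, 0 <= H z)%E ->
  (\int[mu2]_z H (z.1, z.2 + a * z.1)%R = \int[mu2]_z H z)%E.
Proof.
move=> mH H0.
have ms : measurable_fun [set: T * T] (fun z => (z.1, z.2 + a * z.1) : T * T).
  apply: measurable_fun_pair => //; apply: measurable_funD => //.
  by apply: measurable_funM.
rewrite fubini_tonelli1//; last exact: measurableT_comp.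
rewrite [RHS](fubini_tonelli1 H mH H0); apply: eq_integral => x _.
rewrite /fubini_F /=.
apply: (integral_translate (h := fun y => H (x, y)) (a * x)) => //.
exact: measurable_fun_pair2.
Qed.

(* A rotation is a product of three shears. *)
Lemma integral_rotation (H : T * T -> \bar R) (c s : R) : measurable_fun [set: T * T] H ->
  (forall z, 0 <= H z)%E -> c ^+ 2 + s ^+ 2 = 1 -> 1 + c != 0 ->
  (\int[mu2]_z H (c * z.1 - s * z.2, s * z.1 + c * z.2)%R = \int[mu2]_z H z)%E.
Proof.
move=> mH H0 cs c1.
(* This is - tan (theta / 2) for the angle theta of the rotation, which is why the half-turn c = -1
   is excluded. *)
pose a := - s / (1 + c).
have as1 : 1 + a * s = c.
  rewrite /a; apply: (mulIf c1); rewrite mulrDl mul1r.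
  have -> : - s / (1 + c) * s * (1 + c) = - s ^+ 2 by field.
  by rewrite -[s ^+ 2](addKr (c ^+ 2)) cs; ring.
have as2 : a * (1 + (1 + a * s)) = - s by rewrite as1 /a divfK.
have m1 (k : R) : measurable_fun [set: T * T] (fun z => (z.1 + k * z.2, z.2) : T * T).
  apply: measurable_fun_pair => //; apply: measurable_funD => //.
  by apply: measurable_funM.
have m2 (k : R) : measurable_fun [set: T * T] (fun z => (z.1, z.2 + k * z.1) : T * T).
  apply: measurable_fun_pair => //; apply: measurable_funD => //.
  by apply: measurable_funM.
rewrite -[RHS](integral_shear1 a)//.
pose H1 (z : T * T) := H (z.1 + a * z.2, z.2).
have mH1 : measurable_fun [set: T * T] H1 by exact: (measurableT_comp mH (m1 a)).
rewrite -[RHS](@integral_shear2 H1 s)//; last by move=> z; exact: H0.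
pose H2 (z : T * T) := H1 (z.1, z.2 + s * z.1).
have mH2 : measurable_fun [set: T * T] H2 by exact: (measurableT_comp mH1 (m2 s)).
rewrite -[RHS](@integral_shear1 H2 a)//; last by move=> z; exact: H0.
apply: eq_integral => -[x y] _; rewrite /H2 /H1 /=; congr H; congr (_, _).
  have -> : x + a * y + a * (y + s * (x + a * y)) = (1 + a * s) * x + a * (1 + (1 + a * s)) * y by ring.
  by rewrite as2 as1; ring.
have -> : y + s * (x + a * y) = s * x + (1 + a * s) * y by ring.
by rewrite as1.
Qed.

End plane_measure.

(** * Area of the disk *)

Section disk_integrals.
Variable R : realType.
Local Notation mu := (@lebesgue_measure R).
Local Notation mu2 := (mu \x mu)%E.
Local Notation T := (measurableTypeR R).

Lemma continuous_FTC2E (f F : R -> R) (a b : R) : a < b -> continuous f -> continuous F ->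
  (forall x, a < x < b -> is_derive x 1 F (f x)) ->
  (\int[mu]_(x in `[a, b]) (f x)%:E = (F b - F a)%:E)%E.
Proof.
move=> ab cf cF dF; rewrite (@continuous_FTC2 _ f F)//.
- exact: continuous_subspaceT.
- split.
  + by move=> x; rewrite in_itv/= => /dF[].
  + by apply: cvg_at_right_filter; exact: cF.
  + by apply: cvg_at_left_filter; exact: cF.
- by move=> x; rewrite in_itv/= => /dF[_ h]; rewrite derive1E.
Qed.

Lemma sqr_lt_sqrt (x y : R) : (x ^+ 2 < y) = (- Num.sqrt y < x < Num.sqrt y).
Proof.
rewrite -ltr_norml; have [y0|y0] := leP y 0.
  by rewrite ler0_sqrtr// ltNge (le_trans y0) ?sqr_ge0// ltNge normr_ge0.
by rewrite -sqrtr_sqr ltr_sqrt.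
Qed.

(** The classical primitive x sqrt (r^2 - x^2) + r^2 asin (x / r), with asin (x / r) written by the
    half-angle formula, which is continuous on the whole line. *)
Definition disk_area_primitive (r x : R) : R :=
  x * Num.sqrt (r ^+ 2 - x ^+ 2) +
  r ^+ 2 * (2 * atan (x / (r + Num.sqrt (r ^+ 2 - x ^+ 2)))).

Lemma is_derive_disk_area_primitive (r x : R) : - r < x < r ->
  is_derive x 1 (disk_area_primitive r) (2 * Num.sqrt (r ^+ 2 - x ^+ 2)).
Proof.
move=> /andP[xr1 xr2]; have r0 : 0 < r by lra.
have d0 : 0 < r ^+ 2 - x ^+ 2 by nra.
pose g (y : R) := r ^+ 2 - y ^+ 2.
have dg : is_derive x 1 g (- (2 * x)).
  have := is_derive1B (is_derive_cst (r ^+ 2) x 1) (is_derive1M (is_derive_id x (1:R)) (is_derive_id x (1:R))).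
  by move=> h; apply: (is_derive_eq h); ring.
have ds := @is_derive1_compE R Num.sqrt g x _ _ (is_derive1_sqrt d0) dg.
set s := Num.sqrt (r ^+ 2 - x ^+ 2).
have s0 : 0 < s by rewrite sqrtr_gt0.
have s2 : s ^+ 2 = r ^+ 2 - x ^+ 2 by rewrite sqr_sqrtr// ltW.
have rs0 : r + s != 0 by rewrite gt_eqF// addr_gt0.
have dr := is_derive1D (is_derive_cst r x 1) ds.
have dv := @is_deriveV R (fun y => r + Num.sqrt (g y)) x _ 1 rs0 dr.
have dq := is_derive1M (is_derive_id x (1:R)) dv.
have dat := @is_derive1_compE R (@atan R) (fun y => y / (r + Num.sqrt (g y))) x _ _ (is_derive1_atan _) dq.
have dfin := is_derive1D (is_derive1M (is_derive_id x (1:R)) ds)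
  (is_derive1Z (r ^+ 2) (is_derive1Z 2 dat)).
apply: (is_derive_eq dfin); rewrite -/(g x) -/s -exprVn -mulrA /GRing.scale /=.
have xE : x ^+ 2 = (r - s) * (r + s) by rewrite -subr_sqr s2; ring.
have rn : r != 0 by rewrite gt_eqF.
have sn : s != 0 by rewrite gt_eqF.
have q1 : 1 + (x / (r + s)) ^+ 2 = 2 * r / (r + s).
  by rewrite exprMn xE exprVn; field.
rewrite q1; transitivity (- (x ^+ 2) / s + s + r * (x ^+ 2 / (s * (r + s)) + 1)).
  by field; rewrite rs0 sn rn.
by rewrite xE; field; rewrite rs0 sn.
Qed.

Lemma continuous_disk_area_primitive (r : R) : 0 < r -> continuous (disk_area_primitive r).
Proof.
move=> r0 x; have cs : {for x, continuous (fun y : R => Num.sqrt (r ^+ 2 - y ^+ 2))}.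
  apply: (@continuous_comp _ _ _ (fun y : R => r ^+ 2 - y ^+ 2) Num.sqrt); last exact: sqrt_continuous.
  by apply: cvgB; [exact: cvg_cst|exact: exprn_continuous].
apply: cvgD; first by apply: cvgM => //; exact: cvg_id.
apply: cvgM; first exact: cvg_cst.
apply: cvgM; first exact: cvg_cst.
apply: (@continuous_comp _ _ _ (fun y : R => y / (r + Num.sqrt (r ^+ 2 - y ^+ 2))) (@atan R)); last exact: continuous_atan.
apply: cvgM; first exact: cvg_id.
apply: cvgV; first by rewrite gt_eqF// ltr_wpDr// sqrtr_ge0.
by apply: cvgD => //; exact: cvg_cst.
Qed.

Lemma area_disk (r : R) : 0 < r ->
  mu2 ([set z | z.1 ^+ 2 + z.2 ^+ 2 < r ^+ 2] : set (T * T)) = (pi * r ^+ 2)%:E.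
Proof.
move=> r0; rewrite /product_measure1.
pose f (x : R) := 2 * Num.sqrt (r ^+ 2 - x ^+ 2).
transitivity (\int[mu]_x (f x)%:E)%E.
  apply: eq_integral => x _ /=.
  have -> : xsection ([set z | z.1 ^+ 2 + z.2 ^+ 2 < r ^+ 2] : set (T * T)) x =
     [set` `]- Num.sqrt (r ^+ 2 - x ^+ 2), Num.sqrt (r ^+ 2 - x ^+ 2)[ ].
    apply/seteqP; split => y; rewrite /xsection/= inE/= in_itv/= -sqr_lt_sqrt ltrBrDl//.
  rewrite lebesgue_measure_itv/= lte_fin; case: ifPn => [_|].
    by rewrite -EFinB /f; congr _%:E; ring.
  rewrite -leNgt /f => h; congr _%:E.
  have := sqrtr_ge0 (r ^+ 2 - x ^+ 2); lra.
(* Outside [-r, r] the square root of a negative number is 0 by convention, so the integrand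
   vanishes. *)
have -> : (\int[mu]_x (f x)%:E = \int[mu]_(x in `[(- r)%R, r]) (f x)%:E)%E.
  rewrite [RHS]integral_mkcond; apply: eq_integral => x _; rewrite patchE.
  case: ifPn => //; rewrite notin_setE /= in_itv/= => /negP xr.
  congr _%:E; rewrite /f ler0_sqrtr ?mulr0// subr_le0.
  rewrite leNgt; apply/negP => h; move/negP: xr; apply.
  have : `|x| < `|r| by rewrite -ltr_sqr ?nnegrE// !real_normK ?num_real.
  by rewrite (gtr0_norm r0) ltr_norml => /andP[/ltW-> /ltW].
have rr : - r < r by lra.
have cP := continuous_disk_area_primitive r0.
have cf : continuous f.
  move=> x; apply: cvgM; first exact: cvg_cst.
  apply: (@continuous_comp _ _ _ (fun y : R => r ^+ 2 - y ^+ 2) Num.sqrt); last exact: sqrt_continuous.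
  by apply: cvgB; [exact: cvg_cst|exact: exprn_continuous].
rewrite (continuous_FTC2E rr cf cP (@is_derive_disk_area_primitive r)).
rewrite /disk_area_primitive !sqrrN subrr sqrtr0 !mulr0 addr0 mulNr divff ?gt_eqF// atanN.
rewrite atan1; congr _%:E; by field.
Qed.

Lemma measurable_disk (r : R) : measurable ([set z | z.1 ^+ 2 + z.2 ^+ 2 < r] : set (T * T)).
Proof.
apply: open_measurable_plane.
have -> : [set z : R * R | z.1 ^+ 2 + z.2 ^+ 2 < r] = (fun z : R * R => z.1 ^+ 2 + z.2 ^+ 2) @^-1` [set x | x < r] by [].
apply: open_comp; last exact: open_lt.
move=> z _; apply: cvgD; apply: (@continuous_comp _ _ _ _ (fun x : R => x ^+ 2)); try exact: exprn_continuous.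
  exact: cvg_fst.
exact: cvg_snd.
Qed.

Lemma measurable_unit_disk : measurable (unit_disk R : set (T * T)).
Proof. exact: measurable_disk. Qed.

Lemma area_unit_disk : mu2 (unit_disk R : set (T * T)) = pi%:E.
Proof. by have := area_disk (@ltr01 R); rewrite expr1n mulr1. Qed.

Lemma area_unit_disk_annulus (r : R) : 0 <= r <= 1 ->
  mu2 ([set z | unit_disk R z /\ r <= z.1 ^+ 2 + z.2 ^+ 2] : set (T * T)) = (pi * (1 - r))%:E.
Proof.
move=> /andP[r0 r1].
pose A : set (T * T) := [set z | z.1 ^+ 2 + z.2 ^+ 2 < r].
have AE : mu2 A = (pi * r)%:E.
  have [r00|rn] := eqVneq r 0.
    rewrite r00 mulr0 (_ : A = set0) ?measure0//; apply/seteqP; split => z //=.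
    by rewrite /A/= r00 ltNge addr_ge0// sqr_ge0.
  have rp : 0 < r by rewrite lt_def rn.
  have := @area_disk (Num.sqrt r); rewrite sqr_sqrtr// sqrtr_gt0; exact.
have -> : [set z | unit_disk R z /\ r <= z.1 ^+ 2 + z.2 ^+ 2] = unit_disk R `\` A.
  by apply/seteqP; split => z /= [h1 h2]; split => //; move: h2; rewrite /A/= ?ltNge; [move=> ->|move/negP; rewrite negbK].
have sub : A `<=` unit_disk R by move=> z; rewrite /A/= => /lt_le_trans; apply.
rewrite measureD//; last 3 first.
- exact: measurable_unit_disk.
- exact: measurable_disk.
- by have := ltry (@pi R); rewrite -area_unit_disk.
rewrite setIidr// mulrBr mulr1 EFinB; congr (_ - _)%E; [exact: area_unit_disk|exact: AE].
Qed.
End disk_integrals.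

(** * Integrals over the disk *)

Section disk_mean.
Variable R : realType.
Local Notation C := R[i].
Local Notation mu := (@lebesgue_measure R).
Local Notation mu2 := (mu \x mu)%E.
Local Notation T := (measurableTypeR R).
Local Notation cpx := (@cpx R).
Implicit Types G : C -> R.

Lemma unit_diskE (z : R * R) : unit_disk R z <-> normc (cpx z) < 1.
Proof.
have -> : unit_disk R z = is_true (normc (cpx z) ^+ 2 < 1) by rewrite sqr_normc.
by rewrite expr_lt1// normc_ge0.
Qed.

Definition dint G : R := (\int[mu2]_(z in unit_disk R) G (cpx z))%R.

Lemma continuousC_integrable_disk G : continuousC G ->
  (mu2 : {measure set (T * T) -> \bar R}).-integrable (unit_disk R) (fun z : T * T => (G (cpx z))%:E).
Proof.
move=> cG; apply: measurable_bounded_integrable.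
- exact: measurable_unit_disk.
- by have := ltry (@pi R); rewrite -area_unit_disk.
- apply: measurable_funTS; exact: continuous_measurable_plane.
- have [M hM] := bounded_cdisk cG; exists M; split; first exact: num_real.
  move=> x Mx z /unit_diskE z1; apply: le_trans (hM _ (ltW z1)) (ltW Mx).
Qed.

Lemma dintD G1 G2 : continuousC G1 -> continuousC G2 ->
  dint (fun z => G1 z + G2 z) = dint G1 + dint G2.
Proof.
move=> c1 c2; apply: RintegralD; [exact: measurable_unit_disk|..];
  exact: continuousC_integrable_disk.
Qed.

Lemma dintZ G (a : R) : continuousC G -> dint (fun z => a * G z) = a * dint G.
Proof.
move=> cG; apply: RintegralZl; [exact: measurable_unit_disk|].
exact: continuousC_integrable_disk.
Qed.

Lemma dint_le G1 G2 : continuousC G1 -> continuousC G2 ->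
  (forall z, normc z <= 1 -> G1 z <= G2 z) -> dint G1 <= dint G2.
Proof.
move=> c1 c2 h; apply: le_Rintegral; [exact: measurable_unit_disk| | |].
- exact: continuousC_integrable_disk.
- exact: continuousC_integrable_disk.
- by move=> z /unit_diskE/ltW; exact: h.
Qed.

Lemma dint_cst (a : R) : dint (fun=> a) = a * pi.
Proof.
rewrite /dint Rintegral_cst; last exact: measurable_unit_disk.
by congr (_ * _); rewrite -[RHS]/(fine pi%:E) -area_unit_disk.
Qed.

Lemma continuousC_sum (n : nat) (F : nat -> C -> R) :
  (forall i, continuousC (F i)) -> continuousC (fun z => \sum_(i < n) F i z).
Proof.
move=> cF; elim: n => [|n IH].
  by under [X in continuousC X]funext do rewrite big_ord0; exact: continuousC_cst.
under [X in continuousC X]funext do rewrite big_ord_recr/=.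
exact: (continuousCD IH (cF n)).
Qed.

Lemma dint_sum (n : nat) (F : nat -> C -> R) : (forall i, continuousC (F i)) ->
  dint (fun z => \sum_(i < n) F i z) = \sum_(i < n) dint (F i).
Proof.
move=> cF; elim: n => [|n IH].
  rewrite big_ord0; under [X in dint X]funext do rewrite big_ord0.
  by rewrite dint_cst mul0r.
under [X in dint X]funext do rewrite big_ord_recr/=.
by rewrite big_ord_recr/= dintD// ?IH//; exact: continuousC_sum.
Qed.

Lemma continuousC_mul G (w : C) : continuousC G -> continuousC (fun z => G (z * w)).
Proof.
move=> cG z; case: w => a b.
have c1 : continuousC (fun z => complex.Re z * a - complex.Im z * b).
  by apply: continuousCB; apply: continuousCM; [exact: continuousC_Re|exact: continuousC_cst|exact: continuousC_Im|exact: continuousC_cst].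
have c2 : continuousC (fun z => complex.Re z * b + complex.Im z * a).
  by apply: continuousCD; apply: continuousCM; [exact: continuousC_Re|exact: continuousC_cst|exact: continuousC_Im|exact: continuousC_cst].
pose h (x : R * R) : R * R := (x.1 * a - x.2 * b, x.1 * b + x.2 * a).
apply: (@continuous_comp _ _ _ h (fun x : R * R => G (cpx x))); last exact: cG.
exact: (cvg_pair (c1 z) (c2 z)).
Qed.

Lemma dintE G : continuousC G -> (forall z, 0 <= G z) ->
  (\int[mu2]_(z in unit_disk R) (G (cpx z))%:E)%E = (dint G)%:E.
Proof.
move=> cG G0; rewrite /dint /Rintegral fineK//.
apply: integrable_fin_num; first exact: measurable_unit_disk.
exact: continuousC_integrable_disk.
Qed.

Lemma dint_rotation_ge0 G (w : C) : continuousC G -> (forall z, 0 <= G z) ->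
  normc w = 1 -> 1 + complex.Re w != 0 -> dint (fun z => G (z * w)) = dint G.
Proof.
move=> cG G0 w1 wn.
have cGw : continuousC (fun z => G (z * w)) by exact: continuousC_mul.
apply: (@EFin_inj R); rewrite -(dintE cG G0) -(dintE cGw)//.
rewrite [LHS]integral_mkcond [RHS]integral_mkcond.
pose H : T * T -> \bar R := ((fun z => (G (cpx z))%:E) \_ (unit_disk R)).
have mH : measurable_fun [set: T * T] H.
  have [+ _] := @measurable_restrictT _ _ (T * T)%type _ (unit_disk R : set (T * T))
    (fun z : T * T => (G (cpx z))%:E) (@measurable_unit_disk R); apply.
  apply: measurable_funTS; apply/measurable_EFinP.
  exact: continuous_measurable_plane.
have H0 z : (0 <= H z)%E.
  by rewrite /H patchE; case: ifP => //; rewrite lee_fin G0.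
have ww : complex.Re w ^+ 2 + complex.Im w ^+ 2 = 1 by rewrite -sqr_normc w1 expr1n.
rewrite -[RHS](integral_rotation mH H0 ww wn).
apply: eq_integral => z _; rewrite /H !patchE.
set z' := (X in _ = if X \in _ then _ else _).
have E : cpx z' = cpx z * w.
  by case: w {cGw w1 wn ww} @z' => a b; apply: eqC; rewrite ?ReM ?ImM /=; ring.
have dE : (z' \in unit_disk R) = (z \in unit_disk R).
  by apply/idP/idP; rewrite !inE => /unit_diskE h; apply/unit_diskE; move: h;
    rewrite E Normc.normcM w1 mulr1.
by rewrite dE E.
Qed.

(** Adding a bound M of |G| on the disk reduces to a nonnegative function; the maximum with 0 makes
    it nonnegative off the disk too, without changing it inside. *)
Lemma dint_rotation G (w : C) : continuousC G ->
  normc w = 1 -> 1 + complex.Re w != 0 -> dint (fun z => G (z * w)) = dint G.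
Proof.
move=> cG w1 wn.
have [M hM] := bounded_cdisk cG.
pose G1 z := Num.max (G z + M) 0.
have cG1 : continuousC G1.
  apply: (continuousC_comp (G := fun z => G z + M) (k := fun x : R => Num.max x 0)).
    by apply: continuousCD => //; exact: continuousC_cst.
  by move=> z; apply: continuous_max; [exact: cvg_id|exact: cvg_cst].
have E z : normc z <= 1 -> G1 z = G z + M.
  move=> z1; rewrite /G1 max_l//; have := hM _ z1; rewrite ler_norml => /andP[]; lra.
have /= := @dint_rotation_ge0 G1 w cG1 _ w1 wn.
have eqG1 H H' : (forall z, normc z <= 1 -> H z = H' z) -> dint H = dint H'.
  move=> h; apply: eq_Rintegral => z; rewrite inE => /unit_diskE/ltW; exact: h.
rewrite (eqG1 _ _ E) (eqG1 (fun z => G1 (z * w)) (fun z => G (z * w) + M)); last first.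
  by move=> z z1; rewrite E// Normc.normcM w1 mulr1.
rewrite !dintD//; try exact: continuousC_cst; last exact: continuousC_mul.
have G10 z : 0 <= G1 z by rewrite /G1 le_max lexx orbT.
by move=> /(_ G10) /addIr.
Qed.

(** The rotations are obtained by iterating the one by [root1]; n > 2 keeps it away from -1, the
    half-turn excluded by the three shears. *)
Lemma dint_sum_root1 G n : continuousC G -> (2 < n)%N ->
  dint (fun z => \sum_(j < n) G (z * root1 R n ^+ j)) = n%:R * dint G.
Proof.
move=> cG n2; rewrite (@dint_sum n (fun j z => G (z * root1 R n ^+ j))); last first.
  by move=> j; exact: continuousC_mul.
have rn : 1 + complex.Re (root1 R n) != 0.
  apply/eqP => h.
  have n1 := normc_root1 R n; have := sqr_normc (root1 R n).
  rewrite n1 expr1n => e.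
  have i0 : complex.Im (root1 R n) = 0 by apply/eqP; rewrite -sqrf_eq0; apply/eqP; nra.
  have := @root1X_neq1 R n 2; rewrite n2 => /(_ isT)/eqP; apply.
  have r1 : complex.Re (root1 R n) = -1 by lra.
  by apply: eqC; rewrite expr2 ?ReM ?ImM i0 r1 /=; ring.
transitivity (\sum_(j < n) dint G); last by rewrite sumr_const card_ord mulr_natl.
apply: eq_bigr => -[j /= _] _; elim: j => [|j IH].
  by congr dint; apply/funext => z; rewrite expr0 mulr1.
rewrite -IH -[RHS](dint_rotation (@continuousC_mul G (root1 R n ^+ j) cG) (normc_root1 R n) rn).
by congr dint; apply/funext => z; rewrite exprS mulrA.
Qed.

(** * Moments of the disk *)

Lemma bernoulli_step (a : R) n : 0 <= a ->
  a ^+ n.+1 + n.+1%:R * a ^+ n <= (a + 1) ^+ n.+1.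
Proof.
move=> a0; elim: n => [|n IH]; first by rewrite !expr1 expr0 mulr1.
rewrite [leRHS]exprS; apply: le_trans (ler_wpM2l _ IH); last by lra.
rewrite -[n.+2%:R]natr1 exprS [a ^+ n.+1]exprS.
have an : 0 <= a ^+ n by apply: exprn_ge0.
have : (0 : R) <= n.+1%:R by [].
move: (n.+1%:R) (a ^+ n) an => N x x0 N0.
have : 0 <= N * x by rewrite mulr_ge0.
nra.
Qed.

Lemma sum_exprn_le n (M : nat) :
  \sum_(k < M) k.+1%:R ^+ n <= M.+1%:R ^+ n.+1 / n.+1%:R :> R.
Proof.
elim: M => [|M IH]; first by rewrite big_ord0 divr_ge0// exprn_ge0.
rewrite big_ord_recr/= ler_pdivlMr ?ltr0n//.
rewrite ler_pdivlMr ?ltr0n// in IH.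
have := @bernoulli_step M.+1%:R n (ler0n _ _); rewrite natr1.
move: IH; rewrite mulrDl; lra.
Qed.

(* Layer cake over M annuli. *)
Lemma moment_disk_step n (M : nat) : (0 < n)%N ->
  dint (fun z => (normc z ^+ 2) ^+ n) <= pi * ((1 + M.+1%:R^-1) ^+ n.+1 / n.+1%:R).
Proof.
move=> n0; set m := M.+1; have m0 : (0 : R) < m%:R by rewrite ltr0n.
pose d (k : nat) : R := (k%:R / m%:R) ^+ n.
pose A (k : nat) : set (T * T) := [set z | unit_disk R z /\ k%:R / m%:R <= z.1 ^+ 2 + z.2 ^+ 2].
have d_le k : d k <= d k.+1.
  by rewrite /d lerXn2r ?nnegrE ?divr_ge0// ler_pM2r ?invr_gt0// ler_nat.
have mA k : measurable (A k).
  have -> : A k = unit_disk R `\` [set z | z.1 ^+ 2 + z.2 ^+ 2 < k%:R / m%:R].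
    by apply/seteqP; split => z /= [h1 h2]; split => //; move: h2; rewrite ?ltNge; [move=> ->|move/negP; rewrite negbK].
  by apply: measurableD; [exact: measurable_unit_disk|exact: measurable_disk].
have cG : continuousC (fun z : C => (normc z ^+ 2) ^+ n).
  apply: continuousCX; apply: continuousCX; apply: (@continuousC_normc R id); [exact: continuousC_Re|exact: continuousC_Im].
rewrite -lee_fin -dintE//; last by move=> z; rewrite exprn_ge0 ?sqr_ge0.
(* A step function of |z|^2 above |z|^(2n): crossing the inner circle of the k-th annulus adds the
   jump d (k + 1) - d k. *)
pose s z := (\sum_(k < m) ((d k.+1 - d k)%:E * (\1_(A k) z)%:E))%E.
have s0 z k : (0 <= (d k.+1 - d k)%:E * (\1_(A k) z)%:E)%E.
  by rewrite mule_ge0// lee_fin ?subr_ge0.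
have ms k : measurable_fun (unit_disk R : set (T * T)) (fun z => ((d k.+1 - d k)%:E * (\1_(A k) z)%:E)%E).
  apply: measurable_funTS; apply: measurable_funeM.
  by apply/measurable_EFinP; exact: measurable_indic.
apply: (@le_trans _ _ (\int[mu2]_(z in unit_disk R) s z)%E).
  apply: ge0_le_integral.
  - exact: measurable_unit_disk.
  - by move=> z _; rewrite lee_fin exprn_ge0 ?sqr_ge0.
  - apply/measurable_EFinP; apply: measurable_funTS; exact: continuous_measurable_plane.
  - apply: (@emeasurable_sum _ (T * T)%type R (unit_disk R) _ _ (fun (k : 'I_m) z => ((d k.+1 - d k)%:E * (\1_(A k) z)%:E)%E)) => k; exact: ms.
  move=> z /[dup] Dz /unit_diskE z1.
  set x := normc (cpx z) ^+ 2.
  have x0 : 0 <= x by rewrite sqr_ge0.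
  have x1 : x < 1 by rewrite expr_lt1// normc_ge0.
  (* The index of the annulus containing z: the jumps up to K telescope to d (K + 1), which is at
     least |z|^(2n). *)
  pose K := Num.truncn (x * m%:R).
  have /andP[K1 K2] : (K%:R <= x * m%:R < K.+1%:R) by apply: truncn_itv; rewrite mulr_ge0.
  have Km : (K < m)%N by rewrite -(ltr_nat R) (le_lt_trans K1)// gtr_pMl.
  have AK (k : nat) : (k <= K)%N -> A k z.
    move=> kK; split => //.
    apply: (@le_trans _ _ (K%:R / m%:R)); first by rewrite ler_pM2r ?invr_gt0// ler_nat.
    rewrite ler_pdivrMr//; move: K1; rewrite /x sqr_normc; exact.
  have -> : s z = (\sum_(k < m) ((d k.+1 - d k) * \1_(A k) z))%:E.
    by rewrite /s -sumEFin; apply: eq_bigr => k _; rewrite EFinM.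
  rewrite lee_fin (bigID (fun k : 'I_m => (k < K.+1)%N))/=.
  apply: ler_wpDr; first by apply: sumr_ge0 => k _; rewrite mulr_ge0 ?subr_ge0.
  rewrite -(big_ord_widen m (fun k => (d k.+1 - d k) * \1_(A k) z) Km).
  rewrite (eq_bigr (fun k : 'I_K.+1 => d k.+1 - d k)); last first.
    by move=> k _; rewrite indicE mem_set ?mulr1//; apply: AK; rewrite -ltnS.
  rewrite -(big_mkord xpredT (fun k => d k.+1 - d k)) telescope_sumr//.
  rewrite /d mul0r expr0n eqn0Ngt n0 subr0.
  by rewrite lerXn2r ?nnegrE ?divr_ge0// ler_pdivlMr// ltW.
rewrite /s ge0_integral_sum//; last exact: measurable_unit_disk.
have iE k : (k < m)%N -> (\int[mu2]_(z in unit_disk R) ((d k.+1 - d k)%:E * (\1_(A k) z)%:E))%E =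
   ((d k.+1 - d k) * (pi * (1 - k%:R / m%:R)))%:E.
  move=> km; rewrite ge0_integralZl//; last by rewrite lee_fin subr_ge0.
    rewrite integral_indic//; last exact: measurable_unit_disk.
    rewrite setIidl; last by move=> z [].
    rewrite EFinM; congr (_ * _)%E; apply: area_unit_disk_annulus.
    by rewrite divr_ge0//= ler_pdivrMr// mul1r ler_nat ltnW.
    exact: measurable_unit_disk.
  apply: measurable_funTS; apply/measurable_EFinP; exact: measurable_indic.
apply: (@le_trans _ _ (\sum_(k < m) (d k.+1 - d k) * (pi * (1 - k%:R / m%:R)))%:E).
  by rewrite le_eqVlt; apply/orP; left; apply/eqP; rewrite -sumEFin; apply: eq_bigr => k _; exact: iE.
rewrite lee_fin.
(* Summation by parts; the boundary term vanishes at k = m. *)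
have abel k : \sum_(i < k) (d i.+1 - d i) * (pi * (1 - i%:R / m%:R)) = pi * (d k * (1 - k%:R / m%:R) + m%:R^-1 * \sum_(i < k) d i.+1).
  elim: k => [|k IH]; first by rewrite !big_ord0 /d mul0r expr0n eqn0Ngt n0/=; ring.
  rewrite !big_ord_recr/= IH -[k.+1%:R in RHS]natr1; field.
  by rewrite gt_eqF.
rewrite abel divff ?gt_eqF// subrr mulr0 add0r ler_pM2l ?pi_gt0//.
have -> : \sum_(i < m) d i.+1 = (\sum_(i < m) i.+1%:R ^+ n) / m%:R ^+ n.
  by rewrite mulr_suml; apply: eq_bigr => i _; rewrite /d exprMn exprVn.
have := sum_exprn_le n m.
have -> : 1 + m%:R^-1 = m.+1%:R / m%:R :> R by rewrite -[m.+1%:R]natr1 mulrDl divff ?gt_eqF// mul1r.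
move=> h; rewrite expr_div_n mulrAC mulrCA -invfM -exprS.
by rewrite ler_pM2r// invr_gt0 exprn_gt0.
Qed.

Lemma moment_disk n : dint (fun z => (normc z ^+ 2) ^+ n) <= pi / n.+1%:R.
Proof.
(* The step function telescopes from 0^n, which is 0 only for n > 0. *)
have [->|] := eqVneq n 0%N.
  by under [X in dint X]funext do rewrite expr0; rewrite dint_cst mul1r divr1.
rewrite -lt0n => n0.
have h : (fun M => pi * ((1 + (@harmonic R) M) ^+ n.+1 / n.+1%:R)) @ \oo --> pi * ((1 + 0) ^+ n.+1 / n.+1%:R).
  apply: cvgM; first exact: cvg_cst.
  apply: cvgM; last exact: cvg_cst.
  apply: (@cvg_comp _ _ _ (fun M => 1 + @harmonic R M) (fun x : R => x ^+ n.+1)); last exact: exprn_continuous.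
  by apply: cvgD; [exact: cvg_cst|exact: cvg_harmonic].
rewrite addr0 expr1n mul1r in h.
apply: (ler_cvg_to (cvg_cst (dint (fun z => (normc z ^+ 2) ^+ n))) h).
by apply: nearW => M; exact: moment_disk_step.
Qed.

End disk_mean.

(** * Sub-mean value inequality *)

Section sub_mean_value.
Variable R : realType.
Local Notation C := R[i].
Implicit Types (z w : C) (P Q : {poly C}) (psi : C -> R).

Lemma touched_ln_max (m : R) w0 : w0 != 0 -> 0 < m <= normc w0 ->
  touched (fun w => ln (Num.max (normc w) m)) w0.
Proof.
move=> w00 /andP[m0 mw]; have n0 : 0 < normc w0 by rewrite normc_gt0.
have j := jetD (jet_cst (ln (normc w0))) (@jet_log_abs1 R).
have j2 : jet (fun v => ln (normc w0) + log_abs1 v) (ln (normc w0)) 1 0 (- 1 / 2) 0 (- (- 1 / 2)).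
  by apply: (jet_eq j); split; ring.
apply: (touched_jet w00 j2); first by rewrite max_l.
exists 1 => // v v1; have [_ n1] := normc1D_gt0 v1.
rewrite /log_abs1 -lnM ?posrE// -Normc.normcM ler_ln ?posrE ?lt_max ?m0 ?orbT//.
  by rewrite le_max lexx.
by rewrite Normc.normcM mulr_gt0.
Qed.

Lemma continuousC_max_normc P (m : R) : 0 < m ->
  continuousC (fun z => ln (Num.max (normc P.[z]) m)).
Proof.
move=> m0; have [cr ci] := continuousC_horner P.
have cn := continuousC_normc cr ci.
apply: (continuousC_comp (G := fun z => Num.max (normc P.[z]) m) (k := @ln R)).
  by move=> z; apply: continuous_max; [exact: cn|exact: cvg_cst].
by move=> z; apply: continuous_ln; rewrite lt_max m0 orbT.
Qed.

Lemma continuousC_comp_horner psi P : continuousC psi ->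
  continuousC (fun z => psi P.[z]).
Proof.
move=> cpsi z; have [cr ci] := continuousC_horner P.
pose h (x : R * R) : R * R := (complex.Re P.[cpx x], complex.Im P.[cpx x]).
have -> : (fun x : R * R => psi P.[cpx x]) = (fun x => psi (cpx (h x))).
  by apply/funext => x; rewrite /h /cpx /=; case: (P.[_]).
apply: (@continuous_comp _ _ _ h (fun x : R * R => psi (cpx x))); last exact: cpsi.
exact: (cvg_pair (cr z) (ci z)).
Qed.

(* The zeros of P are avoided by adding the barrier d * ln |P|. *)
Lemma le_Re_at0 psi P Q (e : R) : continuousC psi ->
  (forall w, w != 0 -> touched psi w) -> P.[0] != 0 ->
  (forall z, normc z = 1 -> psi P.[z] <= complex.Re Q.[z] + e) ->
  psi P.[0] <= complex.Re Q.[0] + e.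
Proof.
move=> cpsi tpsi P0 ePQ.
have n0 : 0 < normc P.[0] by rewrite normc_gt0.
have cP := @continuousC_comp_horner psi P cpsi.
have [cQ _] := continuousC_horner Q.
have [K hK] := bounded_cdisk (continuousCB cP cQ).
have [L L0 hL] := horner_bounded P.
pose l := ln (L + 1).
have l0 : 0 <= l by rewrite ln_ge0// lerDr.
have main (d : R) : 0 < d ->
    psi P.[0] - complex.Re Q.[0] + d * ln (normc P.[0]) <= e + d * l.
  move=> d0.
  (* The last bound makes G at most e + d l wherever |P| <= m, so subharmonicity is only asked for
     away from the zeros of P. The bound by |P(0)| leaves the value at 0 untruncated, and m <= 1
     keeps the truncated logarithm below l. *)
  pose m := Num.min (Num.min 1 (normc P.[0])) (expR ((e + d * l - K) / d)).
  have m0 : 0 < m by rewrite !lt_min ltr01 n0 expR_gt0.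
  have mP : m <= normc P.[0] by rewrite !ge_min lexx orbT.
  have m1 : m <= 1 by rewrite !ge_min lexx.
  have mK : d * ln m <= e + d * l - K.
    rewrite mulrC -ler_pdivlMr// -[leRHS]expRK ler_ln ?posrE ?expR_gt0//.
    by rewrite ge_min lexx orbT.
  pose b w := ln (Num.max (normc w) m).
  pose G z := psi P.[z] + complex.Re (- Q).[z] + d * b P.[z].
  have bl z : normc z <= 1 -> b P.[z] <= l.
    move=> z1; rewrite ler_ln ?posrE ?lt_max ?m0 ?orbT//; last by rewrite ltr_pwDr.
    rewrite ge_max; apply/andP; split; last by rewrite (le_trans m1)// lerDr.
    by rewrite (le_trans (hL _ z1))// lerDl.
  have cG : continuousC G.
    apply: continuousCD; first by apply: continuousCD => //; exact: (continuousC_horner (- Q)).1.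
    apply: continuousCM; first exact: continuousC_cst.
    exact: continuousC_max_normc.
  have GE z : G z = psi P.[z] - complex.Re Q.[z] + d * b P.[z].
    by rewrite /G hornerN ReN.
  have := @max_principle R G (e + d * l) cG.
  move=> /(_ _ _ 0); rewrite GE /b max_l//; apply; last by rewrite normc0.
    move=> z z1; rewrite GE lerD//; first by rewrite lerBlDl ePQ.
    by rewrite ler_pM2l// bl// z1.
  move=> z z1; rewrite GE => Gz.
  have Pm : m < normc P.[z].
    rewrite ltNge; apply/negP => Pm; move: Gz; rewrite ltNge => /negP; apply.
    rewrite /b max_r//.
    have := hK z (ltW z1); rewrite ler_norml => /andP[_ hk].
    by have := lerD hk mK; lra.
  have Pz : P.[z] != 0 by rewrite -normc_gt0 (lt_trans m0).
  apply: sub4D; first apply: sub4D.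
  - by apply: sub4_touched; exact: tpsi.
  - exact: sub4_Re.
  - apply: sub4Z; first exact: ltW.
    by apply: (@sub4_touched _ b); apply: touched_ln_max => //; rewrite m0 ltW.
rewrite leNgt; apply/negP => gap.
pose g := psi P.[0] - complex.Re Q.[0] - e.
have g0 : 0 < g by rewrite /g; lra.
(* With d = g / (2 c), the cost d (l - ln |P(0)|) of the barrier is less than half of the supposed
   gap g. *)
pose c := l - ln (normc P.[0]) + 1.
have c0 : 0 < c.
  have : ln (normc P.[0]) <= l.
    rewrite ler_ln ?posrE//; last by rewrite ltr_pwDr.
    by rewrite (le_trans (hL _ _)) ?normc0// lerDl.
  by rewrite /c; lra.
have d0 : 0 < g / (2 * c) by rewrite divr_gt0// mulr_gt0.
have h1 := main _ d0.
have h2 : g <= g / (2 * c) * (c - 1) by rewrite /g /c in h1 *; lra.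
have h3 : g / (2 * c) * c = g / 2 by field; rewrite gt_eqF.
rewrite mulrBr h3 in h2; lra.
Qed.

(** One n serves every z, so the inequality can be integrated over the disk. For fixed z, the
    function w -> psi (P (z w)) is approximated on the circle by Re Q with Q of size at most n; the
    discrete mean of Re Q is then exactly Re Q(0), which [le_Re_at0] compares with psi (P(0)). *)
Lemma sub_mean_root1 psi P (e : R) : continuousC psi ->
  (forall w, w != 0 -> touched psi w) -> P.[0] != 0 -> 0 < e ->
  exists2 n : nat, (2 < n)%N & forall z, normc z <= 1 ->
    n%:R * (psi P.[0] - e) <= \sum_(j < n) psi P.[z * root1 R n ^+ j].
Proof.
move=> cpsi tpsi P0 e0.
have cP := @continuousC_comp_horner psi P cpsi.
have e4 : 0 < e / 4 by rewrite divr_gt0.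
have [B B0 hB] := modulus_cdisk cP e4.
(* Large enough for the Fejer error to be at most e / 4, and greater than 2 as [dint_sum_root1]
   demands. *)
pose n := (Num.truncn (16 * B / e)).+3.
have nB : B * 4 / n%:R <= e / 4.
  rewrite ler_pdivrMr ?ltr0n//.
  have : 16 * B / e <= n%:R.
    apply: le_trans (ltW (truncnS_gt _)) _; rewrite ler_nat /n.
    by rewrite ltnS leqW.
  rewrite ler_pdivrMr//; lra.
exists n => // z z1.
have zw w : normc w = 1 -> normc (z * w) <= 1 by move=> w1; rewrite Normc.normcM w1 mulr1.
have gB w w' : normc w = 1 -> normc w' = 1 ->
    `|psi P.[z * w] - psi P.[z * w']| <= e / 4 + B * normc (w - w') ^+ 2.
  move=> w1 w1'; apply: le_trans (hB _ _ (zw _ w1) (zw _ w1')) _.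
  rewrite lerD2l ler_wpM2l// -mulrBr Normc.normcM exprMn ler_piMl ?sqr_ge0//.
  by rewrite expr_le1 ?normc_ge0.
have [Q sQ hQ] := fejer_approx (ltn0Sn _ : (0 < n)%N) B0 gB.
have hQ' w : normc w = 1 -> `|psi P.[z * w] - complex.Re Q.[w]| <= e / 2.
  by move=> /hQ /le_trans; apply; lra.
pose Pz := P \Po (z *: 'X).
have PzE w : Pz.[w] = P.[z * w] by rewrite horner_comp !hornerE.
have Pz0 : Pz.[0] = P.[0] by rewrite PzE mulr0.
have := @le_Re_at0 psi Pz Q (e / 2) cpsi tpsi.
rewrite Pz0 => /(_ P0) le0.
have {}le0 : psi P.[0] <= complex.Re Q.[0] + e / 2.
  apply: le0 => w w1; have := hQ' _ w1; rewrite PzE ler_norml => /andP[_]; lra.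
have sumQ : \sum_(j < n) complex.Re Q.[root1 R n ^+ j] = n%:R * complex.Re Q.[0].
  rewrite -Re_sum; have := sum_root1 1 sQ (ltn0Sn _ : (0 < n)%N).
  under eq_bigr do rewrite mul1r.
  by move=> ->; rewrite -(rmorph_nat (real_complex R)) ReMr.
apply: (@le_trans _ _ (\sum_(j < n) (complex.Re Q.[root1 R n ^+ j] - e / 2))).
  rewrite sumrB sumQ sumr_const card_ord.
  have -> : n%:R * complex.Re Q.[0] - (e / 2) *+ n = n%:R * (complex.Re Q.[0] - e / 2).
    by rewrite -[(e / 2) *+ n]mulr_natl mulrBr.
  rewrite ler_wpM2l//; lra.
apply: ler_sum => j _.
have r1 : normc (root1 R n ^+ j) = 1 by rewrite normcX normc_root1 expr1n.
have := hQ' _ r1; rewrite ler_norml => /andP[]; lra.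
Qed.

End sub_mean_value.

(** * Means over the circle *)

Section circle_mean.
Variable R : realType.
Local Notation C := R[i].
Local Notation mu := (@lebesgue_measure R).
Local Notation cpx := (@cpx R).
Implicit Types (G k : C -> R) (P Q : {poly C}).

Lemma continuous_cis k : continuousC k -> continuous (fun t : R => k (cis t)).
Proof.
move=> ck t; apply: (@continuous_comp _ _ _ (fun t : R => (cos t, sin t)) (fun x : R * R => k (cpx x))); last exact: ck.
exact: (cvg_pair (@continuous_cos R t) (@continuous_sin R t)).
Qed.

Definition cmean k : R := (2 * pi)^-1 * (\int[mu]_(t in `[0, (2 * pi)%R]) k (cis t))%R.

Let twopi_gt0 : 0 < 2 * pi :> R.
Proof. by rewrite mulr_gt0// pi_gt0. Qed.

Lemma continuous_segment_integrable (h : R -> R) (a b : R) : continuous h ->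
  mu.-integrable `[a, b] (EFin \o h).
Proof.
move=> ch; apply: continuous_compact_integrable; first exact: segment_compact.
exact: continuous_subspaceT.
Qed.

Lemma cmeanD k1 k2 : continuousC k1 -> continuousC k2 ->
  cmean (fun z => k1 z + k2 z) = cmean k1 + cmean k2.
Proof.
move=> c1 c2; rewrite /cmean -mulrDr; congr (_ * _); apply: RintegralD => //;
  by apply: continuous_segment_integrable; exact: continuous_cis.
Qed.

Lemma cmeanZ k (a : R) : continuousC k -> cmean (fun z => a * k z) = a * cmean k.
Proof.
move=> ck; rewrite /cmean mulrCA; congr (_ * _); apply: RintegralZl => //.
by apply: continuous_segment_integrable; exact: continuous_cis.
Qed.

Lemma cmean_le k1 k2 : continuousC k1 -> continuousC k2 ->
  (forall z, normc z = 1 -> k1 z <= k2 z) -> cmean k1 <= cmean k2.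
Proof.
move=> c1 c2 h; rewrite /cmean ler_pM2l ?invr_gt0//; apply: le_Rintegral => //;
  try by apply: continuous_segment_integrable; exact: continuous_cis.
by move=> t _; rewrite h// normc_cis.
Qed.

Lemma cmean_cst (a : R) : cmean (fun=> a) = a.
Proof.
rewrite /cmean Rintegral_cst//.
have mE : mu `[0, (2 * pi)%R] = (2 * pi)%:E by rewrite lebesgue_measure_itv/= lte_fin twopi_gt0 oppr0 adde0.
rewrite (_ : fine _ = 2 * pi); last by rewrite -[RHS]/(fine (2 * pi)%:E) -mE.
by rewrite mulrCA mulVf ?mulr1// gt_eqF.
Qed.

Lemma cmean_sum (n : nat) (F : nat -> C -> R) : (forall i, continuousC (F i)) ->
  cmean (fun z => \sum_(i < n) F i z) = \sum_(i < n) cmean (F i).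
Proof.
move=> cF; elim: n => [|n IH].
  rewrite big_ord0; under [X in cmean X]funext do rewrite big_ord0.
  by rewrite cmean_cst.
under [X in cmean X]funext do rewrite big_ord_recr/=.
by rewrite big_ord_recr/= cmeanD// ?IH//; exact: continuousC_sum.
Qed.

Lemma cmean_Re_monomial (c : C) n : (0 < n)%N ->
  cmean (fun z => complex.Re (c * z ^+ n)) = 0.
Proof.
move=> n0; have nR : (n%:R : R) != 0 by rewrite pnatr_eq0 -lt0n.
case: c => a b; rewrite /cmean.
pose f (t : R) := a * cos (n%:R * t) - b * sin (n%:R * t).
pose F (t : R) := a / n%:R * sin (n%:R * t) + b / n%:R * cos (n%:R * t).
have E t : complex.Re ((a +i* b)%C * cis t ^+ n) = f t by rewrite cisX ReM /= -mulr_natl.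
under eq_Rintegral do rewrite E.
have dF (t : R) : is_derive t 1 F (f t).
  have h := is_derive1D (is_derive1Z (a / n%:R) (is_derive1_sinM n%:R t))
    (is_derive1Z (b / n%:R) (is_derive1_cosM n%:R t)).
  by apply: (is_derive_eq h); rewrite /f; field.
have cF : continuous F by move=> t; exact: is_derive1_continuous (dF t).
have cf : continuous f.
  move=> t; apply: cvgB; apply: cvgM; try exact: cvg_cst.
    exact: is_derive1_continuous (is_derive1_cosM n%:R t).
  exact: is_derive1_continuous (is_derive1_sinM n%:R t).
rewrite /Rintegral (continuous_FTC2E twopi_gt0 cf cF (fun t _ => dF t))/=.
have -> : F (2 * pi) = F 0; last by rewrite subrr mulr0.
have c1 : cis (n%:R * (2 * pi) : R) = 1.
  rewrite mulr_natl -cisX (_ : cis _ = 1) ?expr1n//.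
  by apply: eqC; rewrite /= mulr_natl ?cos2pi ?sin2pi.
have /= cE := congr1 (@complex.Re R) c1; have /= sE := congr1 (@complex.Im R) c1.
by rewrite /F cE sE !mulr0 cos0 sin0 !mulr0.
Qed.

Lemma continuousC_Re_horner Q : continuousC (fun z => complex.Re Q.[z]).
Proof. exact: (continuousC_horner Q).1. Qed.

Lemma cmean_Re Q : cmean (fun z => complex.Re Q.[z]) = complex.Re Q.[0].
Proof.
have E z : complex.Re Q.[z] = \sum_(i < size Q) complex.Re (Q`_i * z ^+ i).
  by rewrite horner_coef Re_sum.
under [X in cmean X]funext do rewrite E.
have cm i : continuousC (fun z => complex.Re (Q`_i * z ^+ i)).
  have := @continuousC_Re_horner (Q`_i *: 'X^i).
  by under [X in continuousC X -> _]funext do rewrite hornerZ hornerXn.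
rewrite (@cmean_sum _ (fun i z => complex.Re (Q`_i * z ^+ i)))// E.
apply: eq_bigr => -[[|i] /= _] _; last by rewrite cmean_Re_monomial// expr0n mulr0.
by under [X in cmean X]funext do rewrite expr0; rewrite cmean_cst expr0.
Qed.

(** Parseval: on the circle the integrand is the real part of [sqpoly], whose mean is its value at
    0. *)
Lemma cmean_sqr_normc P : cmean (fun z => normc P.[z] ^+ 2) = \sum_(i < size P) normc P`_i ^+ 2.
Proof.
have [cr ci] := continuousC_horner P.
have cP := @continuousCX R _ 2 (continuousC_normc cr ci).
have cS := @continuousC_Re_horner (sqpoly (size P) P).
have E z : normc z = 1 -> normc P.[z] ^+ 2 = complex.Re (sqpoly (size P) P).[z].
  by move=> z1; exact: sqpolyE.
transitivity (complex.Re (sqpoly (size P) P).[0]); last by rewrite sqpoly0.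
rewrite -cmean_Re; apply/eqP; rewrite eq_le.
by apply/andP; split; apply: cmean_le => // z z1; rewrite E.
Qed.

Lemma fejer_continuous G (e : R) : continuousC G -> 0 < e ->
  exists Q : {poly C}, forall z, normc z = 1 -> `|G z - complex.Re Q.[z]| <= e.
Proof.
move=> cG e0; have e2 : 0 < e / 2 by rewrite divr_gt0.
have [B B0 hB] := modulus_cdisk cG e2.
pose n := (Num.truncn (8 * B / e)).+1.
have nB : B * 4 / n%:R <= e / 2.
  rewrite ler_pdivrMr ?ltr0n//.
  have : 8 * B / e <= n%:R by exact: ltW (truncnS_gt _).
  rewrite ler_pdivrMr//; lra.
have [|Q _ hQ] := fejer_approx (ltn0Sn _ : (0 < n)%N) B0 (g := G) (e := e / 2).
  by move=> z w z1 w1; apply: hB; rewrite ?z1 ?w1.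
by exists Q => z /hQ /le_trans; apply; lra.
Qed.

(** A Fejer approximation Re Q of psi o P on the circle links both sides: its value at 0 is its
    mean, and [le_Re_at0] bounds psi (P(0)) by it. *)
Lemma sub_mean_circle (psi : C -> R) P : continuousC psi ->
  (forall w, w != 0 -> touched psi w) -> P.[0] != 0 ->
  psi P.[0] <= cmean (fun z => psi P.[z]).
Proof.
move=> cpsi tpsi P0; have cP := continuousC_comp_horner (P := P) cpsi.
apply/ler_addgt0Pr => e e0; have e2 : 0 < e / 2 by rewrite divr_gt0.
have [Q hQ] := fejer_continuous cP e2.
apply: (le_trans (@le_Re_at0 _ psi P Q (e / 2) cpsi tpsi P0 _)).
  by move=> z z1; have := hQ z z1; rewrite ler_norml => /andP[]; lra.
suff : complex.Re Q.[0] <= cmean (fun z => psi P.[z]) + e / 2 by lra.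
rewrite -cmean_Re -[e / 2]cmean_cst -cmeanD//; last exact: continuousC_cst.
apply: cmean_le.
- exact: continuousC_Re_horner.
- by apply: continuousCD => //; exact: continuousC_cst.
- by move=> z z1; have := hQ z z1; rewrite ler_norml => /andP[]; lra.
Qed.

End circle_mean.

(** * Carleman's inequality *)

Section carleman.
Variable R : realType.
Local Notation C := R[i].
Implicit Types (P Q g : {poly C}).

Lemma sqr_sum_le (n : nat) (x : nat -> R) :
  (\sum_(i < n) x i) ^+ 2 <= n%:R * \sum_(i < n) x i ^+ 2.
Proof.
rewrite expr2 big_distrlr/=.
have h : n%:R * \sum_(i < n) x i ^+ 2 = \sum_(i < n) \sum_(j < n) (x i ^+ 2 + x j ^+ 2) / 2.
  under [RHS]eq_bigr do rewrite -mulr_suml big_split/= sumr_const card_ord.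
  rewrite -mulr_suml big_split/= sumrMnl sumr_const card_ord -mulr_natl.
  by rewrite -[X in _ = (X + _) / _]mulr_natl; field.
rewrite h; apply: ler_sum => i _; apply: ler_sum => j _.
by rewrite ler_pdivlMr//; have := sqr_ge0 (x i - x j); nra.
Qed.

Lemma continuousC_normc_horner P : continuousC (fun z => normc P.[z]).
Proof. by have [] := continuousC_horner P; exact: continuousC_normc. Qed.

(** The i-th coefficient of g^2 is a sum of i + 1 products; the factor i + 1 from Cauchy-Schwarz
    cancels exactly against the moment pi / (i + 1) of the disk. *)
Lemma carleman_poly g :
  dint (fun z => normc g.[z] ^+ 4) <= pi * cmean (fun z => normc g.[z] ^+ 2) ^+ 2.
Proof.
rewrite cmean_sqr_normc.
(* The 3 ensures n > 2 for the average over rotations. *)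
pose S := g * g; pose n := maxn 3 (size g + size g).
have n3 : (2 < n)%N by rewrite leq_max.
have n0 : (0 < n)%N by exact: leq_trans n3.
have sS : (size S <= n)%N.
  by rewrite (leq_trans (size_polyMleq _ _))// (leq_trans (leq_pred _))// leq_maxr.
have cS : continuousC (fun z => normc S.[z] ^+ 2).
  by apply: continuousCX; exact: continuousC_normc_horner.
have cN i : continuousC (fun z : C => (normc z ^+ 2) ^+ i).
  apply: continuousCX; apply: continuousCX; apply: (@continuousC_normc R id);
    [exact: continuousC_Re|exact: continuousC_Im].
have -> : (fun z => normc g.[z] ^+ 4) = (fun z => normc S.[z] ^+ 2).
  by apply/funext => z; rewrite hornerM Normc.normcM -expr2 -exprM.
have nR : (0 : R) < n%:R by rewrite ltr0n.
have -> : dint (fun z => normc S.[z] ^+ 2) = \sum_(i < n) normc S`_i ^+ 2 * dint (fun z : C => (normc z ^+ 2) ^+ i).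
  apply: (mulfI (lt0r_neq0 nR)); rewrite -dint_sum_root1//.
  under [X in dint X]funext do rewrite mean_sqr_normc//.
  rewrite (@dintZ _ (fun z => \sum_(i < n) normc S`_i ^+ 2 * (normc z ^+ 2) ^+ i)); last first.
    apply: (@continuousC_sum _ n (fun i z => normc S`_i ^+ 2 * (normc z ^+ 2) ^+ i)) => i.
    by apply: continuousCM => //; exact: continuousC_cst.
  congr (_ * _); rewrite (@dint_sum _ n (fun i z => normc S`_i ^+ 2 * (normc z ^+ 2) ^+ i)).
    by apply: eq_bigr => i _; rewrite dintZ.
  by move=> i; apply: continuousCM => //; exact: continuousC_cst.
(* The coefficients of h^2 are the sums left by Cauchy-Schwarz, and their total h(1)^2 is the square
   of the mean of |g|^2. *)
pose h : {poly R} := \poly_(k < size g) (normc g`_k ^+ 2).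
have hE k : h`_k = normc g`_k ^+ 2.
  rewrite coef_poly; case: ltnP => // kg.
  by rewrite nth_default// normc0 expr0n.
have h1 : h.[1] = \sum_(i < size g) normc g`_i ^+ 2.
  by rewrite horner_poly; apply: eq_bigr => i _; rewrite expr1n mulr1.
have sh : (size (h * h)%R <= n)%N.
  rewrite (leq_trans (size_polyMleq _ _))// (leq_trans (leq_pred _))//.
  by rewrite leq_max; apply/orP; right; apply: leq_add; exact: size_poly.
have hh : (h * h).[1] = \sum_(i < n) (h * h)`_i.
  by rewrite (horner_coef_wide _ sh); apply: eq_bigr => i _; rewrite expr1n mulr1.
rewrite -h1 expr2 -hornerM hh mulr_sumr; apply: ler_sum => i _.
apply: (le_trans (ler_wpM2l (sqr_ge0 _) (moment_disk R i))).
rewrite mulrCA ler_pM2l ?pi_gt0// ler_pdivrMr// coefM.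
rewrite /S coefM.
apply: (@le_trans _ _ ((\sum_(j < i.+1) normc (g`_j * g`_(i - j))) ^+ 2)).
  rewrite ler_sqr ?nnegrE ?normc_ge0 ?ler_normc_sum//.
  by apply: sumr_ge0 => j _; exact: normc_ge0.
apply: (le_trans (sqr_sum_le _ (fun j => normc (g`_j * g`_(i - j))))).
rewrite mulrC ler_pM2r//; apply: ler_sum => j _.
by rewrite !hE Normc.normcM exprMn.
Qed.

(** Here y / (1 + y) = y - y^2 / (1 + y) >= y - 2 y^2 because 1 + y >= 1 / 2, and e^(-u) >= 1 - u at
    u = y / (1 + y) gives e^u <= 1 + y. *)
Lemma expR_le1D (y : R) : - 1 / 2 <= y -> expR (y - 2 * y ^+ 2) <= 1 + y.
Proof.
move=> y2; have y1 : 0 < 1 + y by lra.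
apply: (@le_trans _ _ (expR (y / (1 + y)))).
  rewrite ler_expR ler_pdivlMr//; nra.
have := expR_ge1Dx (- (y / (1 + y))).
have -> : 1 + - (y / (1 + y)) = (1 + y)^-1 by field; rewrite gt_eqF.
by rewrite expRN lef_pV2 ?posrE// expR_gt0.
Qed.

Lemma continuousC_expR (G : C -> R) : continuousC G -> continuousC (fun z => expR (G z)).
Proof. by move=> cG; apply: (continuousC_comp (k := @expR R)) => // z; exact: continuous_expR. Qed.

(** Uniform rate for (1 + w / N)^N -> e^w, from |1 + w / N|^2 = 1 + 2 Re w / N + |w|^2 / N^2. The
    upper bound is 1 + x <= e^x; the lower one drops the last term, with 4 K <= N ensuring 2 Re w /
    N >= - 1 / 2. *)
Lemma normc_1DX (N : nat) (K : R) (w : C) : (0 < N)%N -> normc w <= K -> 4 * K <= N%:R ->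
  expR (2 * complex.Re w) * expR (- (8 * K ^+ 2 / N%:R)) <=
  normc ((1 + (N%:R^-1)%:C%C * w) ^+ N) ^+ 2 <=
  expR (2 * complex.Re w) * expR (K ^+ 2 / N%:R).
Proof.
move=> N0 wK KN; set x := normc _ ^+ 2; have NR : (0 : R) < N%:R by rewrite ltr0n.
have K0 : 0 <= K by exact: le_trans (normc_ge0 w) wK.
set a := complex.Re w.
have aK : - K <= a <= K by rewrite -ler_norml (le_trans (normRe_le _)).
have xE : x = (1 + (2 * a / N%:R + normc w ^+ 2 / N%:R ^+ 2)) ^+ N.
  rewrite /x normcX exprAC sqr_normc ReD ImD ReMr ImMr/= add0r; congr (_ ^+ _).
  by rewrite sqr_normc -/a; field; rewrite gt_eqF.
have w2 : normc w ^+ 2 <= K ^+ 2 by rewrite ler_sqr ?nnegrE ?normc_ge0.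
have q0 : 0 <= normc w ^+ 2 / N%:R ^+ 2 by rewrite divr_ge0 ?sqr_ge0.
pose y := 2 * a / N%:R.
have yl : - 1 / 2 <= y by rewrite /y ler_pdivlMr//; lra.
rewrite -!expRD xE -/y; apply/andP; split.
  apply: (@le_trans _ _ ((1 + y) ^+ N)); last first.
    rewrite lerXn2r ?nnegrE//; [lra|lra|by rewrite lerD2l lerDl].
  apply: (@le_trans _ _ (expR (y - 2 * y ^+ 2) ^+ N)); last first.
    by rewrite lerXn2r ?nnegrE ?expR_ge0 ?expR_le1D//; lra.
  rewrite -expRM_natl ler_expR /y -subr_ge0.
  have -> : N%:R * (2 * a / N%:R - 2 * (2 * a / N%:R) ^+ 2) - (2 * a - 8 * K ^+ 2 / N%:R) =
    8 * (K ^+ 2 - a ^+ 2) / N%:R by field; rewrite gt_eqF.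
  rewrite divr_ge0// mulr_ge0// subr_ge0; nra.
apply: (@le_trans _ _ (expR (y + normc w ^+ 2 / N%:R ^+ 2) ^+ N)).
  rewrite lerXn2r ?nnegrE ?expR_ge0 ?expR_ge1Dx//; lra.
rewrite -expRM_natl ler_expR /y.
have -> : N%:R * (2 * a / N%:R + normc w ^+ 2 / N%:R ^+ 2) = 2 * a + normc w ^+ 2 / N%:R.
  by field; rewrite gt_eqF.
by rewrite lerD2l ler_pM2r ?invr_gt0.
Qed.

Lemma cmean_ge0 (k : C -> R) : continuousC k -> (forall z, normc z = 1 -> 0 <= k z) -> 0 <= cmean k.
Proof.
move=> ck k0; rewrite -[leLHS](cmean_cst (0 : R)); apply: cmean_le => //.
exact: continuousC_cst.
Qed.

Lemma carleman_exp Q :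
  dint (fun z => expR (2 * complex.Re Q.[z]) ^+ 2) <=
  pi * cmean (fun z => expR (2 * complex.Re Q.[z])) ^+ 2.
Proof.
have [K K0 hK] := horner_bounded Q.
pose E z := expR (2 * complex.Re Q.[z]).
have cE : continuousC E.
  apply: continuousC_expR; apply: continuousCM; first exact: continuousC_cst.
  exact: continuousC_Re_horner.
have cE2 : continuousC (fun z => E z ^+ 2) by exact: continuousCX.
have cE0 : 0 <= cmean E by apply: cmean_ge0 => // z _; exact: expR_ge0.
have step N : 4 * K <= N.+1%:R ->
  dint (fun z => E z ^+ 2) <= expR (18 * K ^+ 2 * (@harmonic R) N) * (pi * cmean E ^+ 2).
  move=> KN; pose g := (1 + (N.+1%:R^-1)%:C%C *: Q) ^+ N.+1.
  have gE z : normc z <= 1 -> E z * expR (- (8 * K ^+ 2 / N.+1%:R)) <= normc g.[z] ^+ 2 <= E z * expR (K ^+ 2 / N.+1%:R).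
    move=> z1; rewrite /g horner_exp hornerD hornerZ hornerC.
    exact: (normc_1DX (ltn0Sn N) (hK z z1) KN).
  have cg m : continuousC (fun z => normc g.[z] ^+ m) by apply: continuousCX; exact: continuousC_normc_horner.
  have h1 : expR (- (8 * K ^+ 2 / N.+1%:R)) ^+ 2 * dint (fun z => E z ^+ 2) <= dint (fun z => normc g.[z] ^+ 4).
    rewrite -dintZ//; apply: dint_le => //.
      by apply: continuousCM => //; exact: continuousC_cst.
    move=> z z1; rewrite mulrC -exprMn (exprM _ 2 2) ler_sqr ?nnegrE ?sqr_ge0//.
      by have /andP[] := gE z z1.
    by rewrite mulr_ge0 ?expR_ge0.
  have h2 : cmean (fun z => normc g.[z] ^+ 2) <= expR (K ^+ 2 / N.+1%:R) * cmean E.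
    rewrite -cmeanZ//; apply: cmean_le => //.
      by apply: continuousCM => //; exact: continuousC_cst.
    by move=> z z1; have := gE z; rewrite z1 => /(_ (lexx _))/andP[_]; rewrite mulrC.
  have h3 : 0 <= cmean (fun z => normc g.[z] ^+ 2).
    by apply: cmean_ge0 => // z _; exact: sqr_ge0.
  have := le_trans h1 (carleman_poly g).
  rewrite -[X in X * dint _]expRM_natl mulrN expRN mulrC ler_pdivrMr ?expR_gt0//.
  move=> /le_trans; apply.
  apply: (@le_trans _ _ (pi * (expR (K ^+ 2 / N.+1%:R) * cmean E) ^+ 2 * expR (2%:R * (8 * K ^+ 2 / N.+1%:R)))).
    rewrite ler_pM2r ?expR_gt0// ler_pM2l ?pi_gt0// ler_sqr ?nnegrE//.
    exact: le_trans h2.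
  rewrite le_eqVlt; apply/orP; left; apply/eqP.
  rewrite exprMn -expRM_natl.
  (* The 18 is 2 * 8 + 2 * 1: the lower error on the disk and the upper error on the circle, both
     squared. *)
  have -> : 18 * K ^+ 2 * harmonic N = 2%:R * (K ^+ 2 / N.+1%:R) + 2%:R * (8 * K ^+ 2 / N.+1%:R).
    rewrite /harmonic/=; set r := _^-1; ring.
  by rewrite expRD; ring.
have lim : (fun N => expR (18 * K ^+ 2 * (@harmonic R) N) * (pi * cmean E ^+ 2)) @ \oo -->
   expR (18 * K ^+ 2 * 0) * (pi * cmean E ^+ 2).
  apply: cvgM; last exact: cvg_cst.
  apply: (@cvg_comp _ _ _ (fun N => 18 * K ^+ 2 * @harmonic R N) (@expR R)); last exact: continuous_expR.
  by apply: cvgM; [exact: cvg_cst|exact: cvg_harmonic].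
rewrite mulr0 expR0 mul1r in lim.
apply: (ler_cvg_to (cvg_cst (dint (fun z => E z ^+ 2))) lim).
exists (Num.truncn (4 * K)) => // N /= KN; apply: step.
by apply: (le_trans (ltW (truncnS_gt _))); rewrite ler_nat.
Qed.

Lemma touched_cst_le (psi : C -> R) w0 : (forall w, psi w0 <= psi w) -> touched psi w0.
Proof.
move=> h; exists 0, 0 => e e0; exists 1 => // v _.
rewrite !mul0r addr0 /= addr0; apply: le_trans (h _); rewrite gerBl.
by apply: mulr_ge0; [exact: ltW|exact: sqr_ge0].
Qed.

(** Where |w0| < m the truncated logarithm is at its minimum, so contact from below holds
    everywhere, the origin included. *)
Lemma touched_ln_max0 (m : R) w0 : 0 < m -> touched (fun w => ln (Num.max (normc w) m)) w0.
Proof.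
move=> m0; have [mw|wm] := leP m (normc w0).
  by apply: touched_ln_max; rewrite ?m0// -normc_gt0 (lt_le_trans m0).
apply: touched_cst_le => w; rewrite (max_r (ltW wm)) ler_ln ?posrE ?lt_max ?m0 ?orbT//.
by rewrite le_max lexx orbT.
Qed.

Lemma continuousC_normc_powR (p : R) P : 0 < p -> continuousC (fun z => normc P.[z] `^ p).
Proof.
move=> p0; have -> : (fun z => normc P.[z] `^ p) = (fun z => `|normc P.[z]| `^ p).
  by apply/funext => w; rewrite ger0_norm// normc_ge0.
apply: (continuousC_comp (k := fun x : R => `|x| `^ p)); first exact: continuousC_normc_horner.
by move=> z; exact: continuous_normr_powR.
Qed.

Lemma carleman (p : R) P : 0 < p ->
  dint (fun z => (normc P.[z] `^ p) ^+ 2) <= pi * cmean (fun z => normc P.[z] `^ p) ^+ 2.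
Proof.
move=> p0; set F := fun z => normc P.[z] `^ p.
have cF : continuousC F by exact: continuousC_normc_powR.
have cF2 : continuousC (fun z => F z ^+ 2) by exact: continuousCX.
have F0 z : 0 <= F z by exact: powR_ge0.
have cF0 : 0 <= cmean F by exact: cmean_ge0.
have step (e : R) : 0 < e ->
    dint (fun z => F z ^+ 2) <= pi * (expR (2 * e) * (cmean F + e)) ^+ 2.
  (* Truncating |P| from below at m raises |P|^p by at most m^p = e. *)
  move=> e0; pose m := e `^ p^-1.
  have m0 : 0 < m by exact: powR_gt0.
  have mp : m `^ p = e by rewrite -powRrM mulVf ?gt_eqF// powRr1// ltW.
  pose b z := p * ln (Num.max (normc P.[z]) m).
  have cb : continuousC b.
    by apply: continuousCM; [exact: continuousC_cst|exact: continuousC_max_normc].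
  have [Q0 hQ0] := fejer_continuous cb e0.
  (* The shift makes 2 Re Q = Re Q0 + e lie between b and b + 2 e on the circle; the lower bound
     then extends to the disk by the maximum principle. *)
  pose Q := (1 / 2)%:C%C *: Q0 + ((e / 2)%:C%C)%:P.
  have QE z : 2 * complex.Re Q.[z] = complex.Re Q0.[z] + e.
    by rewrite hornerD hornerZ hornerC ReD ReMr/=; lra.
  have maxE z : expR (b z) = Num.max (normc P.[z]) m `^ p.
    by rewrite /powR gt_eqF ?lt_max ?m0 ?orbT.
  have bQ z : normc z <= 1 -> b z <= 2 * complex.Re Q.[z].
    move=> z1; rewrite -subr_le0.
    have -> : b z - 2 * complex.Re Q.[z] = b z + complex.Re ((- 2)%:C%C *: Q).[z].
      by rewrite hornerZ ReMr; lra.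
    apply: (@max_principle _ (fun z => b z + complex.Re ((- 2)%:C%C *: Q).[z])) => //.
    - by apply: continuousCD => //; exact: continuousC_Re_horner.
    - move=> w w1; rewrite hornerZ ReMr.
      by have := hQ0 w w1; rewrite ler_norml => /andP[_]; have := QE w; lra.
    - move=> w _ _; apply: sub4D; last exact: sub4_Re.
      apply: sub4Z; first exact: ltW.
      by apply: (@sub4_touched _ (fun w => ln (Num.max (normc w) m))); exact: touched_ln_max0.
  have FE z : normc z <= 1 -> F z <= expR (2 * complex.Re Q.[z]).
    move=> z1; apply: (@le_trans _ _ (expR (b z))); last by rewrite ler_expR bQ.
    rewrite maxE /F ge0_ler_powR ?nnegrE ?normc_ge0 ?le_max ?normc_ge0 ?lexx// ltW//.
  have EF z : normc z = 1 -> expR (2 * complex.Re Q.[z]) <= expR (2 * e) * (F z + e).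
    move=> z1; apply: (@le_trans _ _ (expR (2 * e + b z))).
      rewrite ler_expR; have := hQ0 z z1; rewrite ler_norml => /andP[h _]; have := QE z; lra.
    rewrite expRD ler_pM2l ?expR_gt0// maxE -mp /F.
    by case: (leP m (normc P.[z])) => _; [rewrite lerDl powR_ge0|rewrite lerDr powR_ge0].
  have cE : continuousC (fun z => expR (2 * complex.Re Q.[z])).
    apply: continuousC_expR; apply: continuousCM; first exact: continuousC_cst.
    exact: continuousC_Re_horner.
  apply: (@le_trans _ _ (dint (fun z => expR (2 * complex.Re Q.[z]) ^+ 2))).
    apply: dint_le => //; first exact: continuousCX.
    by move=> z z1; rewrite ler_sqr ?nnegrE ?expR_ge0// FE.
  apply: (le_trans (carleman_exp Q)); rewrite ler_pM2l ?pi_gt0//.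
  rewrite ler_sqr ?nnegrE; last 2 first.
  - by apply: cmean_ge0 => // z _; exact: expR_ge0.
  - by rewrite mulr_ge0 ?expR_ge0// addr_ge0// ltW.
  rewrite -[X in cmean F + X]cmean_cst -cmeanD//; last exact: continuousC_cst.
  rewrite -cmeanZ; last by apply: continuousCD => //; exact: continuousC_cst.
  apply: cmean_le => //; apply: continuousCM; first exact: continuousC_cst.
  by apply: continuousCD => //; exact: continuousC_cst.
have lim : (fun N => pi * (expR (2 * (@harmonic R) N) * (cmean F + (@harmonic R) N)) ^+ 2) @ \oo -->
   pi * (expR (2 * 0) * (cmean F + 0)) ^+ 2.
  apply: cvgM; first exact: cvg_cst.
  apply: (@cvg_comp _ _ _ (fun N => expR (2 * (@harmonic R) N) * (cmean F + (@harmonic R) N)) (fun x : R => x ^+ 2)); last exact: exprn_continuous.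
  apply: cvgM; last by apply: cvgD; [exact: cvg_cst|exact: cvg_harmonic].
  apply: (@cvg_comp _ _ _ (fun N => 2 * @harmonic R N) (@expR R)); last exact: continuous_expR.
  by apply: cvgM; [exact: cvg_cst|exact: cvg_harmonic].
rewrite mulr0 expR0 mul1r addr0 in lim.
apply: (ler_cvg_to (cvg_cst (dint (fun z => F z ^+ 2))) lim).
by apply: nearW => N; apply: step; rewrite /harmonic/= invr_gt0.
Qed.

End carleman.

(** * Riesz-type inequality *)

Section riesz.
Variable R : realType.
Local Notation C := R[i].
Implicit Types (P Q g : {poly C}) (p : R).

Lemma powR_sqr (a p : R) : 0 <= a -> a `^ (2 * p) = (a `^ p) ^+ 2.
Proof. by move=> a0; rewrite mulrC powRrM powR_mulrn// powR_ge0. Qed.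

Lemma normr_powR_lipschitz (s M x y : R) : 1 < s -> `|x| <= M -> `|y| <= M ->
  `| `|x| `^ s - `|y| `^ s | <= s * M `^ (s - 1) * `|x - y|.
Proof.
move=> s1; wlog xy : x y / `|y| <= `|x|.
  move=> h xM yM; have [/h|/ltW/h] := leP `|y| `|x|; first exact.
  by rewrite distrC [`|y - x|]distrC; exact.
move=> xM yM; have M0 : 0 <= M by exact: le_trans xM.
have s0 : 0 < s by lra.
have K0 : 0 <= s * M `^ (s - 1) by rewrite mulr_ge0 ?powR_ge0// ltW.
apply: (@le_trans _ _ (s * M `^ (s - 1) * (`|x| - `|y|))); last first.
  by rewrite ler_wpM2l// lerB_dist.
rewrite ger0_norm ?subr_ge0; last first.
  by rewrite ge0_ler_powR ?nnegrE// ltW.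
have [<-|ne] := eqVneq `|y| `|x|; first by rewrite !subrr mulr0.
have lt : `|y| < `|x| by rewrite lt_neqAle ne.
have [] := @MVT R (fun x : R => `|x| `^ s) (fun t => s * t `^ (s - 1)) _ _ lt.
- move=> t; rewrite in_itv/= => /andP[yt _]; apply: is_derive1_normr_powR.
  exact: le_lt_trans yt.
- by apply: continuous_subspaceT; exact: continuous_normr_powR.
move=> t; rewrite in_itv/= => /andP[yt tx]; rewrite !normr_id => ->.
have t0 : 0 <= t by apply: le_trans (ltW yt).
rewrite ler_wpM2r ?subr_ge0// ler_wpM2l ?(ltW s0)// ge0_ler_powR ?nnegrE ?subr_ge0 ?(ltW s1)//.
by apply: le_trans (ltW tx) xM.
Qed.

Lemma continuousC_Re_powR p P : 0 < p -> continuousC (fun z => `|complex.Re P.[z]| `^ p).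
Proof.
move=> p0; apply: (continuousC_comp (G := fun z => complex.Re P.[z]) (k := fun x : R => `|x| `^ p)).
  exact: continuousC_Re_horner.
by move=> z; exact: continuous_normr_powR.
Qed.

Definition riesz_const p : R :=
  if p <= 2 then cos (pi / (2 * p)) else sin (pi / (2 * p)).

Lemma riesz_const_gt0 p : 1 < p -> 0 < riesz_const p.
Proof.
move=> p1; have [a1 a2 a3 [a4 a5]] := contact_bounds p1.
by rewrite /riesz_const; case: ifP.
Qed.

Lemma riesz_circle p P (c : R) : 1 < p -> c != 0 ->
  complex.Re P.[0] ^+ 2 = c ^+ 2 -> complex.Im P.[0] ^+ 2 = c ^+ 2 ->
  riesz_const p `^ p * cmean (fun z => normc P.[z] `^ p) <=
  cmean (fun z => `|complex.Re P.[z]| `^ p).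
Proof.
move=> p1 c0 e1 e2; have p0 : 0 < p by lra.
have [a1 a2 a3 [a4 a5]] := contact_bounds p1.
have cN Q := @continuousC_normc_powR R p Q p0.
have cR := @continuousC_Re_powR p P p0.
have main (psi : C -> R) Q (a b : R) : 0 <= b -> continuousC psi ->
    (forall w, w != 0 -> touched psi w) -> Q.[0] != 0 -> 0 <= psi Q.[0] ->
    (forall z, a * normc Q.[z] `^ p + b * psi Q.[z] <= `|complex.Re P.[z]| `^ p) ->
    a * cmean (fun z => normc Q.[z] `^ p) <= cmean (fun z => `|complex.Re P.[z]| `^ p).
  move=> b0 cpsi tpsi Q0 psi0 h.
  have cQ := continuousC_comp_horner (P := Q) cpsi.
  have m0 := le_trans psi0 (sub_mean_circle cpsi tpsi Q0).
  apply: (@le_trans _ _ (cmean (fun z => a * normc Q.[z] `^ p + b * psi Q.[z]))).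
    rewrite cmeanD; [|by apply: continuousCM => //; exact: continuousC_cst..].
    by rewrite !cmeanZ// lerDl mulr_ge0.
  by apply: cmean_le => //; apply: continuousCD; apply: continuousCM => //; exact: continuousC_cst.
have P0 : P.[0] != 0.
  by apply/eqP => z0; move/eqP: c0; apply; apply/eqP; rewrite -sqrf_eq0 -e1 z0 /= expr0n.
rewrite /riesz_const; have [p2|p2] := leP p 2.
  have p12 : 1 < p <= 2 by rewrite p1.
  apply: (main (rpow_cos p) P _ (cos (pi / (2 * p)) `^ (p - 1) * sin (pi / (2 * p)))).
  - by rewrite mulr_ge0 ?powR_ge0// ltW.
  - exact: continuousC_rpow_cos.
  - by move=> w; exact: touched_rpow_cos.
  - exact: P0.
  - exact: rpow_cos_diag c0 p12 e1 e2.
  - by move=> z; exact: rpow_cos_le.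
(* A quarter turn makes Re P the imaginary part, to which [rpow_trunc_Im] applies. *)
pose iP := (0 +i* 1)%C *: P.
have iE z : iP.[z] = (0 +i* 1)%C * P.[z] by rewrite hornerZ.
have nE z : normc iP.[z] = normc P.[z].
  by rewrite iE Normc.normcM /normc/= expr0n expr1n add0r sqrtr1 mul1r.
have ImE z : complex.Im iP.[z] = complex.Re P.[z] by rewrite iE ImM /=; ring.
have ReE z : complex.Re iP.[z] = - complex.Im P.[z] by rewrite iE ReM /=; ring.
have -> : (fun z => normc P.[z] `^ p) = (fun z => normc iP.[z] `^ p).
  by apply/funext => z; rewrite nE.
apply: (main (rpow_trunc p) iP _ (sin (pi / (2 * p)) `^ (p - 1) * cos (pi / (2 * p)))).
- by rewrite mulr_ge0 ?powR_ge0// ltW.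
- exact: continuousC_rpow_trunc.
- by move=> w; exact: touched_rpow_trunc.
- by rewrite -normc_gt0 nE normc_gt0.
- by apply: (rpow_trunc_diag c0) => //; rewrite ?ReE ?ImE ?sqrrN.
- by move=> z; rewrite -ImE; exact: rpow_trunc_Im.
Qed.

(** The exponent 2 p always exceeds 2, so a single psi serves and cos (pi / (4 p)) involves no case
    distinction. The integrands are first averaged over n rotations, which leaves the integrals
    unchanged and brings in the discrete sub-mean inequality. *)
Lemma riesz_disk p P (c : R) : 1 < p -> c != 0 ->
  complex.Re P.[0] ^+ 2 = c ^+ 2 -> complex.Im P.[0] ^+ 2 = c ^+ 2 ->
  dint (fun z => (`|complex.Re P.[z]| `^ p) ^+ 2) <=
  (cos (pi / (4 * p)) `^ p) ^+ 2 * dint (fun z => (normc P.[z] `^ p) ^+ 2).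
Proof.
move=> p1 c0 e1 e2; have p0 : 0 < p by lra.
have s2 : 2 < 2 * p by lra. have s1 : 1 < 2 * p by lra.
have [a1 a2 a3 [a4 a5]] := contact_bounds s1.
have cN := @continuousCX R _ 2 (@continuousC_normc_powR R p P p0).
have cR := @continuousCX R _ 2 (@continuousC_Re_powR p P p0).
set t0 := pi / (2 * (2 * p)) in a1 a2 a3 a4 a5.
have -> : pi / (4 * p) = t0 by rewrite /t0 mulrA -natrM.
pose psi := @rpow_trunc R (2 * p).
pose b := cos t0 `^ (2 * p - 1) * sin t0.
have b0 : 0 <= b by rewrite mulr_ge0 ?powR_ge0// ltW.
pose K := (cos t0 `^ p) ^+ 2.
have V w : (`|complex.Re w| `^ p) ^+ 2 + b * psi w <= K * (normc w `^ p) ^+ 2.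
  rewrite /K -!powR_sqr ?normc_ge0 ?(ltW a4)//; exact: rpow_trunc_Re.
have P0 : P.[0] != 0.
  by apply/eqP => z0; move/eqP: c0; apply; apply/eqP; rewrite -sqrf_eq0 -e1 z0 /= expr0n.
have psi0 : 0 <= psi P.[0] by exact: rpow_trunc_diag c0 s2 e1 e2.
(* Integrated over the disk, the loss b e' contributes b e' pi = e b / (b + 1) <= e. *)
apply/ler_addgt0Pr => e e0; pose e' := e / (pi * (b + 1)).
have e'0 : 0 < e' by rewrite divr_gt0// mulr_gt0 ?pi_gt0//; lra.
have cpsi : continuousC psi by apply: continuousC_rpow_trunc; lra.
have tpsi w : w != 0 -> touched psi w by exact: touched_rpow_trunc.
have [n n2 hn] := sub_mean_root1 cpsi tpsi P0 e'0.
have nR : (0 : R) < n%:R by rewrite ltr0n (ltn_trans _ n2).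
have step : dint (fun z => \sum_(j < n) (`|complex.Re P.[z * root1 R n ^+ j]| `^ p) ^+ 2) <=
    dint (fun z => K * (\sum_(j < n) (normc P.[z * root1 R n ^+ j] `^ p) ^+ 2) + b * (n%:R * e')).
  have cS (G : C -> R) : continuousC G -> continuousC (fun z => \sum_(j < n) G (z * root1 R n ^+ j)).
    by move=> cG; apply: (@continuousC_sum _ n (fun j z => G (z * root1 R n ^+ j))) => j; exact: continuousC_mul.
  apply: dint_le; first exact: (cS _ cR).
    apply: continuousCD; last exact: continuousC_cst.
    by apply: continuousCM; [exact: continuousC_cst|exact: (cS _ cN)].
  move=> z z1; rewrite -lerBlDr.
  apply: (@le_trans _ _ (\sum_(j < n) ((`|complex.Re P.[z * root1 R n ^+ j]| `^ p) ^+ 2 + b * psi P.[z * root1 R n ^+ j]))).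
    rewrite big_split/= lerD2l -mulr_sumr -mulrN ler_wpM2l//.
    apply: le_trans (hn z z1); rewrite -mulrN ler_pM2l//; lra.
  by rewrite mulr_sumr; apply: ler_sum => j _; exact: V.
move: step; rewrite (dint_sum_root1 cR n2).
rewrite dintD; last 2 first.
- apply: continuousCM; first exact: continuousC_cst.
  by apply: (@continuousC_sum _ n (fun j z => (normc P.[z * root1 R n ^+ j] `^ p) ^+ 2)) => j; exact: (@continuousC_mul _ _ (root1 R n ^+ j) cN).
- exact: continuousC_cst.
rewrite dintZ; last first.
  by apply: (@continuousC_sum _ n (fun j z => (normc P.[z * root1 R n ^+ j] `^ p) ^+ 2)) => j; exact: (@continuousC_mul _ _ (root1 R n ^+ j) cN).
rewrite (dint_sum_root1 cN n2) dint_cst mulrCA -/K.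
have -> : b * (n%:R * e') * pi = n%:R * (b * e' * pi) by ring.
rewrite -mulrDr ler_pM2l// => /le_trans; apply; rewrite lerD2l.
have pi0 := pi_gt0 R.
have -> : b * e' * pi = e * (b / (b + 1)) by rewrite /e'; field; rewrite !gt_eqF//; lra.
by rewrite ler_piMr ?(ltW e0)// ler_pdivrMr; lra.
Qed.

Lemma riesz_bergman_poly p P (c : R) : 1 < p -> c != 0 ->
  complex.Re P.[0] ^+ 2 = c ^+ 2 -> complex.Im P.[0] ^+ 2 = c ^+ 2 ->
  riesz_const p `^ p ^+ 2 * dint (fun z => `|complex.Re P.[z]| `^ (2 * p)) <=
  (cos (pi / (4 * p)) `^ p) ^+ 2 * pi * cmean (fun z => `|complex.Re P.[z]| `^ p) ^+ 2.
Proof.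
move=> p1 c0 e1 e2; have p0 : 0 < p by lra.
have -> : (fun z => `|complex.Re P.[z]| `^ (2 * p)) = (fun z => (`|complex.Re P.[z]| `^ p) ^+ 2).
  by apply/funext => z; rewrite powR_sqr.
have h1 := riesz_disk p1 c0 e1 e2; have h2 := riesz_circle p1 c0 e1 e2.
have h3 := carleman P p0.
have : 0 <= cmean (fun z => normc P.[z] `^ p).
  by apply: cmean_ge0; [exact: continuousC_normc_powR|move=> z _; exact: powR_ge0].
move: h1 h2 h3; set k := riesz_const p `^ p; set l := cos _ `^ p.
have k0 : 0 <= k by exact: powR_ge0.
have pi0 := pi_gt0 R.
move: (dint _) (dint _) (cmean _) (cmean _) => X Y M m h1 h2 h3 m0.
apply: (le_trans (ler_wpM2l (sqr_ge0 k) h1)).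
rewrite mulrCA -mulrA ler_wpM2l ?sqr_ge0//.
apply: (le_trans (ler_wpM2l (sqr_ge0 k) h3)).
rewrite mulrCA ler_pM2l// -exprMn.
have km : 0 <= k * m by rewrite mulr_ge0.
by rewrite ler_sqr ?nnegrE// (le_trans km).
Qed.

Lemma sub4_sub_Re (u : C -> R) Q z : sub4 u z -> sub4 (fun w => u w - complex.Re Q.[w]) z.
Proof.
move=> su; have -> : (fun w => u w - complex.Re Q.[w]) = (fun w => u w + complex.Re (- Q).[w]).
  by apply/funext => w; rewrite hornerN ReN.
by apply: sub4D => //; exact: sub4_Re.
Qed.

(** Q is built from the boundary values alone; the maximum principle for u - Re Q and for its
    opposite carries the bound inside. *)
Lemma harmonic_approx (u : C -> R) (e : R) : continuousC u ->
  (forall z, normc z < 1 -> sub4 u z) -> (forall z, normc z < 1 -> sub4 (fun w => - u w) z) ->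
  0 < e -> exists Q, forall z, normc z <= 1 -> `|u z - complex.Re Q.[z]| <= e.
Proof.
move=> cu su sNu e0; have [Q hQ] := fejer_continuous cu e0; exists Q => z z1.
have h1 : u z - complex.Re Q.[z] <= e.
  apply: (@max_principle R (fun z => u z - complex.Re Q.[z])) => //.
  - by apply: continuousCB => //; exact: continuousC_Re_horner.
  - by move=> w w1; have := hQ w w1; rewrite ler_norml => /andP[].
  - by move=> w w1 _; apply: sub4_sub_Re; exact: su.
have h2 : - u z - complex.Re (- Q).[z] <= e.
  apply: (@max_principle R (fun z => - u z - complex.Re (- Q).[z])) => //.
  - by apply: continuousCB; [exact: continuousCN|exact: continuousC_Re_horner].
  - by move=> w w1; have := hQ w w1; rewrite hornerN ReN ler_norml => /andP[]; lra.
  - by move=> w w1 _; apply: (@sub4_sub_Re (fun w => - u w)); exact: sNu.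
by rewrite hornerN ReN in h2; rewrite ler_norml; apply/andP; split; lra.
Qed.

Lemma riesz_bergman p (u : C -> R) : 1 < p -> continuousC u ->
  (forall z, normc z < 1 -> sub4 u z) -> (forall z, normc z < 1 -> sub4 (fun w => - u w) z) ->
  riesz_const p `^ p ^+ 2 * dint (fun z => `|u z| `^ (2 * p)) <=
  (cos (pi / (4 * p)) `^ p) ^+ 2 * pi * cmean (fun z => `|u z| `^ p) ^+ 2.
Proof.
move=> p1 cu su sNu; have p0 : 0 < p by lra.
(* The margin 3 accommodates |Re P| <= |u| + 3 e with e <= 1. *)
have [M0 hM0] := bounded_cdisk cu; pose M := M0 + 3.
pose L1 := p * M `^ (p - 1); pose L2 := 2 * p * M `^ (2 * p - 1).
have L10 : 0 <= L1 by rewrite mulr_ge0 ?powR_ge0// ltW.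
have L20 : 0 <= L2 by rewrite mulr_ge0 ?powR_ge0//; lra.
have cpow (G : C -> R) s : 0 < s -> continuousC G -> continuousC (fun z => `|G z| `^ s).
  by move=> s0 cG; apply: (continuousC_comp (k := fun x : R => `|x| `^ s)) => // z; exact: continuous_normr_powR.
set k := riesz_const p `^ p; set l := cos _ `^ p.
have step (e : R) : 0 < e <= 1 ->
  k ^+ 2 * (dint (fun z => `|u z| `^ (2 * p)) - L2 * (3 * e) * pi) <=
  l ^+ 2 * pi * (cmean (fun z => `|u z| `^ p) + L1 * (3 * e)) ^+ 2.
  move=> /andP[e0 e1]; have [Q hQ] := harmonic_approx cu su sNu e0.
  (* The value of u at 0, moved off 0 if necessary, since P(0) must not vanish. *)
  pose c := if u 0 == 0 then e else u 0.
  have c0 : c != 0 by rewrite /c; case: ifPn => // _; rewrite gt_eqF.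
  have cu0 : `|c - u 0| <= e.
    by rewrite /c; case: ifPn => [/eqP->|_]; [rewrite subr0 gtr0_norm|rewrite subrr normr0 ltW].
  (* Only the constant term changes. The approximation by Q, its value at 0 and the choice of c each
     cost e, hence 3 e. *)
  pose P := Q - Q.[0]%:P + (c +i* c)%C%:P.
  have P0 : P.[0] = (c +i* c)%C by rewrite /P !hornerE subrr add0r.
  have uP z : normc z <= 1 -> `|u z - complex.Re P.[z]| <= 3 * e.
    move=> z1; rewrite /P !hornerD hornerN !hornerC !ReD ReN/=.
    have := hQ z z1; have := hQ 0; rewrite normc0 => /(_ ler01).
    by move: cu0; rewrite !ler_norml => /andP[? ?] /andP[? ?] /andP[? ?]; apply/andP; split; lra.
  have uM z : normc z <= 1 -> `|u z| <= M.
    by move=> z1; rewrite /M; have := hM0 z z1; lra.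
  have PM z : normc z <= 1 -> `|complex.Re P.[z]| <= M.
    move=> z1; have := uP z z1; have := hM0 z z1; rewrite /M !ler_norml => /andP[? ?] /andP[? ?].
    by apply/andP; split; lra.
  have lip s z : 1 < s -> normc z <= 1 ->
      `| `|u z| `^ s - `|complex.Re P.[z]| `^ s | <= s * M `^ (s - 1) * (3 * e).
    move=> s1 z1; apply: (le_trans (normr_powR_lipschitz s1 (uM z z1) (PM z z1))).
    by rewrite ler_wpM2l ?uP// mulr_ge0 ?powR_ge0//; lra.
  have cP := @continuousC_Re_horner R P.
  have d1 : dint (fun z => `|u z| `^ (2 * p)) - L2 * (3 * e) * pi <= dint (fun z => `|complex.Re P.[z]| `^ (2 * p)).
    rewrite lerBlDr -dint_cst -dintD; last 2 first.
    - by apply: cpow => //; lra.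
    - exact: continuousC_cst.
    apply: dint_le; first by apply: cpow => //; lra.
      by apply: continuousCD; [apply: cpow => //; lra|exact: continuousC_cst].
    move=> z z1; have := @lip (2 * p) z _ z1; rewrite -/L2 ler_norml => h.
    have /h/andP[] : 1 < 2 * p by lra.
    lra.
  have d2 : cmean (fun z => `|complex.Re P.[z]| `^ p) <= cmean (fun z => `|u z| `^ p) + L1 * (3 * e).
    rewrite -[X in _ + X]cmean_cst -cmeanD; last 2 first.
    - exact: cpow.
    - exact: continuousC_cst.
    apply: cmean_le; first exact: cpow.
      by apply: continuousCD; [exact: cpow|exact: continuousC_cst].
    move=> z z1; have := @lip p z p1; rewrite z1 => /(_ (lexx _)); rewrite -/L1 ler_norml => /andP[]; lra.
  have Pe1 : complex.Re P.[0] ^+ 2 = c ^+ 2 by rewrite P0.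
  have Pe2 : complex.Im P.[0] ^+ 2 = c ^+ 2 by rewrite P0.
  have := riesz_bergman_poly p1 c0 Pe1 Pe2; rewrite -/k -/l => main.
  apply: (le_trans (ler_wpM2l (sqr_ge0 k) d1)); apply: (le_trans main).
  rewrite ler_wpM2l//; first by rewrite mulr_ge0 ?sqr_ge0// pi_ge0.
  rewrite ler_sqr ?nnegrE//; last apply: le_trans d2.
    by apply: cmean_ge0; [exact: cpow|move=> z _; exact: powR_ge0].
  by apply: cmean_ge0; [exact: cpow|move=> z _; exact: powR_ge0].
set D := dint _ in step *; set m := cmean _ in step *.
have c1 (a : R) : (fun N => a * (3 * (@harmonic R) N)) @ \oo --> a * (3 * 0).
  by apply: cvgM; [exact: cvg_cst|apply: cvgM; [exact: cvg_cst|exact: cvg_harmonic]].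
have l1 : (fun N => k ^+ 2 * (D - L2 * (3 * (@harmonic R) N) * pi)) @ \oo --> k ^+ 2 * (D - L2 * (3 * 0) * pi).
  apply: cvgM; first exact: cvg_cst.
  by apply: cvgB; [exact: cvg_cst|apply: cvgM; [exact: c1|exact: cvg_cst]].
have l2 : (fun N => l ^+ 2 * pi * (m + L1 * (3 * (@harmonic R) N)) ^+ 2) @ \oo --> l ^+ 2 * pi * (m + L1 * (3 * 0)) ^+ 2.
  apply: cvgM; first exact: cvg_cst.
  apply: (@cvg_comp _ _ _ (fun N => m + L1 * (3 * (@harmonic R) N)) (fun x : R => x ^+ 2)); last exact: exprn_continuous.
  by apply: cvgD; [exact: cvg_cst|exact: c1].
rewrite !mulr0 mul0r subr0 in l1; rewrite !mulr0 addr0 in l2.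
apply: (ler_cvg_to l1 l2).
apply: nearW => N; apply: step; rewrite /harmonic/= invr_gt0 ltr0n/=.
by rewrite invf_le1 ?ltr0n// ler1n.
Qed.



End riesz.

(** * Harmonic functions *)

Section harmonic_functions.
Variable R : realType.
Local Notation C := R[i].
Local Notation mu := (@lebesgue_measure R).
Local Notation mu2 := (mu \x mu)%E.
Local Notation T := (measurableTypeR R).
Local Notation cpx := (@cpx R).
Local Notation D := (unit_disk R).
Implicit Types (f : R * R -> R).

Lemma is_derive_partialx f (x y : R) : derivable f (x, y) ((1, 0) : R * R) ->
  is_derive x 1 (fun t : R => f (t, y)) (partialx f (x, y)).
Proof.
have E : (fun h : R => h^-1 *: (f (h *: 1 + x, y) - f (x, y))) =
    (fun h : R => h^-1 *: (f (h *: ((1, 0) : R * R) + (x, y)) - f (x, y))).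
  apply/funext => h; congr (_ *: (f _ - _)).
  by rewrite -[RHS]/(h *: 1 + x, h *: 0 + y) scaler0 add0r.
by rewrite /derivable -E => df; split; [exact: df|rewrite /partialx /derive -E].
Qed.

Lemma is_derive_partialy f (x y : R) : derivable f (x, y) ((0, 1) : R * R) ->
  is_derive y 1 (fun t : R => f (x, t)) (partialy f (x, y)).
Proof.
have E : (fun h : R => h^-1 *: (f (x, h *: 1 + y) - f (x, y))) =
    (fun h : R => h^-1 *: (f (h *: ((0, 1) : R * R) + (x, y)) - f (x, y))).
  apply/funext => h; congr (_ *: (f _ - _)).
  by rewrite -[RHS]/(h *: 0 + x, h *: 1 + y) scaler0 add0r.
by rewrite /derivable -E => df; split; [exact: df|rewrite /partialy /derive -E].
Qed.

Lemma unit_disk_box (z : R * R) : D z -> exists2 d : R, 0 < d &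
  forall w : R * R, `|w.1 - z.1| < d -> `|w.2 - z.2| < d -> D w.
Proof.
move=> /unit_diskE z1; pose d := (1 - normc (cpx z)) / 2.
have d0 : 0 < d by rewrite divr_gt0// subr_gt0.
exists d => // w w1 w2; apply/unit_diskE.
have -> : cpx w = cpx z + ((w.1 - z.1)%:C%C + (0 +i* (w.2 - z.2))%C).
  by apply: eqC; rewrite /= ?ReD ?ImD/=; ring.
apply: (le_lt_trans (le_normcD _ _)); apply: (le_lt_trans (lerD (lexx _) (le_normcD _ _))).
rewrite normcR (_ : normc (0 +i* _)%C = `|w.2 - z.2|); last by rewrite /normc expr0n add0r sqrtr_sqr.
by move: w1 w2; rewrite /d; lra.
Qed.

Lemma mean_value_le (k dk : R -> R) (a b K : R) :
  (forall t, Num.min a b <= t <= Num.max a b -> is_derive t 1 k (dk t)) ->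
  (forall t, Num.min a b <= t <= Num.max a b -> `|dk t| <= K) ->
  `|k b - k a| <= K * `|b - a|.
Proof.
wlog ab : a b / a <= b.
  move=> h; have /orP[/h//|ba] := le_total a b.
  by rewrite minC maxC distrC [`|b - a|]distrC; exact: h.
rewrite min_l// max_r// => hd hK.
have [] := @MVT_segment R k dk a b ab.
- by move=> t; rewrite in_itv/= => /andP[/ltW at' /ltW tb]; apply: hd; rewrite at' tb.
- apply: derivable_within_continuous => t; rewrite in_itv/= => tab.
  by have [] := hd _ tab.
move=> t; rewrite in_itv/= => tab ->; rewrite normrM ler_wpM2r//; exact: hK.
Qed.

(** A nearby point is reached first along the vertical line, where the partial derivative in y gives
    continuity, then along a horizontal segment, on which [partialx] is bounded by its continuity at
    z. *)
Lemma C1_continuous f (z : R * R) : C1_on D f -> D z -> {for z, continuous f}.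
Proof.
move=> C1 Dz; have [d0 d00 hd0] := unit_disk_box Dz.
case: z Dz hd0 => x y Dz /= hd0.
have [_ dy cx _] := C1 _ Dz.
pose K := `|partialx f (x, y)| + 1.
have : \forall w \near nbhs (x, y), `|partialx f (x, y) - partialx f w| <= 1.
  by have /cvgrPdist_le := cx; apply.
move=> /nbhs_ballP[d1 /= d10 hd1].
have cy := is_derive1_continuous (is_derive_partialy dy).
apply/cvgrPdist_le => e e0.
have e2 : 0 < e / 2 by rewrite divr_gt0.
have /cvgrPdist_le/(_ _ e2)/nbhs_ballP[d2 /= d20 hd2] := cy.
have K0 : 0 < K by rewrite ltr_wpDl.
pose d := Num.min (Num.min d0 d1) (Num.min d2 (e / 2 / K)).
have dpos : 0 < d by rewrite !lt_min d00 d10 d20 divr_gt0.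
suff : nbhs ((x, y) : R * R) (fun w => `|f (x, y) - f w| <= e) by [].
apply/nbhs_ballP; exists d => //= -[x' y'] [/= bx by'].
move: bx by'; rewrite /ball/= !lt_min => /andP[/andP[bx0 bx1] /andP[_ bx3]] /andP[/andP[by0 by1] /andP[by2 _]].
have seg t : Num.min x x' <= t <= Num.max x x' -> `|x - t| <= `|x - x'|.
  have /orP[xx|xx] := le_total x x'; rewrite ?(min_l xx) ?(max_r xx) ?(min_r xx) ?(max_l xx) => /andP[t1 t2].
    by rewrite !ler0_norm; lra.
  by rewrite !ger0_norm; lra.
have h1 : `|f (x', y') - f (x, y')| <= K * `|x' - x|.
  apply: (@mean_value_le (fun t => f (t, y')) (fun t => partialx f (t, y'))) => t /seg tx.
    have Dt : D (t, y').
      by apply: hd0 => /=; rewrite distrC// (le_lt_trans tx).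
    by have [dt _ _ _] := C1 _ Dt; exact: is_derive_partialx.
  have h : `|partialx f (x, y) - partialx f (t, y')| <= 1.
    by apply: hd1; split => //=; exact: le_lt_trans tx bx1.
  have := ler_normB (partialx f (x, y)) (partialx f (x, y) - partialx f (t, y')).
  by rewrite opprB addrC subrK /K; lra.
have h2 : `|f (x, y) - f (x, y')| <= e / 2 by exact: hd2.
have h3 : K * `|x' - x| <= e / 2 by rewrite mulrC -ler_pdivlMr// distrC ltW.
have := ler_distD (f (x, y')) (f (x, y)) (f (x', y')).
by rewrite [`|f (x, y') - _|]distrC; lra.
Qed.

(** On the closed unit disk this is z -> r z; points outside are first projected radially onto the
    circle. Composition with f is then continuous on the whole plane, as [continuousC] demands. *)
Definition retract (r : R) (z : R * R) : R * R :=
  (r * z.1 / Num.max 1 (normc (cpx z)), r * z.2 / Num.max 1 (normc (cpx z))).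

Lemma continuous_retract r : continuous (retract r).
Proof.
have cm : continuousC (fun z : C => Num.max 1 (normc z)).
  apply: (continuousC_comp (k := fun x : R => Num.max 1 x)).
    by apply: (@continuousC_normc R id); [exact: continuousC_Re|exact: continuousC_Im].
  by move=> z; apply: continuous_max; [exact: cvg_cst|exact: cvg_id].
have ci : continuous (fun z : R * R => (Num.max 1 (normc (cpx z)))^-1).
  by move=> z; apply: cvgV; [rewrite gt_eqF// lt_max ltr01|exact: cm].
have c1 : continuous (fun z : R * R => r * z.1 / Num.max 1 (normc (cpx z))).
  by move=> z; apply: cvgM; [apply: cvgM; [exact: cvg_cst|exact: cvg_fst]|exact: ci].
have c2 : continuous (fun z : R * R => r * z.2 / Num.max 1 (normc (cpx z))).
  by move=> z; apply: cvgM; [apply: cvgM; [exact: cvg_cst|exact: cvg_snd]|exact: ci].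
by move=> z; exact: (cvg_pair (c1 z) (c2 z)).
Qed.

Lemma retractE r (z : R * R) : normc (cpx z) <= 1 -> retract r z = (r * z.1, r * z.2).
Proof. by move=> z1; rewrite /retract max_l// !divr1. Qed.

Lemma retract_unit_disk r z : 0 <= r < 1 -> D (retract r z).
Proof.
move=> /andP[r0 r1]; apply/unit_diskE.
set m := Num.max 1 (normc (cpx z)).
have m1 : 1 <= m by rewrite le_max lexx.
have mz : normc (cpx z) <= m by rewrite le_max lexx orbT.
have -> : cpx (retract r z) = (r / m)%:C%C * cpx z.
  by apply: eqC; rewrite ?ReMr ?ImMr /retract/= -/m; ring.
rewrite Normc.normcM normcR ger0_norm; last by rewrite divr_ge0//; lra.
rewrite mulrAC ltr_pdivrMr; last by lra.
rewrite mul1r; have := normc_ge0 (cpx z); nra.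
Qed.

(** One-variable expansions along the two axes: first-order terms cancel in pairs, and the
    second-order ones add up to h^2 times the Laplacian, which is 0. *)
Lemma harmonic_second_difference f (z : R * R) (e : R) : harmonic_on D f -> D z -> 0 < e ->
  exists2 d : R, 0 < d & forall h, `|h| < d ->
    `|f (z.1 + h, z.2) + f (z.1 - h, z.2) + f (z.1, z.2 + h) + f (z.1, z.2 - h) - 4 * f z| <= e * h ^+ 2.
Proof.
move=> [[C1 Cx Cy] lap] Dz e0; have [d0 d00 hd0] := unit_disk_box Dz.
have := lap _ Dz; rewrite /laplacian.
case: z Dz hd0 {lap} => x y Dz /= hd0 lap.
have e4 : 0 < e / 4 by rewrite divr_gt0.
have tx : taylor2 (fun t : R => f (t, y)) x (f (x, y)) (partialx f (x, y)) (partialx (partialx f) (x, y) / 2).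
  apply: (@taylor2_derive R (fun t : R => f (t, y)) (fun t : R => partialx f (t, y)) x d0 _ d00).
    move=> t tx; have Dt : D (t, y) by apply: hd0 => //=; rewrite subrr normr0.
    by have [dt _ _ _] := C1 _ Dt; exact: is_derive_partialx.
  by have [dt _ _ _] := Cx _ Dz; exact: is_derive_partialx.
have ty : taylor2 (fun t : R => f (x, t)) y (f (x, y)) (partialy f (x, y)) (partialy (partialy f) (x, y) / 2).
  apply: (@taylor2_derive R (fun t : R => f (x, t)) (fun t : R => partialy f (x, t)) y d0 _ d00).
    move=> t ty; have Dt : D (x, t) by apply: hd0 => //=; rewrite subrr normr0.
    by have [_ dt _ _] := C1 _ Dt; exact: is_derive_partialy.
  by have [_ dt _ _] := Cy _ Dz; exact: is_derive_partialy.
have [d1 d10 hd1] := tx _ e4; have [d2 d20 hd2] := ty _ e4.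
exists (Num.min d1 d2) => [|h]; first by rewrite lt_min d10.
rewrite lt_min => /andP[h1 h2].
have Nh1 : `|- h| < d1 by rewrite normrN. have Nh2 : `|- h| < d2 by rewrite normrN.
have a1 := hd1 _ h1; have a2 := hd1 _ Nh1; have a3 := hd2 _ h2; have a4 := hd2 _ Nh2.
rewrite sqrrN in a2 a4.
move: (partialx (partialx f) (x, y)) (partialy (partialy f) (x, y)) lap a1 a2 a3 a4 => a b lap.
have -> : b = - a by lra.
move: (h ^+ 2) => h2'.
rewrite !ler_norml => /andP[? ?] /andP[? ?] /andP[? ?] /andP[? ?]; apply/andP; split; lra.
Qed.

Definition dilate r f : C -> R := fun z => f (retract r (complex.Re z, complex.Im z)).

Lemma continuousC_dilate r f : 0 <= r < 1 -> harmonic_on D f -> continuousC (dilate r f).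
Proof.
move=> r01 [[C1 _ _] _] z.
apply: (@continuous_comp _ _ _ (retract r) f); first exact: continuous_retract.
by apply: C1_continuous => //; exact: retract_unit_disk.
Qed.

Lemma dilate_cross r f z : 0 <= r < 1 -> harmonic_on D f -> normc z < 1 ->
  forall e, 0 < e -> exists2 d : R, 0 < d & forall h, 0 < h < d ->
    `|cross (dilate r f) z h - 4 * dilate r f z| <= e * h ^+ 2.
Proof.
move=> r01 hf z1 e e0; have /andP[r0 r1] := r01.
have Dz : D (r * complex.Re z, r * complex.Im z).
  have := @retract_unit_disk r (complex.Re z, complex.Im z) r01.
  by rewrite retractE//; case: z z1 => ? ?; exact: ltW.
have [d d0 hd] := harmonic_second_difference hf Dz e0.
exists (Num.min d (1 - normc z)) => [|h]; first by rewrite lt_min d0 subr_gt0.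
rewrite lt_min => /andP[h0 /andP[hd' hz]].
have dE w : normc w <= 1 -> dilate r f w = f (r * complex.Re w, r * complex.Im w).
  by case: w => a b w1; rewrite /dilate retractE.
have nh : normc (h%:C%C : C) = h by rewrite normcR gtr0_norm.
have nih : normc (0 +i* h)%C = h by rewrite /normc expr0n add0r sqrtr_sqr gtr0_norm.
have le1 w : normc w = h -> normc (z + w) <= 1.
  by move=> wh; apply: (le_trans (le_normcD _ _)); rewrite wh; lra.
have rh : `|r * h| < d by rewrite ger0_norm; nra.
rewrite /cross !dE ?le1 ?normcN ?(ltW z1)//.
rewrite !ReD !ImD !ReN !ImN /= !oppr0 !addr0 !mulrDr !mulrN.
apply: (le_trans (hd _ rh)); rewrite ler_wpM2l ?(ltW e0)// exprMn ler_piMl ?sqr_ge0//.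
by rewrite expr_le1// ltW.
Qed.

Lemma sub4_dilate r f z : 0 <= r < 1 -> harmonic_on D f -> normc z < 1 ->
  sub4 (dilate r f) z /\ sub4 (fun w => - dilate r f w) z.
Proof.
move=> r01 hf z1; split=> e e0; have [d d0 hd] := dilate_cross r01 hf z1 e0;
  exists d => // h /hd; rewrite ler_norml => /andP[]; first by lra.
by rewrite /cross; lra.
Qed.

End harmonic_functions.

(** * Radial limits *)

Section main.
Variable R : realType.
Local Notation C := R[i].
Local Notation mu := (@lebesgue_measure R).
Local Notation mu2 := (mu \x mu)%E.
Local Notation T := (measurableTypeR R).
Local Notation cpx := (@cpx R).
Local Notation D := (unit_disk R).
Implicit Types (f : R * R -> R) (p r : R).

Lemma continuousC_dilate_powR p r f : 0 < p -> 0 <= r < 1 -> harmonic_on D f ->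
  continuousC (fun z => `|dilate r f z| `^ p).
Proof.
move=> p0 r01 hf; apply: (continuousC_comp (k := fun x : R => `|x| `^ p)).
  exact: continuousC_dilate.
by move=> z; exact: continuous_normr_powR.
Qed.

Lemma cmean_dilate_hardy p r f : 1 < p -> 0 <= r < 1 -> harmonic_on D f ->
  ((cmean (fun z => `|dilate r f z| `^ p) `^ p^-1)%:E <= hardy_norm p f)%E.
Proof.
move=> p1 r01 hf; have p0 : 0 < p by lra.
apply: ereal_sup_ubound; exists r => //.
rewrite -poweR_EFin; congr poweR.
rewrite /cmean EFinM; congr (_ * _)%E.
have E t : `|f (r * cos t, r * sin t)| `^ p = `|dilate r f (cis t)| `^ p.
  have t1 : normc (cpx (cos t, sin t)) <= 1 by rewrite -[cpx _]/(cis t) normc_cis.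
  by rewrite /dilate retractE.
under eq_integral do rewrite E.
rewrite /Rintegral fineK//.
apply: integrable_fin_num => //.
apply: (@continuous_segment_integrable R (fun t => `|dilate r f (cis t)| `^ p)).
exact: (continuous_cis (continuousC_dilate_powR p0 r01 hf)).
Qed.

Lemma dint_dilate_le p r f (H : R) : 1 < p -> 0 <= r < 1 -> harmonic_on D f ->
  hardy_norm p f = H%:E ->
  dint (fun z => `|dilate r f z| `^ (2 * p)) <= pi * (bergman_hardy_const p * H) `^ (2 * p).
Proof.
move=> p1 r01 hf hH; have p0 : 0 < p by lra.
have cm := continuousC_dilate_powR p0 r01 hf.
have m0 : 0 <= cmean (fun z => `|dilate r f z| `^ p).
  by apply: cmean_ge0 => // z _; exact: powR_ge0.
have := cmean_dilate_hardy p1 r01 hf; rewrite hH lee_fin => mH.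
have H0 : 0 <= H by apply: le_trans mH; exact: powR_ge0.
have mHp : cmean (fun z => `|dilate r f z| `^ p) <= H `^ p.
  rewrite -[leLHS]powRr1// -(mulVf (lt0r_neq0 p0)) powRrM.
  by rewrite ge0_ler_powR ?nnegrE ?powR_ge0// ltW.
have k0 := riesz_const_gt0 p1.
have s1 : 1 < 2 * p by lra.
have [a1 a2 a3 [a4 a5]] := contact_bounds s1.
rewrite mulrA -natrM in a4.
have cE : bergman_hardy_const p = cos (pi / (4 * p)) / riesz_const p.
  by rewrite /bergman_hardy_const /riesz_const; case: ifP.
have := riesz_bergman p1 (continuousC_dilate r01 hf)
  (fun z z1 => (sub4_dilate r01 hf z1).1) (fun z z1 => (sub4_dilate r01 hf z1).2).
set k := riesz_const p `^ p; set l := cos _ `^ p => main.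
have kp : 0 < k by exact: powR_gt0.
rewrite powR_sqr; last by rewrite cE mulr_ge0// divr_ge0// ltW.
rewrite powRM//; last by rewrite cE divr_ge0// ltW.
rewrite cE powRM ?invr_ge0 ?(ltW a4) ?(ltW k0)// -/l -(powR_inv1 (ltW k0)) -powRrM mulN1r powRN -/k.
rewrite -(ler_pM2l (exprn_gt0 2 kp)); apply: (le_trans main).
have -> : k ^+ 2 * (pi * (l / k * H `^ p) ^+ 2) = l ^+ 2 * pi * (H `^ p) ^+ 2.
  by field; rewrite gt_eqF.
rewrite ler_wpM2l//; first by rewrite mulr_ge0 ?sqr_ge0// pi_ge0.
by rewrite ler_sqr ?nnegrE// powR_ge0.
Qed.

Lemma limn_einf_le (a : (\bar R)^nat) (b : \bar R) :
  (forall n, (a n <= b)%E) -> (limn_einf a <= b)%E.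
Proof.
move=> ab; rewrite limn_einf_lim; apply: lime_le; first exact: is_cvg_einfs.
apply: nearW => n; apply: le_trans (ab n).
by apply: ereal_inf_lbound; exists n => //=.
Qed.

Lemma harmonic_integral_le p f (B : R) : 0 < p -> harmonic_on D f ->
  (forall r, 0 <= r < 1 -> dint (fun z => `|dilate r f z| `^ p) <= B) ->
  (\int[mu2]_(z in D) (`|f z| `^ p)%:E <= B%:E)%E.
Proof.
move=> p0 hf hB; pose r (n : nat) : R := 1 - harmonic n.
have r01 n : 0 <= r n < 1.
  rewrite /r subr_ge0 ltrBlDr ltrDl /harmonic/= invr_gt0 ltr0n andbT.
  by rewrite invf_le1 ?ltr0n// ler1n.
pose g n (z : T * T) := (`|dilate (r n) f (cpx z)| `^ p)%:E.
have cg n : continuousC (fun z => `|dilate (r n) f z| `^ p) by exact: continuousC_dilate_powR.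
have mg n : measurable_fun (D : set (T * T)) (g n).
  by apply: measurable_funTS; apply/measurable_EFinP; exact: (continuous_measurable_plane (cg n)).
have g0 n z : D z -> (0 <= g n z)%E by move=> _; rewrite lee_fin powR_ge0.
have lim z : D z -> limn_einf (g^~ z) = (`|f z| `^ p)%:E.
  move=> Dz; have z1 : normc (cpx z) <= 1 by apply/ltW/unit_diskE.
  suff cv : g^~ z @ \oo --> (`|f z| `^ p)%:E.
    by have [-> _] := cvg_limn_einf_sup cv.
  apply: cvg_EFin; first exact: nearW.
  apply: (@cvg_comp _ _ _ (fun n => dilate (r n) f (cpx z)) (fun x : R => `|x| `^ p)); last exact: continuous_normr_powR.
  have cf : {for z, continuous f} by have [[C1 _ _] _] := hf; exact: C1_continuous.
  have -> : (fun n => dilate (r n) f (cpx z)) = (fun n => f (r n * z.1, r n * z.2)).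
    by apply/funext => n; rewrite /dilate retractE//; case: z {Dz cf} z1.
  apply: (@cvg_comp _ _ _ (fun n => (r n * z.1, r n * z.2)) f); last exact: cf.
  have cr (a : R) : (fun n => r n * a) @ \oo --> a.
    rewrite -[X in _ --> X]mul1r -[X in X * a]subr0; apply: cvgM; last exact: cvg_cst.
    by apply: cvgB; [exact: cvg_cst|exact: cvg_harmonic].
  by case: z {Dz z1 cf} => x y; exact: (cvg_pair (cr x) (cr y)).
apply: (@le_trans _ _ (\int[mu2]_(z in D) limn_einf (g^~ z))%E).
  rewrite (eq_integral (fun z => limn_einf (g^~ z)))// => z; rewrite inE => Dz.
  by rewrite lim.
apply: (le_trans (fatou _ (@measurable_unit_disk R) mg g0)).
apply: limn_einf_le => n; rewrite /g.
rewrite (@dintE R (fun z => `|dilate (r n) f z| `^ p))//.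
by rewrite lee_fin hB.
Qed.

Lemma bergman_hardy_const_gt0 p : 1 < p -> 0 < bergman_hardy_const p.
Proof.
move=> p1; have s1 : 1 < 2 * p by lra.
have [_ _ _ [a4 _]] := contact_bounds s1; rewrite mulrA -natrM in a4.
have -> : bergman_hardy_const p = cos (pi / (4 * p)) / riesz_const p.
  by rewrite /bergman_hardy_const /riesz_const; case: ifP.
by rewrite divr_gt0// riesz_const_gt0.
Qed.

End main.

Theorem theorem1p1 (R : realType) (p : R) (f : R * R -> R) :
  1 < p -> harmonic_on (unit_disk R) f ->
  (bergman_norm (2 * p) f <= (bergman_hardy_const p)%:E * hardy_norm p f)%E.
Proof.
move=> p1 hf; have c0 := bergman_hardy_const_gt0 p1.
(* The radius 0 belongs to the supremum, so the Hardy norm is nonnegative and -oo is ruled out. *)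
have r0 : 0 <= (0 : R) < 1 by rewrite lexx ltr01.
have h0 := cmean_dilate_hardy p1 r0 hf.
have : (0 <= hardy_norm p f)%E by apply: le_trans h0; rewrite lee_fin powR_ge0.
case hH : (hardy_norm p f) => [H| |] // H0; last first.
  (* With an infinite Hardy norm the right side is +oo, because the constant is strictly
     positive. *)
  by rewrite gt0_muley ?lte_fin// leey.
rewrite lee_fin in H0.
have p2 : 0 < 2 * p by lra.
have CH0 : 0 <= bergman_hardy_const p * H by rewrite mulr_ge0// ltW.
have := harmonic_integral_le p2 hf (fun r r01 => dint_dilate_le p1 r01 hf hH).
rewrite /bergman_norm; set X := integral _ _ _ => XB.
have X0 : (0 <= X)%E by apply: integral_ge0 => z _; rewrite lee_fin powR_ge0.
have pV : 0 <= (pi : R)^-1 by rewrite invr_ge0 pi_ge0.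
rewrite -EFinM -[leRHS](_ : ((bergman_hardy_const p * H) `^ (2 * p))%:E `^ (2 * p)^-1 = _)%E; last first.
  by rewrite poweR_EFin -powRrM mulfV ?gt_eqF// powRr1.
apply: gt0_ler_poweR.
- by rewrite invr_ge0 ltW.
- by rewrite in_itv/= mule_ge0 ?leey.
- by rewrite in_itv/= lee_fin powR_ge0 leey.
apply: (le_trans (lee_wpmul2l _ XB)); first by rewrite lee_fin.
by rewrite -EFinM lee_fin mulKf// gt_eqF// pi_gt0.
Qed.
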